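(* Let $F\in L^2(Q_T)$, $U_0\in H^1_0(\Omega)$ with $\nabla\cdot(c^2\nabla U_0)\in L^2(\Omega)$, and $V_0\in H^1_0(\Omega)$. Then there exists a unique $(U_h,V_h)\in(Q_h(Q_T))^2$ such that $$\mathcal{A}((U_h,V_h),(\lambda_h,\chi_h))=(F,\lambda_h)_{L^2_e(Q_T)}-(c^2\nabla U_0,\nabla\lambda_h)_{L^2_e(Q_T)}-(V_0,\chi_h)_{L^2_e(Q_T)}$$ for all $(\lambda_h,\chi_h)\in(\partial_tQ_h(Q_T))^2$, and it satisfies $$\|(U_h,V_h)\|_{\mathcal{V}_{e,h}(Q_T)}\le 2\sqrt{C_\Omega^2/c_0^2+4T^2}\,\Bigl(\|F\|_{L^2_e(Q_T)}+\sqrt{T}\,\|\nabla\cdot(c^2\nabla U_0)\|_{L^2(\Omega)}+\sqrt{T}\,\|c\nabla V_0\|_{L^2(\Omega)}\Bigr).$$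
   Context: Setting: $\Omega\subset\mathbb{R}^d$ ($d\in\{1,2,3\}$) is a bounded Lipschitz polytopal domain, $T>0$, $Q_T=\Omega\times(0,T)$; $c\in L^\infty(\Omega)$ with $c(x)\ge c_0>0$ for a.e. $x\in\Omega$. $\nabla$ and $\nabla\cdot$ are the gradient and divergence in space. $C_\Omega>0$ is a constant in the Poincaré inequality $\|v\|_{L^2(\Omega)}\le C_\Omega\|\nabla v\|_{L^2(\Omega)}$ for all $v\in H^1_0(\Omega)$. $H^1_{0,\bullet}(0,T)=\{u\in H^1(0,T):u(0)=0\}$. $U_0$, $V_0$ are regarded as time-independent functions on $Q_T$ when they appear in space-time products. Discrete spaces: $S_{h_x}(\Omega)\subset H^1_0(\Omega)$ and $S_{h_t}(0,T)\subset H^1_{0,\bullet}(0,T)$ are finite-dimensional subspaces; $Q_h(Q_T)=S_{h_x}(\Omega)\otimes S_{h_t}(0,T)$ and $\partial_tQ_h(Q_T)=S_{h_x}(\Omega)\otimes\partial_tS_{h_t}(0,T)$, where $\partial_tS_{h_t}(0,T)$ is the space of derivatives of elements of $S_{h_t}(0,T)$. Weighted product: $(\chi,\lambda)_{L^2_e(Q_T)}=\int_0^T(\chi(\cdot,s),\lambda(\cdot,s))_{L^2(\Omega)}e^{-s/T}\,ds$, with norm $\|\cdot\|_{L^2_e(Q_T)}$. On the discrete spaces the bilinear form is $\mathcal{A}((U,V),(\lambda,\chi))=(\partial_tV,\lambda)_{L^2_e(Q_T)}+(c^2\nabla U,\nabla\lambda)_{L^2_e(Q_T)}-(\partial_tU,\chi)_{L^2_e(Q_T)}+(V,\chi)_{L^2_e(Q_T)}$.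 Discrete Newton potential: $\mathcal{N}^\Omega_{h_x}:L^2(\Omega)\to S_{h_x}(\Omega)$ is defined by $(c^2\nabla\mathcal{N}^\Omega_{h_x}u,\nabla v_{h_x})_{L^2(\Omega)}=(u,v_{h_x})_{L^2(\Omega)}$ for all $v_{h_x}\in S_{h_x}(\Omega)$; it is applied pointwise in time to functions in $L^2(Q_T)$, and $\|U\|_{\mathcal{N}^\Omega_{e,h}}=\|c\nabla\mathcal{N}^\Omega_{h_x}U\|_{L^2_e(Q_T)}$. Discrete norm: $\|(U_h,V_h)\|^2_{\mathcal{V}_{e,h}(Q_T)}=\|\partial_tU_h\|^2_{L^2_e(Q_T)}+\|\partial_tV_h\|^2_{\mathcal{N}^\Omega_{e,h}}+\|c\nabla U_h\|^2_{L^2_e(Q_T)}+\|V_h\|^2_{L^2_e(Q_T)}$. *)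

(* Defs.v *)
From HB Require Import structures.
From mathcomp Require Import all_boot all_order all_algebra.
From mathcomp Require Import all_classical all_reals all_analysis.
Set Implicit Arguments. Unset Strict Implicit. Unset Printing Implicit Defensive.
Import Order.TTheory GRing.Theory Num.Theory.
Import numFieldNormedType.Exports.
Local Open Scope classical_set_scope.
Local Open Scope ring_scope.

(* The library puts no sigma-algebra on 'rV[R]_n: take the product one, as it
   does for n.-tuple R *)
Section measurable_rV.
Context {R : realType} (n : nat).
Let coord (i : 'I_n) (x : 'rV[R]_n) : R := x ord0 i.
Let rV_set0 : g_sigma_preimage coord set0.
Proof. exact: sigma_algebra0. Qed.
Let rV_setC A : g_sigma_preimage coord A -> g_sigma_preimage coord (~` A).
Proof. exact: sigma_algebraC. Qed.
Let rV_bigcup (F : (set 'rV[R]_n)^nat) : (forall i, g_sigma_preimage coord (F i)) ->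
  g_sigma_preimage coord (\bigcup_i F i).
Proof. exact: sigma_algebra_bigcup. Qed.
HB.instance Definition _ := @isMeasurable.Build
  default_measure_display 'rV[R]_n (g_sigma_preimage coord)
  rV_set0 rV_setC rV_bigcup.
End measurable_rV.

Lemma measurable_rVP (R : realType) d (T : measurableType d) n (f : T -> 'rV[R]_n) :
  (forall i, measurable_fun setT (fun x => f x ord0 i)) -> measurable_fun setT f.
Proof.
move=> mf; pose coord (i : 'I_n) (x : 'rV[R]_n) : R := x ord0 i.
suff /= h : g_sigma_preimage (fun i => coord i \o f) `<=` measurable.
  by move: h; rewrite g_sigma_preimage_comp => h _ A mA; apply: h; exists A.
apply: smallest_sub; first exact: sigma_algebra_measurable.
case: n => [|n] in f mf coord *; first by rewrite big_ord0.
by rewrite -bigcup_mkord_ord; apply: bigcup_sub => i _ A [B mB <-]; exact: mf.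
Qed.

Lemma measurable_coord (R : realType) n (i : 'I_n) :
  measurable_fun setT (fun x : 'rV[R]_n => x ord0 i).
Proof.
move=> _ Y mY; rewrite setTI; apply: sub_sigma_algebra => /=.
rewrite -bigcup_seq/=; exists i => /=; first by rewrite mem_index_enum.
by exists Y => //; rewrite setTI.
Qed.

Section lebesgue_rV.
Context {R : realType}.
Implicit Type n : nat.

Definition rV_cons n (p : measurableTypeR R * 'rV[R]_n) : 'rV[R]_n.+1 :=
  row_mx p.1%:M p.2.

Definition rV_uncons n (x : 'rV[R]_n.+1) : measurableTypeR R * 'rV[R]_n :=
  (x ord0 ord0, rsubmx (x : 'rV_(1 + n))).

Lemma rV_consK n : cancel (@rV_cons n) (@rV_uncons n).
Proof.
move=> [a v]; rewrite /rV_uncons/= /rV_cons/= row_mxKr; congr pair.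
have H := row_mxEl (@scalar_mx R 1 a) v ord0 ord0.
rewrite [in RHS]mxE mulr1n in H; apply: etrans H.
by congr (row_mx _ _ _ _); exact: val_inj.
Qed.

Lemma rV_unconsK n : cancel (@rV_uncons n) (@rV_cons n).
Proof.
move=> x; apply: etrans (hsubmxK (x : 'rV_(1 + n))).
rewrite /rV_cons/=; congr (row_mx _ _).
apply/rowP => i; rewrite mxE [in RHS]mxE (ord1 i) mulr1n.
by congr (x _ _); exact: val_inj.
Qed.

Lemma measurable_rV_cons n : measurable_fun setT (@rV_cons n).
Proof.
apply: measurable_rVP => i; rewrite /rV_cons -[n.+1]/(1 + n)%N in i *.
case: (splitP i) => j ij.
  have -> : i = lshift n j by exact/val_inj.
  rewrite (_ : (fun _ => _) = fst)//; apply/funext => -[a v] /=.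
  by rewrite row_mxEl mxE (ord1 j) mulr1n.
have -> : i = rshift 1 j by exact/val_inj.
rewrite (_ : (fun _ => _) = (fun v : 'rV[R]_n => v ord0 j) \o snd).
  exact: measurableT_comp (measurable_coord _) measurable_snd.
by apply/funext => -[a v] /=; rewrite row_mxEr.
Qed.

Lemma measurable_rV_uncons n : measurable_fun setT (@rV_uncons n).
Proof.
apply/measurable_fun_pairP; split; first exact: measurable_coord.
apply: measurable_rVP => i.
rewrite (_ : (fun _ => _) = fun x : 'rV[R]_n.+1 => x ord0 (rshift 1 i)).
  exact: measurable_coord.
by apply/funext => x; rewrite /= mxE.
Qed.

Section step.
Variables (n : nat) (m : {sigma_finite_measure set 'rV[R]_n -> \bar R}).

Definition lebesgue_rV_step : set 'rV[R]_n.+1 -> \bar R :=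
  pushforward (lebesgue_measure \x m)%E (@rV_cons n).

Let step0 : lebesgue_rV_step set0 = 0%E.
Proof. by rewrite /lebesgue_rV_step /pushforward preimage_set0 measure0. Qed.

Let step_ge0 A : (0 <= lebesgue_rV_step A)%E.
Proof. exact: (measure_ge0 (lebesgue_measure \x m)%E). Qed.

Let step_sigma_additive : semi_sigma_additive lebesgue_rV_step.
Proof.
move=> F mF tF mUF; rewrite /lebesgue_rV_step /pushforward preimage_bigcup.
apply: measure_semi_sigma_additive.
- by move=> i; rewrite -[X in measurable X]setTI; exact: measurable_rV_cons.
- apply/trivIsetP => i j _ _ ij.
  by rewrite -preimage_setI; move/trivIsetP : tF => -> //; exact: preimage_set0.
- rewrite -preimage_bigcup -[X in measurable X]setTI.
  exact: measurable_rV_cons.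
Qed.

HB.instance Definition _ := isMeasure.Build _ _ _ lebesgue_rV_step
  step0 step_ge0 step_sigma_additive.

Let step_sigma_finite : sigma_finite setT lebesgue_rV_step.
Proof.
have /sigma_finiteP[F [TF ndF Foo]] := sigma_finiteT (@lebesgue_measure R).
have /sigma_finiteP[G [TG ndG Goo]] := sigma_finiteT m.
exists (fun k => @rV_uncons n @^-1` (F k `*` G k)).
  rewrite -preimage_bigcup -[LHS](preimage_setT (@rV_uncons n)); congr (_ @^-1` _).
  rewrite -setXTT TF TG predeqE => -[x y]; split.
    move=> [/= [i _ Fix] [k _ Gky]]; exists (maxn i k) => //; split.
    - by move: x Fix; exact/subsetPset/ndF/leq_maxl.
    - by move: y Gky; exact/subsetPset/ndG/leq_maxr.
  by move=> [i _ []/= ? ?]; split; exists i.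
move=> k; have [mF Fk] := Foo k; have [mG Gk] := Goo k; split.
  by rewrite -[X in measurable X]setTI; apply: measurable_rV_uncons => //;
    exact: measurableX.
rewrite /lebesgue_rV_step /pushforward -comp_preimage.
rewrite (_ : _ \o _ = id); last by apply/funext => x /=; rewrite rV_consK.
by rewrite preimage_id product_measure1E// lte_mul_pinfty// ge0_fin_numE.
Qed.

HB.instance Definition _ := Measure_isSigmaFinite.Build _ _ _ lebesgue_rV_step
  step_sigma_finite.
End step.

(* n-dimensional Lebesgue measure: the image of the product of the measures on
   R and on R^(n-1) under the identification (a, v) |-> [a | v] *)
Fixpoint lebesgue_rV n : {sigma_finite_measure set 'rV[R]_n -> \bar R} :=
  if n is k.+1 then lebesgue_rV_step (lebesgue_rV k)
  else \d_(0 : 'rV[R]_0).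

End lebesgue_rV.

Section square_integrable_functions.
Context dT (T : measurableType dT) (R : realType).
Variables (mu : {measure set T -> \bar R}) (D : set T).
Implicit Types f g : T -> R.

Definition square_integrable f :=
  measurable_fun D f /\ mu.-integrable D (fun x => (f x ^+ 2)%:E).

Definition dotL2 f g : R := \int[mu]_(x in D) (f x * g x).

Definition normL2 f : R := Num.sqrt (dotL2 f f).

(* Elements of L^2 are represented by functions, so the spanning condition is up
   to equality almost everywhere; H plays the role of the ambient space *)
Definition finite_dim_subspace (H S : set (T -> R)) :=
  [/\ S `<=` H,
      S (fun=> 0),
      forall a f g, S f -> S g -> S (fun x => a * f x + g x) &
      exists (m : nat) (b : 'I_m -> T -> R), (forall k, S (b k)) /\
        forall f, S f -> exists a : 'I_m -> R,
          ae_eq mu D f (fun x => \sum_k a k * b k x)].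

End square_integrable_functions.

Section test_functions.
Context {R : realType} {V : normedModType R}.
Implicit Types (f : V -> R) (D : set V).

Fixpoint Ck (k : nat) f : Prop :=
  if k is k'.+1 then
    continuous f /\
    forall v, (forall x, derivable f x v) /\ Ck k' (fun x => 'D_v f x)
  else continuous f.

Definition smooth f := forall k, Ck k f.

Definition test_function D f :=
  smooth f /\
  exists K, [/\ compact K, K `<=` D & forall x, ~ K x -> f x = 0].

End test_functions.

Section polytopal_domains.
Context {R : realType} {d : nat}.
Implicit Types Omega : set 'rV[R]_d.

Definition convex_hull (s : seq 'rV[R]_d) : set 'rV[R]_d :=
  [set x | exists a : 'I_(size s) -> R,
     [/\ forall i, 0 <= a i, \sum_i a i = 1 & x = \sum_i a i *: s`_i]].

Definition polytopal Omega :=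
  exists P : seq (seq 'rV[R]_d),
    closure Omega = \bigcup_(s in [set` P]) convex_hull s.

(* Near each boundary point, after the orthogonal change of coordinates
   y |-> y *m Q, Omega lies above the graph of gamma; j is the index of the
   vertical coordinate and col' j drops it *)
Definition lipschitz_boundary Omega :=
  forall x, closure Omega x -> ~ Omega x ->
    exists (Q : 'M[R]_d) (j : 'I_d) (gamma : 'rV[R]_d.-1 -> R) (k : R),
      [/\ Q *m Q^T = 1%:M, k.-lipschitz gamma &
          \forall y \near x,
            Omega y <-> gamma (col' j (y *m Q)) < (y *m Q) ord0 j].

Definition lipschitz_polytopal_domain Omega :=
  [/\ Omega !=set0, open Omega, connected Omega, bounded_set Omega
    & lipschitz_boundary Omega /\ polytopal Omega].

End polytopal_domains.

Section space.
Context {R : realType} {d : nat} (Omega : set 'rV[R]_d).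
Implicit Types (v w : 'rV[R]_d -> R) (p q : 'rV[R]_d -> 'rV[R]_d).

Definition L2x := square_integrable (lebesgue_rV d) Omega.

Definition dotx v w : R := dotL2 (lebesgue_rV d) Omega v w.

Definition normx v : R := normL2 (lebesgue_rV d) Omega v.

Definition dotv_x p q : R :=
  \sum_(i < d) dotx (fun x => p x ord0 i) (fun x => q x ord0 i).

Definition normv_x p : R := Num.sqrt (dotv_x p p).

Definition classical_grad v : 'rV[R]_d -> 'rV[R]_d :=
  fun x => \row_i 'D_(delta_mx ord0 i) v x.

Definition is_weak_grad v p :=
  forall i : 'I_d, L2x (fun x => p x ord0 i) /\
    forall phi, test_function Omega phi ->
      dotx v ('D_(delta_mx ord0 i) phi) = - dotx (fun x => p x ord0 i) phi.

(* An arbitrary representative, and 0 when v has no gradient in L^2 *)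
Definition weak_grad v : 'rV[R]_d -> 'rV[R]_d :=
  xget (fun=> 0) [set p | is_weak_grad v p].

Definition H1x : set ('rV[R]_d -> R) :=
  [set v | L2x v /\ exists p, is_weak_grad v p].

Definition H10x : set ('rV[R]_d -> R) :=
  [set v | H1x v /\ forall e : R, 0 < e ->
     exists phi, test_function Omega phi /\
       normx (v \- phi) ^+ 2 + normv_x (weak_grad v \- classical_grad phi) ^+ 2
         < e ^+ 2].

Definition is_weak_div p w :=
  L2x w /\ forall phi, test_function Omega phi ->
    dotv_x p (classical_grad phi) = - dotx w phi.

Definition has_L2_div p := exists w, is_weak_div p w.

Definition weak_div p : 'rV[R]_d -> R := xget (fun=> 0) [set w | is_weak_div p w].

Definition poincare_constant (C : R) :=
  forall v, H10x v -> normx v <= C * normv_x (weak_grad v).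

(* Determined almost everywhere when u is in L^2, by the Riesz theorem in Sx *)
Definition newton (c : 'rV[R]_d -> R) (Sx : set ('rV[R]_d -> R)) (u : 'rV[R]_d -> R) :
    'rV[R]_d -> R :=
  xget (fun=> 0) [set w | Sx w /\ forall v, Sx v ->
    dotv_x (fun x => c x ^+ 2 *: weak_grad w x) (weak_grad v) = dotx u v].

End space.

Section time.
Context {R : realType} (T : R).
Implicit Types u g : measurableTypeR R -> R.

Definition time_interval : set (measurableTypeR R) := `]0, T[%classic.

Definition L2t := square_integrable (@lebesgue_measure R) time_interval.

Definition is_weak_deriv u g :=
  L2t g /\ forall phi : measurableTypeR R -> R, test_function time_interval phi ->
    dotL2 (@lebesgue_measure R) time_interval u ('D_1 phi) =
    - dotL2 (@lebesgue_measure R) time_interval g phi.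

(* u(0) = 0 is a condition on the continuous representative of u *)
Definition H10_left : set (measurableTypeR R -> R) :=
  [set u | [/\ L2t u, exists g, is_weak_deriv u g &
     exists u' : R -> R, [/\ {within `[0, T], continuous u'}, u' 0 = 0 &
       ae_eq (@lebesgue_measure R) time_interval u u']]].

Definition derivatives (St : set (measurableTypeR R -> R)) :
    set (measurableTypeR R -> R) :=
  [set g | exists2 u, St u & is_weak_deriv u g].

End time.

Section space_time.
Context {R : realType} {d : nat} (Omega : set 'rV[R]_d) (T : R).
Local Notation spacetime := ('rV[R]_d * measurableTypeR R)%type.
Implicit Types (U V F G lambda chi : spacetime -> R) (P Q : spacetime -> 'rV[R]_d).

Definition lebesgue_xt : {measure set spacetime -> \bar R} :=
  (lebesgue_rV d \x lebesgue_measure)%E.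

Definition cylinder : set spacetime := Omega `*` time_interval T.

Definition L2xt := square_integrable lebesgue_xt cylinder.

Definition is_weak_dt U G :=
  L2xt G /\ forall phi : spacetime -> R, test_function cylinder phi ->
    dotL2 lebesgue_xt cylinder U ('D_((0, 1) : spacetime) phi) =
    - dotL2 lebesgue_xt cylinder G phi.

Definition weak_dt U : spacetime -> R := xget (fun=> 0) [set G | is_weak_dt U G].

(* The gradient is taken slicewise in time, so only the integrals over the
   slices, as in dotv_e below, are independent of the representatives *)
Definition gradx U : spacetime -> 'rV[R]_d :=
  fun z => weak_grad Omega (fun x => U (x, z.2)) z.1.

(* Functions of x seen as time-independent functions on the cylinder *)
Definition time_independent {A : Type} (v : 'rV[R]_d -> A) : spacetime -> A := fun z => v z.1.

Definition tensor (Sx : set ('rV[R]_d -> R)) (St : set (measurableTypeR R -> R)) :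
    set (spacetime -> R) :=
  [set U | L2xt U /\ exists (m : nat) (v : 'I_m -> 'rV[R]_d -> R)
     (u : 'I_m -> measurableTypeR R -> R),
     [/\ forall k, Sx (v k), forall k, St (u k) &
       ae_eq lebesgue_xt cylinder U (fun z => \sum_k v k z.1 * u k z.2)]].

Definition dot_e U V : R :=
  \int[lebesgue_measure]_(s in time_interval T)
    (dotx Omega (fun x => U (x, s)) (fun x => V (x, s)) * expR (- (s / T))).

Definition norm_e U : R := Num.sqrt (dot_e U U).

Definition dotv_e P Q : R :=
  \int[lebesgue_measure]_(s in time_interval T)
    (dotv_x Omega (fun x => P (x, s)) (fun x => Q (x, s)) * expR (- (s / T))).

Definition normv_e P : R := Num.sqrt (dotv_e P P).

Variable c : 'rV[R]_d -> R.

Definition formA U V lambda chi : R :=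
  dot_e (weak_dt V) lambda
  + dotv_e (fun z => c z.1 ^+ 2 *: gradx U z) (gradx lambda)
  - dot_e (weak_dt U) chi + dot_e V chi.

Variables (Sx : set ('rV[R]_d -> R)) (St : set (measurableTypeR R -> R)).

Definition Qh : set (spacetime -> R) := tensor Sx St.

Definition dtQh : set (spacetime -> R) := tensor Sx (derivatives T St).

Definition newton_xt U : spacetime -> R :=
  fun z => newton Omega c Sx (fun x => U (x, z.2)) z.1.

Definition norm_newton U : R := normv_e (fun z => c z.1 *: gradx (newton_xt U) z).

Definition norm_V U V : R :=
  Num.sqrt (norm_e (weak_dt U) ^+ 2 + norm_newton (weak_dt V) ^+ 2
            + normv_e (fun z => c z.1 *: gradx U z) ^+ 2 + norm_e V ^+ 2).

Definition discrete_solution F (U0 V0 : 'rV[R]_d -> R) U V :=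
  [/\ Qh U, Qh V &
    forall lambda chi, dtQh lambda -> dtQh chi ->
      formA U V lambda chi =
      dot_e F lambda
      - dotv_e (fun z => c z.1 ^+ 2 *: gradx (time_independent U0) z) (gradx lambda)
      - dot_e (time_independent V0) chi].

End space_time.

Arguments lebesgue_xt : clear implicits.

(* Main.v *)
Require Import Defs.
From mathcomp Require Import all_boot all_order all_algebra.
From mathcomp Require Import all_classical all_reals all_analysis measurable_realfun.
From mathcomp Require Import ring lra.
Import Order.TTheory GRing.Theory Num.Theory.
Import numFieldNormedType.Exports.
Local Open Scope classical_set_scope.
Local Open Scope ring_scope.
Set Implicit Arguments. Unset Strict Implicit. Unset Printing Implicit Defensive.

(** Let e_k be the eigenvectors of the discrete operator in S_hx: they are orthonormal in
    L^2(Omega) and orthogonal for the energy (c^2 grad v, grad w), with eigenvalues lam_k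
    ([eigenbasis], a simultaneous diagonalization by Rayleigh quotients). A function of
    Q_h is a sum of products e_k(x) u_k(t) with u_k in S_ht, and testing with the products
    of e_k and a function of time decouples the discrete problem into one problem in time
    for each k ([discrete_solution_modes]): find u, v in S_ht with
<<
      (v', l) + lam_k (u, l) = (f_k, l)   and   - (u', l) + (v, l) = - v0_k (1, l)
>>
    for all l in the space of derivatives, in the product of L^2(0, T) with weight e^(-t/T).
    Here v0_k is the coefficient of V0, and f_k is the coefficient of the force
    F + div (c^2 grad U0): the term of U0 is integrated by parts in space
    ([weak_div_energy]).

    As a function u of S_ht is the primitive of its derivative ([H10_left_prim]), the unknowns
    are the derivatives g = u' and h = v', trial and test spaces coincide, and the decay of the weight
    makes the form coercive: (u, u') >= |u|^2 / (2 T) ([dot_prim_ge]). So the square linear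
    system has only the zero solution without data, hence exactly one solution for all
    data ([mode_solution_exists], [mode_solution_unique]).

    In the modal coefficients, the square of the discrete norm is the sum over k of
<<
      |u'|^2 + lam_k^-1 |v'|^2 + lam_k |u|^2 + |v|^2,
>>
    because the Newton potential divides by lam_k ([norm_V_modal]). Let kap = C_Omega / c0, so that
    kap^2 lam_k >= 1 by Poincare's inequality. For v0 = 0 this sum is at most
    4 (kap^2 + 4 T^2) |f|^2 ([mode_solution_forced]); for f = 0 it is at most 4 T v0^2
    ([mode_solution_initial]). The second bound is the delicate one: as lam_k^-1 is
    bounded by kap^2 only, it must not lose a power of lam_k, and it is obtained from the
    weighted integration by parts for the pairs among u and v + v0. Summing over k with
    Bessel's inequality, the response to the force is at most K times the norm of the force, with
    K^2 = 4 (kap^2 + 4 T^2), and the response to V0 is at most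
    2 sqrt(T) |V0| <= 2 sqrt(T) kap |c grad V0|, hence at most K sqrt(T) |c grad V0|.
    Minkowski's inequality adds the two.

    The other parts relate these computations to the weak notions. Products of smooth bumps
    are dense enough to make weak derivatives unique ([L2xt_orthogonal_eq0],
    [L2t_orthogonal_eq0]); weak gradients are linear on H^1_0 because its elements are limits of
    test functions ([weak_grad_linear]); the time derivative of a modal expansion is taken
    coefficient by coefficient ([weak_dt_modal]); and gradients, being chosen slice by slice
    in time, are only integrated after being replaced, at almost every time, by those of the
    modal expansion ([ae_slice_grad], [ae_eq_Rintegral_any]). *)

(** * Square integrable functions *)

(** The value at the minimum - B / A; a nonnegative polynomial with A = 0 is affine,
    hence constant. *)
Lemma sqr_le_of_quadratic_ge0 (R : realFieldType) (A B C : R) :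
  (forall t, 0 <= t ^+ 2 * A + 2 * t * B + C) -> 0 <= A -> B ^+ 2 <= A * C.
Proof.
move=> H; rewrite le_eqVlt => /predU1P[A0|A0].
  have [->|Bn] := eqVneq B 0; first by rewrite -A0 mul0r expr0n.
  have := H (- (C + 1) / (2 * B)).
  have -> : 2 * (- (C + 1) / (2 * B)) * B = - (C + 1) by field.
  by rewrite -A0 mulr0 add0r opprD addrAC addNr add0r oppr_ge0 ler10.
have := H (- B / A).
have -> : (- B / A) ^+ 2 * A + 2 * (- B / A) * B + C = (A * C - B ^+ 2) / A.
  by field; rewrite gt_eqF.
by rewrite pmulr_lge0 ?invr_gt0// subr_ge0.
Qed.

Section L2.
Context {dX : measure_display} {X : measurableType dX} {R : realType}.
Variables (mu : {measure set X -> \bar R}) (D : set X).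
Hypothesis mD : measurable D.
Implicit Types f g h : X -> R.
Local Notation sqi := (square_integrable mu D).
Local Notation dot := (dotL2 mu D).
Local Notation int f := (mu.-integrable D (EFin \o f)).

Lemma measurable_of_integrable f : int f -> measurable_fun D f.
Proof. by move=> /(measurable_int _)/measurable_EFinP. Qed.

Lemma le_integrableR f g : measurable_fun D f -> int g ->
  (forall x, D x -> `|f x| <= g x) -> int f.
Proof.
move=> mf ig fg; apply: le_integrable ig => //; first exact/measurable_EFinP.
by move=> x Dx /=; rewrite lee_fin (le_trans (fg x Dx))// ler_norm.
Qed.

Lemma integrableDR f g : int f -> int g -> int (fun x => f x + g x).
Proof. by move=> f1 g1; apply: eq_integrable (integrableD mD f1 g1). Qed.

Lemma integrableZR a f : int f -> int (fun x => a * f x).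
Proof. by move=> f1; apply: eq_integrable (integrableZl mD a f1). Qed.

Lemma integrable_sumR (I : Type) (r : seq I) (f : I -> X -> R) :
  (forall i, int (f i)) -> int (fun x => \sum_(i <- r) f i x).
Proof.
move=> If; elim: r => [|i r IH].
  by apply: eq_integrable (integrable0 _ _) => // x _; rewrite /= big_nil.
apply: eq_integrable (integrableDR (If i) IH) => // x _.
by rewrite /= big_cons.
Qed.

Lemma Rintegral_sum (I : Type) (r : seq I) (f : I -> X -> R) :
  (forall i, int (f i)) ->
  \int[mu]_(x in D) (\sum_(i <- r) f i x) = \sum_(i <- r) \int[mu]_(x in D) f i x.
Proof.
move=> If; elim: r => [|i r IH].
  rewrite big_nil; under eq_Rintegral do rewrite big_nil.
  by rewrite /Rintegral integral0.
rewrite big_cons -IH; under eq_Rintegral do rewrite big_cons.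
by rewrite RintegralD//; exact: integrable_sumR.
Qed.

Lemma ae_eq_Rintegral f g : measurable_fun D f -> measurable_fun D g ->
  ae_eq mu D f g -> \int[mu]_(x in D) f x = \int[mu]_(x in D) g x.
Proof.
move=> mf mg fg; congr fine; apply: ae_eq_integral => //; try exact/measurable_EFinP.
by apply: filterS fg => x fgx Dx; rewrite fgx.
Qed.

Lemma ae_eq_integrable f g : measurable_fun D g -> ae_eq mu D f g -> int f -> int g.
Proof.
move=> mg fg intf; have mf := measurable_of_integrable intf.
move/integrableP : intf => [mf' If]; apply/integrableP; split; first exact/measurable_EFinP.
rewrite (@ae_eq_integral _ _ _ mu D (fun x => `|(EFin \o f) x|%E))//.
- by apply: measurableT_comp => //; exact/measurable_EFinP.
- exact: measurableT_comp.
- by apply: filterS fg => x fgx Dx /=; rewrite fgx.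
Qed.

Lemma ae_le_Rintegral f g : int f -> int g ->
  {ae mu, forall x, D x -> f x <= g x} ->
  \int[mu]_(x in D) f x <= \int[mu]_(x in D) g x.
Proof.
move=> If Ig fg.
have mf := measurable_of_integrable If; have mg := measurable_of_integrable Ig.
(* h is below g everywhere and equal to f almost everywhere *)
pose h := fun x => Num.min (f x) (g x).
have mh : measurable_fun D h by exact: measurable_minr.
have fh : ae_eq mu D f h.
  by apply: filterS fg => x fgx Dx; rewrite /h min_l// fgx.
rewrite (ae_eq_Rintegral mf mh fh); apply: le_Rintegral => //.
  exact: ae_eq_integrable fh If.
by move=> x Dx; rewrite /h ge_min lexx orbT.
Qed.

Lemma Rintegral_eq0_ae f : int f -> (forall x, D x -> 0 <= f x) ->
  \int[mu]_(x in D) f x = 0 -> ae_eq mu D f (cst 0).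
Proof.
move=> If f0 I0; have mf := measurable_of_integrable If.
have : (\int[mu]_(x in D) `|(f x)%:E| = 0)%E.
  rewrite (@eq_integral _ _ _ mu D (fun x => (f x)%:E)); last first.
    by move=> x /set_mem Dx; rewrite gee0_abs// lee_fin f0.
  rewrite -[LHS]fineK; last exact: integrable_fin_num.
  by rewrite [fine _]I0.
move/(ae_eq_integral_abs mu mD ((measurable_EFinP _ _).2 mf)).1.
by apply: filterS => x + Dx => /(_ Dx) [].
Qed.

Lemma sqi_measurable f : sqi f -> measurable_fun D f. Proof. by case. Qed.

Lemma sqiM_integrable f g : sqi f -> sqi g -> int (fun x => f x * g x).
Proof.
move=> [mf If] [mg Ig].
apply: (le_integrableR (g := fun x => f x ^+ 2 + g x ^+ 2)).
- exact: measurable_funM.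
- exact: integrableDR.
- move=> x Dx; rewrite normrM.
  have := sqr_ge0 (`|f x| - `|g x|).
  by rewrite -(real_normK (num_real (f x))) -(real_normK (num_real (g x))); nra.
Qed.

Lemma sqi0 : sqi (fun=> 0).
Proof.
split; first exact: measurable_cst.
by apply: eq_integrable (integrable0 _ _) => // x _; rewrite expr0n.
Qed.

Lemma sqiD f g : sqi f -> sqi g -> sqi (fun x => f x + g x).
Proof.
move=> sf sg; have Ifg := sqiM_integrable sf sg; case: sf sg => [mf If] [mg Ig].
split; first exact: measurable_funD.
apply: eq_integrable (integrableDR (integrableDR If Ig) (integrableZR 2 Ifg)) => //.
by move=> x _ /=; congr EFin; ring.
Qed.

Lemma sqiZ a f : sqi f -> sqi (fun x => a * f x).
Proof.
move=> [mf If]; split; first exact: measurable_funM.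
by apply: eq_integrable (integrableZR (a ^+ 2) If) => // x _ /=; rewrite exprMn.
Qed.

Lemma sqiN f : sqi f -> sqi (fun x => - f x).
Proof. by move=> /(sqiZ (-1)); under eq_fun do rewrite mulN1r. Qed.

Lemma sqiB f g : sqi f -> sqi g -> sqi (fun x => f x - g x).
Proof. by move=> sf /sqiN; exact: sqiD. Qed.

Lemma sqi_sum (I : Type) (r : seq I) (a : I -> R) (f : I -> X -> R) :
  (forall i, sqi (f i)) -> sqi (fun x => \sum_(i <- r) a i * f i x).
Proof.
move=> sf; elim: r => [|i r IH].
  by under eq_fun do rewrite big_nil; exact: sqi0.
by under eq_fun do rewrite big_cons; apply: sqiD => //; exact: sqiZ.
Qed.

Lemma sqi_bounded M f g : measurable_fun D f ->
  {ae mu, forall x, D x -> `|f x| <= M} -> sqi g -> sqi (fun x => f x * g x).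
Proof.
move=> mf fM sg; have mg := sg.1; split; first exact: measurable_funM.
(* truncating f at level M does not change it almost everywhere *)
pose h x := Num.max (- `|M|) (Num.min (f x) `|M|).
have mh : measurable_fun D h by apply: measurable_maxr => //; exact: measurable_minr.
have hM x : `|h x| <= `|M|.
  have M0 := normr_ge0 M.
  by rewrite ler_norml /h le_max lexx/= ge_max ge_min lexx orbT andbT; lra.
apply: (@ae_eq_integrable (fun x => (h x * g x) ^+ 2)).
- by apply: measurable_funX; exact: measurable_funM.
- apply: filterS fM => x /[swap] Dx /(_ Dx) fxM; congr (_ ^+ 2); congr (_ * _).
  have /andP[f1 f2] : - `|M| <= f x <= `|M|.
    by rewrite -ler_norml (le_trans fxM)// ler_norm.
  by rewrite /h (min_l f2) max_r.
- apply: (le_integrableR (g := fun x => M ^+ 2 * g x ^+ 2)).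
  + by apply: measurable_funX; exact: measurable_funM.
  + by apply: integrableZR; case: sg.
  + move=> x _; rewrite normrX normrM exprMn -[M ^+ 2]real_normK ?num_real//.
    rewrite -[g x ^+ 2]real_normK ?num_real// ler_wpM2r ?sqr_ge0//.
    by rewrite lerXn2r ?nnegrE.
Qed.

Lemma ae_eq_dotL2 f f' g g' : measurable_fun D f -> measurable_fun D f' ->
  measurable_fun D g -> measurable_fun D g' ->
  ae_eq mu D f f' -> ae_eq mu D g g' -> dot f g = dot f' g'.
Proof.
move=> mf mf' mg mg' ff' gg'; apply: ae_eq_Rintegral; try exact: measurable_funM.
by apply: filterS2 ff' gg' => x fx gx Dx; rewrite fx ?gx.
Qed.

Lemma dotL2C f g : dot f g = dot g f.
Proof. by apply: eq_Rintegral => x _; rewrite mulrC. Qed.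

Lemma dotL2Dl f g h : sqi f -> sqi g -> sqi h ->
  dot (fun x => f x + g x) h = dot f h + dot g h.
Proof.
move=> sf sg sh; rewrite /dotL2; under eq_Rintegral do rewrite mulrDl.
by rewrite RintegralD//; exact: sqiM_integrable.
Qed.

Lemma dotL2Zl a f h : sqi f -> sqi h -> dot (fun x => a * f x) h = a * dot f h.
Proof.
move=> sf sh; rewrite /dotL2; under eq_Rintegral do rewrite -mulrA.
by rewrite RintegralZl//; exact: sqiM_integrable.
Qed.

Lemma dotL2Dr f g h : sqi f -> sqi g -> sqi h ->
  dot h (fun x => f x + g x) = dot h f + dot h g.
Proof. by move=> sf sg sh; rewrite dotL2C dotL2Dl// dotL2C (dotL2C g). Qed.

Lemma dotL2Zr a f h : sqi f -> sqi h -> dot h (fun x => a * f x) = a * dot h f.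
Proof. by move=> sf sh; rewrite dotL2C dotL2Zl// dotL2C. Qed.

Lemma dotL2Bl f g h : sqi f -> sqi g -> sqi h ->
  dot (fun x => f x - g x) h = dot f h - dot g h.
Proof.
move=> sf sg sh; rewrite dotL2Dl//; last exact: sqiN.
have := dotL2Zl (-1) sg sh; under eq_fun do rewrite mulN1r.
by rewrite mulN1r => ->.
Qed.

Lemma dotL2Br f g h : sqi f -> sqi g -> sqi h ->
  dot h (fun x => f x - g x) = dot h f - dot h g.
Proof. by move=> sf sg sh; rewrite dotL2C dotL2Bl// dotL2C (dotL2C g). Qed.

Lemma dotL2_0l h : dot (fun=> 0) h = 0.
Proof.
rewrite /dotL2; under eq_Rintegral do rewrite mul0r.
by rewrite /Rintegral integral0.
Qed.

Lemma dotL2_suml (I : Type) (r : seq I) (a : I -> R) (f : I -> X -> R) h :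
  (forall i, sqi (f i)) -> sqi h ->
  dot (fun x => \sum_(i <- r) a i * f i x) h = \sum_(i <- r) a i * dot (f i) h.
Proof.
move=> sf sh; elim: r => [|i r IH].
  by under eq_fun do rewrite big_nil; rewrite dotL2_0l big_nil.
rewrite big_cons -IH -dotL2Zl// -dotL2Dl//; [|exact: sqiZ|exact: sqi_sum].
by congr dotL2; apply/funext => x; rewrite big_cons.
Qed.

Lemma dotL2_sumr (I : Type) (r : seq I) (a : I -> R) (f : I -> X -> R) h :
  (forall i, sqi (f i)) -> sqi h ->
  dot h (fun x => \sum_(i <- r) a i * f i x) = \sum_(i <- r) a i * dot h (f i).
Proof.
by move=> sf sh; rewrite dotL2C dotL2_suml//; apply: eq_bigr => i _; rewrite dotL2C.
Qed.

Lemma dotL2_ge0 f : 0 <= dot f f.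
Proof. by apply: Rintegral_ge0 => x _; rewrite -expr2 sqr_ge0. Qed.

Lemma normL2_ge0 f : 0 <= normL2 mu D f. Proof. exact: sqrtr_ge0. Qed.

Lemma normL2_sqr f : normL2 mu D f ^+ 2 = dot f f.
Proof. by rewrite sqr_sqrtr// dotL2_ge0. Qed.

Lemma dotL2_eq0 f : sqi f -> dot f f = 0 -> ae_eq mu D f (cst 0).
Proof.
move=> sf ff0; have f0 x : D x -> 0 <= f x * f x by rewrite -expr2 sqr_ge0.
apply: filterS (Rintegral_eq0_ae (sqiM_integrable sf sf) f0 ff0) => x xf /xf /eqP.
by rewrite mulf_eq0 orbb => /eqP.
Qed.

Lemma dotL2_CS f g : sqi f -> sqi g -> dot f g ^+ 2 <= dot f f * dot g g.
Proof.
move=> sf sg; apply: sqr_le_of_quadratic_ge0; last exact: dotL2_ge0.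
move=> t; have stf := sqiZ t sf; have := dotL2_ge0 (fun x => t * f x + g x).
rewrite (dotL2Dl stf sg (sqiD stf sg)) !dotL2Dr// !dotL2Zl// !dotL2Zr// (dotL2C g f).
have alg (A B C : R) : t * (t * A) + t * B + (t * B + C) = t ^+ 2 * A + 2 * t * B + C by ring.
by rewrite alg.
Qed.

Lemma dotL2_le_norm f g : sqi f -> sqi g ->
  `|dot f g| <= normL2 mu D f * normL2 mu D g.
Proof.
move=> sf sg; rewrite -(@ler_pXn2r _ 2)// ?nnegrE ?mulr_ge0 ?normL2_ge0//.
by rewrite real_normK ?num_real// exprMn !normL2_sqr dotL2_CS.
Qed.

Lemma normL2D f g : sqi f -> sqi g ->
  normL2 mu D (fun x => f x + g x) <= normL2 mu D f + normL2 mu D g.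
Proof.
move=> sf sg; rewrite -(@ler_pXn2r _ 2)// ?nnegrE ?addr_ge0 ?normL2_ge0//.
rewrite normL2_sqr dotL2Dl// ?dotL2Dr//; try exact: sqiD.
rewrite sqrrD !normL2_sqr (dotL2C g f).
have := dotL2_le_norm sf sg; have := ler_norm (dot f g); lra.
Qed.

Lemma normL2Z a f : sqi f -> normL2 mu D (fun x => a * f x) = `|a| * normL2 mu D f.
Proof.
move=> sf; rewrite /normL2 dotL2Zl ?dotL2Zr//; try exact: sqiZ.
by rewrite mulrA -expr2 sqrtrM ?sqr_ge0// sqrtr_sqr.
Qed.

End L2.

(** * Integrals of functions equal almost everywhere to a measurable one *)

Section integral_without_measurability.
Local Open Scope ereal_scope.
Context {dX : measure_display} {X : measurableType dX} {R : realType}.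
Variables (mu : {measure set X -> \bar R}) (D : set X).
Hypothesis mD : measurable D.
Implicit Types f g : X -> \bar R.

Lemma ge0_le_integralT f g : (forall x, 0 <= f x) -> (forall x, f x <= g x) ->
  \int[mu]_x f x <= \int[mu]_x g x.
Proof.
move=> f0 fg; have g0 x : 0 <= g x by exact: le_trans (fg x).
rewrite !ge0_integralTE//; apply: le_ereal_sup => _ /= [h hf <-].
by exists h => // x; exact: le_trans (hf x) (fg x).
Qed.

(** The integral of a nonnegative function is a supremum over simple functions, measurable
    or not, hence monotone. It remains to enclose f between two modifications of g on a
    null set, by 0 and by infinity. *)
Lemma ge0_ae_eq_integralT f g : (forall x, 0 <= f x) -> (forall x, 0 <= g x) ->
  measurable_fun setT g -> ae_eq mu setT f g -> \int[mu]_x f x = \int[mu]_x g x.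
Proof.
move=> f0 g0 mg [N [mN N0 sub]].
have fg x : x \notin N -> f x = g x.
  by move=> xN; apply: contrapT => ne; move: xN; rewrite mem_set//; apply: sub => /= /(_ I).
pose lo x := if x \in N then 0 else g x.
pose hi x := if x \in N then +oo else g x.
have mI : measurable_fun setT (fun x => x \in N).
  apply: (measurable_fun_bool true); rewrite setTI.
  rewrite [X in measurable X](_ : _ = N); first exact: mN.
  by apply/seteqP; split=> x /=; [move/set_mem | move/mem_set].
have mlo : measurable_fun setT lo by apply: measurable_fun_ifT => //; exact: measurable_cst.
have mhi : measurable_fun setT hi by apply: measurable_fun_ifT => //; exact: measurable_cst.
have aelo : ae_eq mu setT lo g.
  exists N; split => // x /=; apply: contra_notP => xN _.
  by rewrite /lo memNset.
have aehi : ae_eq mu setT hi g.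
  exists N; split => // x /=; apply: contra_notP => xN _.
  by rewrite /hi memNset.
have lo0 x : 0 <= lo x by rewrite /lo; case: ifP.
have hi0 x : 0 <= hi x by rewrite /hi; case: ifP.
apply/eqP; rewrite eq_le; apply/andP; split.
  rewrite -(ge0_ae_eq_integral measurableT mhi mg (fun x _ => hi0 x) (fun x _ => g0 x) aehi).
  by apply: ge0_le_integralT => // x; rewrite /hi; case: ifPn => [|/fg->//]; rewrite leey.
rewrite -(ge0_ae_eq_integral measurableT mlo mg (fun x _ => lo0 x) (fun x _ => g0 x) aelo).
by apply: ge0_le_integralT => // x; rewrite /lo; case: ifPn => // /fg->.
Qed.

Lemma ge0_ae_eq_integral_any f g : (forall x, 0 <= f x) -> (forall x, 0 <= g x) ->
  measurable_fun D g -> ae_eq mu D f g -> \int[mu]_(x in D) f x = \int[mu]_(x in D) g x.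
Proof.
move=> f0 g0 mg fg; rewrite integral_mkcond [RHS]integral_mkcond.
apply: ge0_ae_eq_integralT.
- by move=> x; exact: erestrict_ge0.
- by move=> x; exact: erestrict_ge0.
- exact: (measurable_restrictT _ mD).1.
- apply: filterS fg => x H _; rewrite !patchE; case: ifPn => // /set_mem; exact: H.
Qed.

Lemma ae_eq_integral_any f g : measurable_fun D g -> ae_eq mu D f g ->
  \int[mu]_(x in D) f x = \int[mu]_(x in D) g x.
Proof.
move=> mg fg; rewrite integralE [RHS]integralE; congr (_ - _).
  apply: ge0_ae_eq_integral_any => //; first exact: measurable_funepos.
  by apply: filterS fg => x H Dx; rewrite !funeposE (H Dx).
apply: ge0_ae_eq_integral_any => //; first exact: measurable_funeneg.
by apply: filterS fg => x H Dx; rewrite !funenegE (H Dx).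
Qed.

(** Gradients and potentials are chosen separately on each time slice, so that nothing
    makes the integrands built from them measurable in time. *)
Lemma ae_eq_Rintegral_any (f g : X -> R) : measurable_fun D g -> ae_eq mu D f g ->
  (\int[mu]_(x in D) f x = \int[mu]_(x in D) g x)%R.
Proof.
move=> mg fg; congr fine; apply: ae_eq_integral_any; first exact/measurable_EFinP.
by apply: filterS fg => x H Dx; rewrite H.
Qed.

End integral_without_measurability.

(** * Fubini's theorem on rectangles *)

Section fubini_rectangle.
Context {dX dY : measure_display} {X : measurableType dX} {Y : measurableType dY}
  {R : realType}.
Variables (m1 : {sigma_finite_measure set X -> \bar R})
  (m2 : {sigma_finite_measure set Y -> \bar R}).
Variables (A : set X) (B : set Y).
Hypotheses (mA : measurable A) (mB : measurable B).
Local Notation mu := (m1 \x m2)%E.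

(** Tonelli's theorem for the indicator function of the exceptional set. *)
Lemma ae_sections (P : X * Y -> Prop) : {ae mu, forall z, P z} ->
  {ae m2, forall s, {ae m1, forall x, P (x, s)}}.
Proof.
move=> [N [mN N0 sub]].
have : ae_eq m2 setT (fun s => m1 (ysection N s)) (cst 0%E).
  apply/ae_eq_integral_abs => //; first exact: measurable_fun_ysection.
  have -> : (\int[m2]_s `|m1 (ysection N s)| = \int[m2]_s (m1 (ysection N s)))%E.
    by apply: eq_integral => s _; rewrite gee0_abs.
  transitivity (\int[mu]_z (\1_N z)%:E)%E; last by rewrite integral_indic// setIT.
  by rewrite indic_fubini_tonelli1// indic_fubini_tonelli// indic_fubini_tonelli_GE.
apply: filterS => s /(_ I) Ns0; exists (ysection N s); split => //.
  exact: measurable_ysection.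
by move=> x /= nP; rewrite /ysection/= inE; apply: sub.
Qed.

Lemma ae_eq_sections T (f g : X * Y -> T) : ae_eq mu (A `*` B) f g ->
  {ae m2, forall s, B s -> ae_eq m1 A (fun x => f (x, s)) (fun x => g (x, s))}.
Proof.
move/ae_sections; apply: filterS => s H Bs; apply: filterS H => x fg Ax.
exact: fg.
Qed.

Lemma measurable_section (f : X * Y -> R) s : measurable_fun (A `*` B) f -> B s ->
  measurable_fun A (fun x => f (x, s)).
Proof.
move=> mf Bs; rewrite (_ : (fun x => _) = f \o (fun x => (x, s)))//.
apply: measurable_comp mf _; first exact: measurableX.
  by move=> _ [x Ax <-].
exact: measurable_funTS (measurable_pair2 _).
Qed.

Lemma ae_product_fst (P : X -> Prop) : {ae m1, forall x, P x} ->
  {ae mu, forall z, P z.1}.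
Proof.
move=> [N [mN N0 sub]]; exists (N `*` setT); split.
- exact: measurableX.
- have -> := product_measure1E m1 m2 mN (@measurableT _ Y).
  by rewrite [X in (X * _)%E](_ : _ = 0%E)// mul0e.
- by move=> [x y] /= nP; split=> //; exact: sub.
Qed.

Lemma ae_product_snd (P : Y -> Prop) : {ae m2, forall x, P x} ->
  {ae mu, forall z, P z.2}.
Proof.
move=> [N [mN N0 sub]]; exists (setT `*` N); split.
- exact: measurableX.
- have -> := product_measure1E m1 m2 (@measurableT _ X) mN.
  by rewrite [X in (_ * X)%E](_ : _ = 0%E)// mule0.
- by move=> [x y] /= nP; split=> //; exact: sub.
Qed.

Section integrable_on_rectangle.
Variable f : X * Y -> R.
Hypothesis If : mu.-integrable (A `*` B) (EFin \o f).

Let g := (f \_ (A `*` B)).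

Let Ig : mu.-integrable setT (EFin \o g).
Proof.
have /(integrable_mkcond _ (measurableX mA mB)).1 := If.
by apply: eq_integrable => // z _; rewrite /g restrict_EFin.
Qed.

Let gE x s : g (x, s) = if s \in B then ((fun x => f (x, s)) \_ A) x else 0.
Proof.
rewrite /g !patchE; have -> : ((x, s) \in A `*` B) = (x \in A) && (s \in B).
  by apply/idP/andP; rewrite !inE.
by case: (x \in A); case: (s \in B).
Qed.

Let gE' x s : g (x, s) = if x \in A then ((fun s => f (x, s)) \_ B) s else 0.
Proof. by rewrite gE !patchE; case: (x \in A); case: (s \in B). Qed.

Lemma ae_integrable_section :
  {ae m2, forall s, B s -> m1.-integrable A (EFin \o (fun x => f (x, s)))}.
Proof.
apply: filterS (ae_integrable2 Ig) => s H Bs.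
apply/(integrable_mkcond _ mA); apply: eq_integrable H => // x _.
by rewrite /= gE mem_set// restrict_EFin.
Qed.

Lemma integrable_int_section :
  m2.-integrable B (EFin \o (fun s => \int[m1]_(x in A) f (x, s))).
Proof.
have Ib : m2.-integrable setT (fubini_G m1 (EFin \o g)).
  apply/integrableP; split; first exact: (measurable_fubini_G Ig).
  have mg := measurable_int _ Ig.
  apply: le_lt_trans ((integrable21ltyP m1 m2 mg).1 Ig); apply: ge0_le_integral => //.
  - by apply: measurableT_comp => //; exact: (measurable_fubini_G Ig).
  - apply: (@measurable_fun_fubini_tonelli_G _ _ _ _ _ m1 (abse \o (EFin \o g))).
      exact: measurableT_comp.
    by move=> z; exact: abse_ge0.
  - move=> y _; apply: le_abse_integral => //.
    exact: (measurableT_comp mg (measurable_pair2 y)).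
have IbB := integrableS measurableT mB (@subsetT _ _) Ib.
have GE s : B s -> fubini_G m1 (EFin \o g) s = (\int[m1]_(x in A) (f (x, s))%:E)%E.
  move=> Bs; rewrite [in RHS]integral_mkcond; apply: eq_integral => x _.
  by rewrite /= gE mem_set// restrict_EFin.
have mR : measurable_fun B (fun s => \int[m1]_(x in A) f (x, s)).
  rewrite (_ : (fun s => _) = fine \o (fun s => \int[m1]_(x in A) (f (x, s))%:E)%E)//.
  apply: measurableT_comp => //.
  by apply: eq_measurable_fun (measurable_int _ IbB) => s /set_mem; exact: GE.
apply/integrableP; split; first exact/measurable_EFinP.
move/integrableP : IbB => [mG]; apply: le_lt_trans.
apply: ge0_le_integral => //.
- by apply: measurableT_comp => //; exact/measurable_EFinP.
- exact: measurableT_comp.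
- move=> s Bs; rewrite GE// /= /Rintegral.
  by case: (\int[m1]_(x in A) (f (x, s))%:E)%E => //=; rewrite normr0 leey.
Qed.

Lemma Rintegral_fubini2 :
  \int[mu]_(z in A `*` B) f z = \int[m2]_(s in B) \int[m1]_(x in A) f (x, s).
Proof.
rewrite Rintegral_mkcond -/g /Rintegral -(integral21_prod_meas1 Ig); congr fine.
rewrite [RHS]integral_mkcond; apply: ae_eq_integral => //.
- exact: (measurable_fubini_G Ig).
- have := (integrable_mkcond _ mB).1 integrable_int_section.
  exact: measurable_int.
apply: filterS (ae_integrable2 Ig) => s Is _; rewrite /fubini_G.
rewrite patchE; case: ifPn => sB; last first.
  under eq_integral do rewrite /= gE (negbTE sB); exact: integral0.
rewrite fineK.
  rewrite [in RHS]integral_mkcond; apply: eq_integral => x _.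
  by rewrite /= gE sB restrict_EFin.
apply: integrable_fin_num => //; apply/(integrable_mkcond _ mA).
by apply: eq_integrable Is => // x _; rewrite /= gE sB restrict_EFin.
Qed.

Lemma Rintegral_fubini1 :
  \int[mu]_(z in A `*` B) f z = \int[m1]_(x in A) \int[m2]_(s in B) f (x, s).
Proof.
have FE x : fine (fubini_F m2 (EFin \o g) x) =
    ((fun x => \int[m2]_(s in B) f (x, s)) \_ A) x.
  rewrite /fubini_F patchE; case: ifPn => xA; last first.
    under eq_integral do rewrite /= gE' (negbTE xA).
    by rewrite integral0.
  rewrite /Rintegral [in RHS]integral_mkcond; congr fine; apply: eq_integral => s _.
  by rewrite /= gE' xA restrict_EFin.
rewrite [RHS]Rintegral_mkcond Rintegral_mkcond -/g /Rintegral.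
rewrite -(integral12_prod_meas1 Ig); congr fine.
under [RHS]eq_integral do rewrite -FE.
apply: ae_eq_integral => //.
- exact: measurable_fubini_F Ig.
- by apply/measurable_EFinP; apply: measurableT_comp => //; exact: measurable_fubini_F Ig.
have := integrable_ae measurableT (integrable_fubini_F Ig).
by apply: filterS => x Fx _; rewrite fineK// Fx.
Qed.

End integrable_on_rectangle.

Lemma measurable_tensor (v : X -> R) (u : Y -> R) : measurable_fun A v -> measurable_fun B u ->
  measurable_fun (A `*` B) (fun z => v z.1 * u z.2).
Proof.
move=> mv mu'; apply: measurable_funM.
  apply: (measurable_comp (F := A) (f := v)) => //; last exact: measurable_funTS.
  by move=> _ [z [Az Bz] <-].
apply: (measurable_comp (F := B) (f := u)) => //; last exact: measurable_funTS.
by move=> _ [z [Az Bz] <-].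
Qed.

Lemma integrable_tensor (v : X -> R) (u : Y -> R) :
  m1.-integrable A (EFin \o v) -> m2.-integrable B (EFin \o u) ->
  mu.-integrable (A `*` B) (EFin \o (fun z => v z.1 * u z.2)).
Proof.
move=> Iv Iu; have mv := measurable_of_integrable Iv; have mu' := measurable_of_integrable Iu.
have mAB : measurable (A `*` B) by exact: measurableX.
apply/(integrable_mkcond _ mAB); set F := (X in _.-integrable _ X).
have mF : measurable_fun setT F.
  apply: (measurable_restrictT _ mAB).1.
  by apply: (measurable_EFinP _ (fun z => v z.1 * u z.2)).2; exact: measurable_tensor.
apply/(integrable12ltyP m1 m2 mF).
have -> : (\int[m1]_x \int[m2]_y `|F (x, y)| =
   \int[m1]_(x in A) (`|v x|%:E * \int[m2]_(y in B) `|u y|%:E))%E.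
  rewrite [RHS]integral_mkcond; apply: eq_integral => x _.
  rewrite patchE; case: ifPn => xA.
    rewrite -ge0_integralZl//; last first.
      by apply/measurable_EFinP; exact: measurableT_comp.
    rewrite [RHS]integral_mkcond; apply: eq_integral => y _.
    rewrite /F !patchE (_ : ((x, y) \in A `*` B) = (y \in B)).
      by case: (y \in B); rewrite ?abse0//= normrM EFinM.
    apply/idP/idP => [/set_mem[/= _ ?]|/set_mem ?]; apply/mem_set => //.
    by split=> //; exact/set_mem.
  apply: integral0_eq => y _; rewrite /F patchE memNset ?abse0//= => -[/= xA' _].
  by move: xA; rewrite mem_set.
have uf : (\int[m2]_(y in B) `|u y|%:E \is a fin_num)%E.
  by apply: integrable_fin_num => //; exact: integrable_norm.
rewrite -(fineK uf) ge0_integralZr//; last first.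
- by rewrite lee_fin fine_ge0// integral_ge0.
- by apply/measurable_EFinP; exact: measurableT_comp.
rewrite lte_mul_pinfty ?ltry// ?integral_ge0// integrable_fin_num//.
exact: integrable_norm.
Qed.

Lemma sqi_tensor (v : X -> R) (u : Y -> R) : square_integrable m1 A v ->
  square_integrable m2 B u ->
  square_integrable mu (A `*` B) (fun z => v z.1 * u z.2).
Proof.
move=> [mv Iv] [mu' Iu]; split; first exact: measurable_tensor.
have := integrable_tensor (v := fun x => v x ^+ 2) (u := fun y => u y ^+ 2) Iv Iu.
apply: eq_integrable => //; first exact: measurableX.
by move=> z _; rewrite /= exprMn.
Qed.

End fubini_rectangle.

(** * Smooth bump functions *)

Section Ck_closure.
Context {R : realType}.

Lemma Ck_continuous (V : normedModType R) k (f : V -> R) : Ck k f -> continuous f.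
Proof. by case: k => [|k] // []. Qed.

Lemma CkS (V : normedModType R) k (f : V -> R) : Ck k.+1 f -> Ck k f.
Proof.
elim: k f => [|k IH] f; first by case.
by move=> [cf H]; split=> // v; have [df Ckf] := H v; split=> //; exact: IH.
Qed.

(** A0 is the linear part of A: the difference quotients of [f \o A] in the direction v
    are those of f in the direction A0 v. *)
Lemma Ck_affine (V W : normedModType R) (A A0 : V -> W) k (f : W -> R) :
  continuous A -> (forall x v t, A (t *: v + x) = t *: A0 v + A x) ->
  Ck k f -> Ck k (f \o A).
Proof.
move=> cA AE; elim: k f => [|k IH] f.
  by move=> cf x; apply: continuous_comp; [exact: cA|exact: cf].
move=> [cf H].
have quot v x : (fun t : R => t^-1 *: ((f \o A \o shift x) (t *: v) - (f \o A) x)) =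
    (fun t : R => t^-1 *: ((f \o shift (A x)) (t *: A0 v) - f (A x))).
  by apply/funext => t /=; rewrite AE.
split; first by move=> x; apply: continuous_comp; [exact: cA|exact: cf].
move=> v; have [df Ckf] := H (A0 v); split.
  by move=> x; rewrite /derivable quot; exact: df.
have -> : (fun x => 'D_v (f \o A) x) = (fun y => 'D_(A0 v) f y) \o A.
  by apply/funext => x; rewrite /derive quot.
exact: IH.
Qed.

Context {V : normedModType R}.
Implicit Types f g : V -> R.

Lemma Ck_cst k (c : R) : Ck k (fun _ : V => c).
Proof.
elim: k c => [|k IH] c; first by move=> x; exact: cvg_cst.
split=> [x|v]; first exact: cvg_cst.
split=> [x|]; first exact: derivable_cst.
have -> : (fun x => 'D_v (fun _ : V => c) x) = (fun=> 0).
  by apply/funext => x; rewrite derive_cst.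
exact: IH.
Qed.

Lemma CkD k f g : Ck k f -> Ck k g -> Ck k (fun x => f x + g x).
Proof.
elim: k f g => [|k IH] f g /=.
  by move=> cf cg x; apply: cvgD; [exact: cf|exact: cg].
move=> [cf Hf] [cg Hg]; split=> [x|v].
  by apply: cvgD; [exact: cf|exact: cg].
have [df Cf] := Hf v; have [dg Cg] := Hg v; split.
  by move=> x; apply: derivableD; [exact: df|exact: dg].
have -> : (fun x => 'D_v (fun x => f x + g x) x) = (fun x => 'D_v f x + 'D_v g x).
  by apply/funext => x; apply: deriveD; [exact: df|exact: dg].
exact: IH.
Qed.

Lemma CkM k f g : Ck k f -> Ck k g -> Ck k (fun x => f x * g x).
Proof.
elim: k f g => [|k IH] f g.
  by move=> /= cf cg x; apply: cvgM; [exact: cf|exact: cg].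
move=> Cf' Cg'; have Cf1 := CkS Cf'; have Cg1 := CkS Cg'.
case: Cf' Cg' => [cf Hf] [cg Hg]; split=> [x|v].
  by apply: cvgM; [exact: cf|exact: cg].
have [df Cf] := Hf v; have [dg Cg] := Hg v; split.
  by move=> x; apply: derivableM; [exact: df|exact: dg].
have -> : (fun x => 'D_v (fun x => f x * g x) x) =
    (fun x => f x * 'D_v g x + g x * 'D_v f x).
  by apply/funext => x; apply: deriveM; [exact: df|exact: dg].
by apply: CkD; exact: IH.
Qed.

Lemma Ck_prod k (I : Type) (r : seq I) (f : I -> V -> R) :
  (forall i, Ck k (f i)) -> Ck k (fun x => \prod_(i <- r) f i x).
Proof.
move=> Cf; elim: r => [|i r IH].
  by under eq_fun do rewrite big_nil; exact: Ck_cst.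
by under eq_fun do rewrite big_cons; exact: CkM.
Qed.

Lemma Ck_cstM k (c : R) f : Ck k f -> Ck k (fun x => c * f x).
Proof. by move=> Cf; apply: CkM => //; exact: Ck_cst. Qed.

Lemma Ck_derive k f v : Ck k.+1 f -> Ck k ('D_v f).
Proof. by case=> _ /(_ v) []. Qed.

End Ck_closure.

Section flat_exponential.
Context {R : realType}.
Implicit Types (x t a b : R).

(** [flat n x = x^-n e^(-1/x)] on the positive half-line: this family is closed
    under differentiation, up to linear combinations, and each member tends to 0
    at 0. *)
Definition flat (n : nat) x : R := if 0 < x then x^-1 ^+ n * expR (- x^-1) else 0.

(** The exponential of 1/x dominates the power n + 1 of 1/x divided by (n + 1)!. *)
Lemma flat_le n x : 0 < x -> flat n x <= (n.+1)`!%:R * x.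
Proof.
move=> x0; rewrite /flat x0 expRN.
have y0 : 0 <= x^-1 by rewrite invr_ge0 ltW.
have f0 : 0 < (n.+1)`!%:R :> R by rewrite ltr0n fact_gt0.
have := expR_ge1Dxn n y0; set y := x^-1 => H.
have {}H : y ^+ n.+1 <= (n.+1)`!%:R * expR y.
  by rewrite mulrC -ler_pdivrMr//; lra.
rewrite ler_pdivrMr ?expR_gt0// -(ler_pM2r (x := y)) ?invr_gt0//.
have xy : x * y = 1 by rewrite divff ?gt_eqF.
rewrite -exprSr (_ : _ * x * expR y * y = (n.+1)`!%:R * expR y * (x * y)); last by ring.
by rewrite xy mulr1.
Qed.

Lemma flat_ge0 n x : 0 <= flat n x.
Proof.
rewrite /flat; case: ifP => // x0.
by rewrite mulr_ge0 ?expR_ge0// exprn_ge0// invr_ge0 ltW.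
Qed.

Lemma flat_le0 n x : x <= 0 -> flat n x = 0.
Proof. by move=> x0; rewrite /flat ltNge x0. Qed.

Lemma flat_norm n x : `|flat n x| <= (n.+1)`!%:R * `|x|.
Proof.
rewrite ger0_norm ?flat_ge0//; have [x0|x0] := leP x 0.
  by rewrite flat_le0// mulr_ge0.
by rewrite gtr0_norm// flat_le.
Qed.

Lemma flatV n x : x^-1 * flat n x = flat n.+1 x.
Proof. by rewrite /flat; case: ifP => _; rewrite ?mulr0// mulrA -exprS. Qed.

Lemma is_derive_flat n x : is_derive x 1 (flat n) (flat n.+2 x - n%:R * flat n.+1 x).
Proof.
have [x0|x0|->] := ltrgtP x 0.
- rewrite !flat_le0 ?ltW// mulr0 subr0.
  apply: (@near_eq_is_derive _ _ _ (cst 0)).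
  by near=> y; rewrite flat_le0//; apply: ltW; near: y; exact: lt_nbhsl.
- have nx : x != 0 by rewrite gt_eqF.
  pose F := fun y : R => y^-1 ^+ n * expR (- y^-1).
  have dV : is_derive x 1 (fun y : R => y^-1) (- x ^- 2).
    by apply: (@is_derive_eq _ _ _ _ _ _ _ _ (is_deriveV nx (is_derive_id _ _))); rewrite scaler1.
  have dF : is_derive x 1 F (flat n.+2 x - n%:R * flat n.+1 x).
    have d1 := is_deriveX n dV.
    have d2 := @is_derive1_comp _ expR _ x _ _ (is_derive_expR _) (is_deriveN dV).
    have d3 := is_deriveM d1 d2.
    have FE : [eta GRing.inv] ^+ n * (expR \o - [eta GRing.inv]) = F.
      by apply/funext => y; rewrite /F !fctE.
    rewrite FE in d3; apply: (@is_derive_eq _ _ _ _ _ _ _ _ d3).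
    rewrite /flat x0 !fctE /GRing.scale/= -!exprVn; case: n {F d1 d3 FE} => [|m].
      by rewrite !expr0 !mul0r !mulr0 subr0 addr0; ring.
    by rewrite /= !exprS; ring.
  apply: near_eq_is_derive dF; near=> y.
  by rewrite /F /flat ifT//; near: y; exact: lt_nbhsr.
- rewrite !(flat_le0 _ (lexx 0)) mulr0 subr0.
  have H : h^-1 *: ((flat n \o shift 0) (h *: 1) - flat n 0) @[h --> 0^'] --> (0 : R).
    apply/cvgr0Pnorm_lt => e e0.
    near=> h; rewrite /= (flat_le0 n (lexx 0)) subr0 addr0 /GRing.scale/= mulr1 flatV.
    apply: (le_lt_trans (flat_norm _ _)).
    rewrite mulrC -ltr_pdivlMr ?ltr0n ?fact_gt0//; near: h.
    apply: dnbhs0_lt; by rewrite divr_gt0 ?ltr0n ?fact_gt0.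
  by apply: DeriveDef; [exact: cvgP H|exact: cvg_lim H].
Unshelve. all: by end_near. Qed.

Lemma continuous_flat n : continuous (flat n).
Proof.
move=> x; apply/differentiable_continuous/derivable1_diffP.
exact: (@ex_derive _ _ _ _ _ _ _ (is_derive_flat n x)).
Qed.

Lemma derive_direction (f : R -> R) x v : derivable f x 1 ->
  derivable f x v /\ 'D_v f x = v * 'D_1 f x.
Proof.
move/derivable1_diffP => df; split; first exact: diff_derivable.
by rewrite !deriveE// -{1}[v]mulr1 -[v * 1]/(v *: 1) linearZ.
Qed.

Lemma Ck_flat k n : Ck k (flat n).
Proof.
elim: k n => [|k IH] n; first exact: continuous_flat.
split=> [|v]; first exact: continuous_flat.
have D x := @derive_direction _ x v (@ex_derive _ _ _ _ _ _ _ (is_derive_flat n x)).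
split; first by move=> x; have [] := D x.
have -> : (fun x => 'D_v (flat n) x) =
    (fun x => v * (flat n.+2 x + - n%:R * flat n.+1 x)).
  apply/funext => x; rewrite (D x).2 (@derive_val _ _ _ _ _ _ _ (is_derive_flat n x)).
  by rewrite mulNr.
by apply: Ck_cstM; apply: CkD => //; exact: Ck_cstM.
Qed.

(** A smooth function supported in the compact interval [a + 1/k, b - 1/k];
    as k grows, it tends to the indicator of the open interval from a to b. *)
Definition bump (k : nat) a b t : R :=
  flat 0 (k%:R * (t - a) - 1) * flat 0 (k%:R * (b - t) - 1).

Lemma Ck_bump j k a b : Ck j (bump k a b).
Proof.
apply: CkM.
  apply: (@Ck_affine _ R R (fun t => k%:R * (t - a) - 1) (fun t => k%:R * t) j (flat 0)).
  - by move=> t; apply: cvgB; [apply: cvgMr; apply: cvgB => //|]; exact: cvg_cst.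
  - by move=> x v t; rewrite /GRing.scale/=; ring.
  - exact: Ck_flat.
apply: (@Ck_affine _ R R (fun t => k%:R * (b - t) - 1) (fun t => - k%:R * t) j (flat 0)).
- by move=> t; apply: cvgB; [apply: cvgMr; apply: cvgB => //|]; exact: cvg_cst.
- by move=> x v t; rewrite /GRing.scale/=; ring.
- exact: Ck_flat.
Qed.

Lemma flat0_le1 x : flat 0 x <= 1.
Proof.
rewrite /flat; case: ifP => // x0.
by rewrite expr0 mul1r expR_le1 oppr_le0 invr_ge0 ltW.
Qed.

Lemma flat0_ge x : 0 < x -> 1 - x^-1 <= flat 0 x.
Proof. by move=> x0; rewrite /flat x0 expr0 mul1r expR_ge1Dx. Qed.

Lemma bump_ge0 k a b t : 0 <= bump k a b t.
Proof. by rewrite mulr_ge0 ?flat_ge0. Qed.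

Lemma bump_le1 k a b t : bump k a b t <= 1.
Proof. by rewrite mulr_ile1 ?flat_ge0 ?flat0_le1. Qed.

Lemma bump_support k a b t : bump k a b t != 0 ->
  [/\ (0 < k)%N, a + k%:R^-1 <= t & t <= b - k%:R^-1].
Proof.
rewrite /bump mulf_eq0 negb_or => /andP[H1 H2].
have {}H1 : 0 < k%:R * (t - a) - 1 by rewrite ltNge; apply: contraNN H1 => /flat_le0 ->.
have {}H2 : 0 < k%:R * (b - t) - 1 by rewrite ltNge; apply: contraNN H2 => /flat_le0 ->.
have k0 : (0 < k)%N by case: k H1 {H2} => //; rewrite mul0r; lra.
have k1 : 0 < k%:R :> R by rewrite ltr0n.
split=> //.
  by rewrite addrC -lerBrDr -div1r ler_pdivrMr// mulrC; lra.
by rewrite lerBrDl -lerBrDr -div1r ler_pdivrMr// mulrC; lra.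
Qed.

Lemma cvg_flat_to1 c : 0 < c -> (fun k : nat => flat 0 (k%:R * c - 1)) @ \oo --> (1 : R).
Proof.
move=> c0; apply/cvgrPdist_le => e e0.
pose m := Num.bound ((1 + e^-1) / c).
exists m => // k /= mk.
have ck : 1 + e^-1 <= k%:R * c.
  rewrite -ler_pdivrMr//; apply: (@le_trans _ _ m%:R); last by rewrite ler_nat.
  apply/ltW/archi_boundP; rewrite divr_ge0 ?addr_ge0 ?invr_ge0 ?ltW//.
have i0 : 0 < e^-1 by rewrite invr_gt0.
have y0 : 0 < k%:R * c - 1 by lra.
rewrite ger0_norm; last by rewrite subr_ge0 flat0_le1.
have := flat0_ge y0.
suff : (k%:R * c - 1)^-1 <= e by lra.
by rewrite -[leRHS]invrK lef_pV2 ?posrE//; lra.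
Qed.

Lemma cvg_bump a b t : (fun k => bump k a b t) @ \oo --> ((a < t < b)%R%:R : R).
Proof.
case: (boolP (a < t < b)%R) => [/andP[at_ tb]|H].
  rewrite [X in _ --> X](_ : _ = 1 * 1); last by rewrite mulr1.
  by apply: cvgM; apply: cvg_flat_to1; rewrite subr_gt0.
rewrite [X in X @ _ --> _](_ : _ = cst 0); first exact: cvg_cst.
apply/funext => k; apply/eqP; apply: contraNT H => /bump_support[k0 h1 h2].
have k1 : 0 < (k%:R)^-1 :> R by rewrite invr_gt0 ltr0n.
by apply/andP; split; lra.
Qed.

End flat_exponential.

(** * Orthogonality to products of bumps *)

Section coordinate_boxes.
Context {dT : measure_display} {T : measurableType dT} {R : realType} {I : finType}.
Variable p : I -> T -> R.

Definition cbox (a b : I -> R) : set T := [set z | forall i, a i < p i z < b i].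

Definition cboxes : set (set T) := [set A | exists a b, A = cbox a b].

Definition locally_cbox (O : set T) :=
  forall z, O z -> exists a b, cbox a b z /\ cbox a b `<=` O.

Lemma setI_closed_cboxes : setI_closed cboxes.
Proof.
move=> A B [a [b ->]] [a' [b' ->]].
exists (fun i => Num.max (a i) (a' i)), (fun i => Num.min (b i) (b' i)).
apply/seteqP; split=> [z [h1 h2] i|z h].
  have /andP[a1 b1] := h1 i; have /andP[a2 b2] := h2 i.
  by rewrite gt_max lt_min a1 a2 b1 b2.
by split=> i; have := h i; rewrite gt_max lt_min => /andP[/andP[a1 a2] /andP[b1 b2]]; apply/andP.
Qed.

Hypothesis mp : forall i, measurable_fun setT (p i).

Lemma measurable_cbox a b : measurable (cbox a b).
Proof.
have -> : cbox a b = \bigcap_(i in [set: I]) (p i @^-1` `]a i, b i[%classic).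
  apply/seteqP; split=> [z h i _|z h i]; rewrite /= ?in_itv/=; first exact: h.
  by have := h i Logic.I; rewrite /= in_itv.
apply: fin_bigcap_measurable; first exact: finite_finset.
by move=> i _; rewrite -[X in measurable X]setTI; exact: mp.
Qed.

(** Boxes with rational end points form a countable basis. *)
Lemma locally_cbox_bigcup (O : set T) : locally_cbox O ->
  exists F : nat -> set T, O = \bigcup_k F k /\
    forall k, F k `<=` O /\ (F k = set0 \/ cboxes (F k)).
Proof.
move=> hO; pose rbox (q : {ffun I -> rat * rat}) :=
  cbox (fun i => ratr (q i).1) (fun i => ratr (q i).2).
pose F (k : nat) := if unpickle k is Some q then
  (if `[< rbox q `<=` O >] then rbox q else set0) else set0.
have FP k : F k `<=` O /\ (F k = set0 \/ cboxes (F k)).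
  rewrite /F; case: unpickle => [q|]; last by split; [|left].
  case: asboolP => [qO|_]; last by split; [|left].
  by split=> //; right; exists (fun i => ratr (q i).1), (fun i => ratr (q i).2).
exists F; split=> //; apply/seteqP; split=> [z Oz|z [k _ Fz]]; last exact: (FP k).1.
have [a [b [zab abO]]] := hO z Oz.
have /all_sig[q qP] i : {q : rat * rat | a i < ratr q.1 < p i z /\ p i z < ratr q.2 < b i}.
  apply: cid; have /andP[h1 h2] := zab i.
  have [r] := rat_in_itvoo h1; rewrite in_itv/= => hr.
  by have [s] := rat_in_itvoo h2; rewrite in_itv/= => hs; exists (r, s).
pose qq := [ffun i => q i].
have qO : rbox qq `<=` O.
  apply: subset_trans abO => y h i; have := h i; rewrite ffunE.
  have [/andP[h1 h2] /andP[h3 h4]] := qP i => /andP[h5 h6].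
  by apply/andP; split; lra.
exists (pickle qq) => //; rewrite /F pickleK; case: asboolP => // _ i.
by rewrite ffunE; have [/andP[h1 h2] /andP[h3 h4]] := qP i; apply/andP.
Qed.

Lemma measurable_locally_cbox (O : set T) : locally_cbox O -> measurable O.
Proof.
move/locally_cbox_bigcup => [F [-> FP]]; apply: bigcupT_measurable => k.
have [_ [->|[a [b ->]]]] := FP k; [exact: measurable0|exact: measurable_cbox].
Qed.

(** A half-space bounding the i-th coordinate from below is the union over m of boxes
    with sides in [-m, m]. *)
Lemma cboxes_generate :
  @measurable _ T `<=` <<s \bigcup_(i in [set: I]) preimage_set_system setT (p i) measurable >> ->
  @measurable _ T = <<s cboxes >>.
Proof.
move=> gen; apply/seteqP; split; last first.
  apply: smallest_sub; first exact: sigma_algebra_measurable.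
  by move=> A [a [b ->]]; exact: measurable_cbox.
apply: (subset_trans gen); apply: smallest_sub; first exact: smallest_sigma_algebra.
move=> A [i _ [B mB <-]]; rewrite setTI.
have sC := smallest_sigma_algebra setT cboxes.
have [s0 sD sU] := sC.
suff /(_ B mB) : @measurable _ R `<=` [set B | <<s cboxes >> (p i @^-1` B)] by [].
rewrite [X in X `<=` _]RGenOInfty.measurableE; apply: smallest_sub.
  split => /=.
  - by rewrite preimage_set0.
  - move=> C hC; rewrite setTD preimage_setC -setTD; exact: sD.
  - by move=> F hF; rewrite preimage_bigcup; exact: sU.
move=> _ [r ->] /=.
have -> : p i @^-1` `]r, +oo[%classic =
    \bigcup_m cbox (fun j => if j == i then r else - m%:R) (fun j => m%:R).
  apply/seteqP; split=> [z|z [m _ h]]; last first.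
    by have := h i; rewrite eqxx /= in_itv/= andbT => /andP[].
  rewrite /= in_itv/= andbT => rz.
  pose M := Num.bound (\sum_j `|p j z|).
  have MP j : `|p j z| < M%:R.
    apply: le_lt_trans (archi_boundP _); last exact: sumr_ge0.
    by rewrite (bigD1 j)//= lerDl sumr_ge0.
  exists M => // j; have := MP j; rewrite ltr_norml => /andP[h1 h2]; rewrite h2 andbT.
  by case: eqP => [->|].
apply: sU => m; apply: sub_sigma_algebra.
by eexists; eexists; reflexivity.
Qed.

Variable mu : {measure set T -> \bar R}.

(** An integrable function on D that is orthogonal to all products of one
    dimensional bumps supported in D integrates to 0 over each box in D, by
    dominated convergence; the boxes generate the sigma-algebra and are stable
    under intersections, so it integrates to 0 over each measurable set. *)
Lemma orthogonal_bumps_eq0 (D : set T) (H : T -> R) :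
  @measurable _ T = <<s cboxes >> -> locally_cbox D ->
  mu.-integrable D (EFin \o H) ->
  (forall a b k, cbox a b `<=` D ->
     \int[mu]_(z in D) (H z * \prod_i bump k (a i) (b i) (p i z)) = 0) ->
  ae_eq mu D H (cst 0).
Proof.
move=> gen locD IH orth; have mD := measurable_locally_cbox locD.
have mH := measurable_of_integrable IH.
have mB a b k : measurable_fun setT (fun z => \prod_i bump k (a i) (b i) (p i z)).
  elim: (index_enum I) => [|i s IHs].
    by under eq_fun do rewrite big_nil; exact: measurable_cst.
  under eq_fun do rewrite big_cons; apply: measurable_funM => //.
  apply: measurableT_comp => //.
  apply: continuous_measurable_fun; exact: Ck_continuous (Ck_bump 0 _ _ _).
have box0 a b : cbox a b `<=` D -> (\int[mu]_(z in cbox a b) (H z)%:E = 0)%E.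
  move=> abD.
  pose f_ k z := ((H z * \prod_i bump k (a i) (b i) (p i z))%:E)%E.
  have mf_ k : measurable_fun D (f_ k).
    apply/measurable_EFinP; apply: measurable_funM => //; exact: measurable_funTS.
  pose f z := ((H \_ (cbox a b)) z)%:E.
  have mf : measurable_fun D f.
    apply/measurable_EFinP; apply/(measurable_restrict _ (measurable_cbox a b)) => //.
    by apply: measurable_funS mH => //; exact: subIsetl.
  have [_ _ cvg] : [/\ mu.-integrable D f,
      [sequence \int[mu]_(x in D) `|f_ n x - f x| ]_n @ \oo --> 0 &
      [sequence \int[mu]_(x in D) (f_ n x) ]_n @ \oo --> \int[mu]_(x in D) f x ]%E.
    apply: (@dominated_convergence _ _ _ mu D mD f_ f (fun z => `|(H z)%:E|%E)) => //.
    - apply: aeW => z Dz; apply: cvg_EFin; first exact: nearW.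
      have -> : (H \_ (cbox a b)) z = H z * \prod_i (a i < p i z < b i)%R%:R.
        rewrite patchE; case: ifPn => [/set_mem h|h].
          by rewrite big1 ?mulr1// => i _; rewrite h.
        have /existsNP[i /negP ni] : ~ (forall i, a i < p i z < b i).
          by move=> h'; move: h; rewrite mem_set.
        by rewrite (bigD1 i)//= (negbTE ni) mul0r mulr0.
      apply: cvgMl_tmp => /=.
      elim: (index_enum I) => [|i s IHs].
        rewrite [X in X @ _](_ : _ = cst 1) ?big_nil; first exact: cvg_cst.
        by apply/funext => k /=; rewrite big_nil.
      rewrite big_cons [X in X @ _](_ : _ = (fun k => bump k (a i) (b i) (p i z) *
        \prod_(i <- s) bump k (a i) (b i) (p i z))); last first.
        by apply/funext => k /=; rewrite big_cons.
      by apply: cvgM => //; exact: cvg_bump.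
    - exact: integrable_abse.
    - apply: aeW => z k Dz; rewrite lee_fin normrM ler_piMr//.
      rewrite ger0_norm ?prodr_ge0//; last by move=> i _; exact: bump_ge0.
      by rewrite prodr_ile1//= => i _; rewrite bump_ge0 bump_le1.
  have Ifk k : (\int[mu]_(x in D) f_ k x = 0)%E.
    rewrite -[LHS]fineK; first by congr EFin; exact: orth.
    apply: integrable_fin_num => //; apply: le_integrable (integrable_abse IH) => //.
    move=> z Dz; rewrite /= lee_fin normr_id normrM ler_piMr//.
    rewrite ger0_norm ?prodr_ge0//; last by move=> i _; exact: bump_ge0.
    by rewrite prodr_ile1//= => i _; rewrite bump_ge0 bump_le1.
  have /(cvg_unique _ cvg) : [sequence (\int[mu]_(x in D) (f_ n x))%E ]_n @ \oo --> (0%E : \bar R).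
    by rewrite [X in X @ _](_ : _ = cst 0%E); [exact: cvg_cst|exact/funext].
  move=> D0; have abE := setIidr abD; rewrite -abE integral_mkcondr -[RHS]D0 ?abE//.
  by apply: eq_integral => z _; rewrite /f restrict_EFin.
have [F [DF FP]] := locally_cbox_bigcup locD.
have F0 k : ae_eq mu (F k) H (cst 0).
  have [FkD [->|[a [b Fk]]]] := FP k; first exact: aeW.
  have mFk : measurable (F k) by rewrite Fk; exact: measurable_cbox.
  have IHk : mu.-integrable (F k) (EFin \o H) by exact: integrableS IH.
  suff Z : @measurable _ T `<=` [set A | measurable A /\ (\int[mu]_(z in A `&` F k) (H z)%:E = 0)%E].
    have : ae_eq mu (F k) (EFin \o H) (cst 0%E).
      apply: (integral_ae_eq mFk IHk) => [|E EF mE]; first exact: measurable_cst.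
      by rewrite integral0; have [_] := Z E mE; rewrite setIidl.
    by apply: filterS => z + Fz => /(_ Fz) [].
  rewrite [X in X `<=` _]gen.
  apply: (lambda_system_subset setI_closed_cboxes (D := setT)) => //.
  - apply/dynkin_lambda_system; split => /=.
    + by split; [exact: measurableT|rewrite setTI Fk box0// -Fk].
    + move=> A [mA A0]; split; first exact: measurableC.
      have := @integral_setU _ _ _ mu (A `&` F k) (~` A `&` F k) (EFin \o H).
      rewrite A0 add0e -setIUl setUv setTI => <-.
      * by rewrite Fk box0// -Fk.
      * exact: measurableI.
      * by apply: measurableI => //; exact: measurableC.
      * exact: measurable_int IHk.
      * by apply/disj_setPS => z [[Az _] [nAz _]]; exact: nAz.
    + move=> G tG HG; split; first by apply: bigcupT_measurable => i; case: (HG i).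
      rewrite setI_bigcupl integral_bigcup.
      * by apply: eseries0 => i _ _; case: (HG i).
      * by apply: trivIset_setIr.
      * by move=> i; apply: measurableI => //; case: (HG i).
      * apply: integrableS IHk => //.
          by apply: bigcupT_measurable => i; apply: measurableI => //; case: (HG i).
        by move=> z [i _ []].
  - move=> A [a' [b' ->]] /=; split; first exact: measurable_cbox.
    have [a2 [b2 E2]] := setI_closed_cboxes (ex_intro _ a' (ex_intro _ b' erefl))
      (ex_intro _ a (ex_intro _ b Fk)).
    by rewrite E2 box0// -E2; apply: subset_trans FkD; exact: subIsetr.
rewrite DF; have /ae_foralln := F0; apply: filterS => z h [k _ Fz].
exact: h Fz.
Qed.

End coordinate_boxes.

(** * Coordinates, measurability of open sets, test functions *)

Section coordinates.
Context {R : realType} {d : nat}.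
Local Notation spacetime := ('rV[R]_d * measurableTypeR R)%type.

Definition coord_x (i : 'I_d) (x : 'rV[R]_d) : R := x ord0 i.

(** [None] stands for the time coordinate. *)
Definition coord_xt (i : option 'I_d) (z : spacetime) : R :=
  if i is Some j then z.1 ord0 j else z.2.

Definition coord_t (_ : unit) (t : measurableTypeR R) : R := t.

Lemma measurable_coord_x i : measurable_fun setT (coord_x i).
Proof. exact: measurable_coord. Qed.

Lemma measurable_coord_xt i : measurable_fun setT (coord_xt i).
Proof.
case: i => [i|]; last exact: measurable_snd.
exact: (measurableT_comp (measurable_coord i) measurable_fst).
Qed.

Lemma measurable_coord_t i : measurable_fun setT (coord_t i).
Proof. exact: measurable_id. Qed.

Lemma measurable_rVE : @measurable _ 'rV[R]_d =
  <<s \big[setU/set0]_(i < d) preimage_set_system setT (coord_x i) measurable >>.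
Proof. by []. Qed.

Lemma cboxes_t_generate : @measurable _ (measurableTypeR R) = <<s cboxes coord_t >>.
Proof.
apply: (cboxes_generate measurable_coord_t).
move=> A mA; apply: sub_sigma_algebra; exists tt => //; exists A => //.
by rewrite setTI.
Qed.

Lemma cboxes_xt_generate : @measurable _ spacetime = <<s cboxes coord_xt >>.
Proof.
apply: (cboxes_generate measurable_coord_xt).
set G := \bigcup_(i in _) _.
have [s0 sD sU] := smallest_sigma_algebra setT G.
apply: smallest_sub; first exact: smallest_sigma_algebra.
move=> _ [[B mB <-]|[B mB <-]]; rewrite setTI; last first.
  apply: sub_sigma_algebra; exists None => //; exists B => //.
  by rewrite setTI.
suff /(_ B mB) : @measurable _ 'rV[R]_d `<=` [set B | <<s G >> (fst @^-1` B)] by [].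
rewrite [X in X `<=` _]measurable_rVE; apply: smallest_sub.
  split => /=.
  - by rewrite preimage_set0.
  - move=> C hC; rewrite setTD preimage_setC -setTD; exact: sD.
  - by move=> F hF; rewrite preimage_bigcup; exact: sU.
move=> A; rewrite -bigcup_seq => -[i _ [C mC <-]] /=.
apply: sub_sigma_algebra; by exists (Some i) => //; exists C => //; rewrite !setTI.
Qed.

Lemma open_locally_cbox_x (O : set 'rV[R]_d) : open O -> locally_cbox coord_x O.
Proof.
rewrite openE => oO z /oO; rewrite /interior -nbhs_ballE => -[e /= e0 eO].
exists (fun i => z ord0 i - e), (fun i => z ord0 i + e); split.
  by move=> i; rewrite /coord_x; apply/andP; split; lra.
move=> y h; apply: eO; split=> // i j; rewrite (ord1 i).
by have := h j; rewrite /ball /= /coord_x ltr_distlC.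
Qed.

Lemma open_locally_cbox_xt (O : set spacetime) : open O -> locally_cbox coord_xt O.
Proof.
rewrite openE => oO z /oO; rewrite /interior -nbhs_ballE => -[e /= e0 eO].
exists (fun i => coord_xt i z - e), (fun i => coord_xt i z + e); split.
  by move=> i; apply/andP; split; lra.
move=> y h; apply: eO; split; last first.
  by have := h None; rewrite /ball /= ltr_distlC.
split=> // i j; rewrite (ord1 i).
by have := h (Some j); rewrite /ball /= ltr_distlC.
Qed.

Lemma open_locally_cbox_t (O : set (measurableTypeR R)) : open O -> locally_cbox coord_t O.
Proof.
rewrite openE => oO z /oO; rewrite /interior -nbhs_ballE => -[e /= e0 eO].
exists (fun i => coord_t i z - e), (fun i => coord_t i z + e); split.
  by move=> i; apply/andP; split; lra.
by move=> y h; apply: eO; have := h tt; rewrite /ball /= ltr_distlC.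
Qed.

Lemma open_measurable_x (O : set 'rV[R]_d) : open O -> measurable O.
Proof.
by move/open_locally_cbox_x; exact: (measurable_locally_cbox measurable_coord_x).
Qed.

Lemma open_measurable_xt (O : set spacetime) : open O -> measurable O.
Proof.
by move/open_locally_cbox_xt; exact: (measurable_locally_cbox measurable_coord_xt).
Qed.

Lemma continuous_measurable_x (f : 'rV[R]_d -> R) : continuous f ->
  measurable_fun setT f.
Proof.
move/continuousP => cf; apply: (measurability _ (RGenOpens.measurableE R)).
move=> _ [_ [a [b ->] <-]]; rewrite setTI; apply: open_measurable_x.
exact/cf/interval_open.
Qed.

Lemma continuous_measurable_xt (f : spacetime -> R) : continuous f ->
  measurable_fun setT f.
Proof.
move/continuousP => cf; apply: (measurability _ (RGenOpens.measurableE R)).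
move=> _ [_ [a [b ->] <-]]; rewrite setTI; apply: open_measurable_xt.
exact/cf/interval_open.
Qed.

End coordinates.

Section finite_measure.
Context {R : realType}.

Definition cube d (M : R) : set 'rV[R]_d := [set x | forall i, `|x ord0 i| <= M].
Arguments cube d M : clear implicits.

Lemma measurable_cube d (M : R) : measurable (cube d M).
Proof.
have -> : cube d M = \bigcap_(i in [set: 'I_d]) (coord_x i @^-1` `[- M, M]%classic).
  apply/seteqP; split=> [x h i _|x h i]; rewrite /= ?in_itv/= -?ler_norml; first exact: h.
  by have := h i Logic.I; rewrite /= in_itv/= -ler_norml.
apply: fin_bigcap_measurable; first exact: finite_finset.
by move=> i _; rewrite -[X in measurable X]setTI; exact: measurable_coord_x.
Qed.

Lemma lebesgue_rV_cube_lty d (M : R) : (lebesgue_rV d (cube d M) < +oo)%E.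
Proof.
elim: d => [|d IH]; first by rewrite /= /dirac/= ltry.
rewrite /= /lebesgue_rV_step /pushforward.
rewrite (_ : _ @^-1` _ = `[- M, M]%classic `*` cube d M).
  rewrite product_measure1E//; last exact: measurable_cube.
  have Ioo : (@lebesgue_measure R (`[- M, M]%classic)%R < +oo)%E.
    by rewrite lebesgue_measure_itv/=; case: ifP => // _; rewrite -EFinB ltry.
  by rewrite lte_mul_pinfty// ge0_fin_numE.
apply/seteqP; split=> [[a v] /= h|[a v] /= [ha hv] i].
  have hl (i : 'I_(1 + d)) : `|row_mx a%:M v ord0 i| <= M by exact: h.
  split.
    by have := hl (lshift d ord0); rewrite row_mxEl mxE in_itv/= -ler_norml.
  by move=> i; have := hl (rshift 1 i); rewrite row_mxEr.
suff hl (j : 'I_(1 + d)) : `|row_mx a%:M v ord0 j| <= M by exact: hl.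
case: (splitP j) => k jk.
  have -> : j = lshift d k by exact/val_inj.
  by rewrite row_mxEl mxE (ord1 k) mulr1n; move: ha; rewrite in_itv/= -ler_norml.
have -> : j = rshift 1 k by exact/val_inj.
by rewrite row_mxEr; exact: hv.
Qed.

Lemma lebesgue_rV_bounded_lty d (A : set 'rV[R]_d) : measurable A ->
  bounded_set A -> (lebesgue_rV d A < +oo)%E.
Proof.
move=> mA /pinfty_ex_gt0[M M0 hM].
apply: le_lt_trans (lebesgue_rV_cube_lty d M); apply: le_measure; rewrite ?inE//.
  exact: measurable_cube.
move=> x Ax i; apply: le_trans (hM x Ax).
by rewrite /Num.Def.normr/= mx_normrE (le_bigmax _ (fun ij => `|x ij.1 ij.2|) (ord0, i)).
Qed.

End finite_measure.

Section test_functions.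
Context {R : realType}.

Lemma test_function_derive (V : normedModType R) (D : set V) (f : V -> R) v :
  test_function D f -> test_function D ('D_v f).
Proof.
move=> [sf [K [cK KD f0]]]; split; first by move=> k; exact: Ck_derive (sf k.+1).
exists K; split=> // x nKx.
have oK : open (~` K).
  by apply: closed_openC; apply: compact_closed cK; exact: norm_hausdorff.
rewrite -(derive_cst (0 : R) v x : 'D_v (cst (0 : R)) x = 0); apply: near_eq_derive.
have : \forall y \near x, (~` K) y by exact: open_nbhs_nbhs.
by apply: filterS => y; exact: f0.
Qed.

Lemma test_function_bounded (V : normedModType R) (D : set V) (f : V -> R) :
  test_function D f -> exists M, forall x, `|f x| <= M.
Proof.
move=> [sf [K [cK KD f0]]].
have : bounded_set (f @` K).
  apply: compact_bounded; apply: continuous_compact => //.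
  by apply: continuous_subspaceT; exact: sf 0%N.
move/pinfty_ex_gt0 => [M M0 hM]; exists M => x.
have [Kx|nKx] := pselect (K x); first by apply: hM; exists x.
by rewrite f0// normr0 ltW.
Qed.

Lemma test_functionD (V : normedModType R) (D : set V) (f g : V -> R) :
  test_function D f -> test_function D g -> test_function D (fun x => f x + g x).
Proof.
move=> [sf [K [cK KD f0]]] [sg [L [cL LD g0]]]; split; first by move=> k; exact: CkD.
exists (K `|` L); split; [exact: compactU|by rewrite subUset|].
by move=> x /not_orP[nK nL]; rewrite f0 ?g0 ?addr0.
Qed.

Lemma test_functionZ (V : normedModType R) (D : set V) c (f : V -> R) :
  test_function D f -> test_function D (fun x => c * f x).
Proof.
move=> [sf [K [cK KD f0]]]; split; first by move=> k; exact: Ck_cstM.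
by exists K; split=> // x nK; rewrite f0 ?mulr0.
Qed.

End test_functions.

(** * Test functions of the domain, of the cylinder and of the time interval *)

Section finite_measure_L2.
Context {dX : measure_display} {X : measurableType dX} {R : realType}.
Variables (mu : {measure set X -> \bar R}) (D : set X).
Hypotheses (mD : measurable D) (Doo : (mu D < +oo)%E).

Lemma bounded_sqi (f : X -> R) M : measurable_fun D f ->
  (forall x, D x -> `|f x| <= M) -> square_integrable mu D f.
Proof.
move=> mf fM; split=> //.
apply: (le_integrableR mD (g := fun=> M ^+ 2)).
- exact: measurable_funX.
- apply/integrableP; split; first by apply/measurable_EFinP; exact: measurable_cst.
  by rewrite /= integral_cst// lte_mul_pinfty.
- move=> x Dx; rewrite normrX lerXn2r ?nnegrE ?fM//.
  exact: le_trans (fM x Dx).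
Qed.

Lemma sqi_cst (c : R) : square_integrable mu D (fun=> c).
Proof. by apply: (bounded_sqi (M := `|c|)) => //; exact: measurable_cst. Qed.

Lemma sqi_integrable (f : X -> R) : square_integrable mu D f ->
  mu.-integrable D (EFin \o f).
Proof.
move=> sf; apply: eq_integrable (sqiM_integrable mD sf (sqi_cst 1)) => // x _ /=.
by rewrite mulr1.
Qed.

End finite_measure_L2.

Section domain.
Context {R : realType} {d : nat} (Omega : set 'rV[R]_d).
Hypotheses (oO : open Omega) (bO : bounded_set Omega).
Variable T : R.
Local Notation spacetime := ('rV[R]_d * measurableTypeR R)%type.
Local Notation It := (time_interval T).
Local Notation cyl := (cylinder Omega T).
Local Notation leb := (@lebesgue_measure R).

Lemma measurable_domain : measurable Omega.
Proof. exact: open_measurable_x. Qed.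

Lemma measurable_time : measurable It.
Proof. exact: measurable_itv. Qed.

Lemma measurable_cylinder : measurable cyl.
Proof. by apply: measurableX; [exact: measurable_domain|exact: measurable_time]. Qed.

Lemma domain_lty : (lebesgue_rV d Omega < +oo)%E.
Proof. by apply: lebesgue_rV_bounded_lty => //; exact: measurable_domain. Qed.

Lemma time_interval_lty : (leb It < +oo)%E.
Proof.
rewrite /time_interval lebesgue_measure_itv/=; case: ifP => // _.
by rewrite -EFinB ltry.
Qed.

Lemma cylinder_lty : (lebesgue_xt R d cyl < +oo)%E.
Proof.
have := @product_measure1E _ _ _ _ R (lebesgue_rV d) leb _ _
  measurable_domain measurable_time.
rewrite /lebesgue_xt /cylinder /= => ->.
rewrite lte_mul_pinfty//; last exact: time_interval_lty.
by rewrite ge0_fin_numE//; exact: domain_lty.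
Qed.

Lemma test_function_L2x phi : test_function Omega phi -> L2x Omega phi.
Proof.
move=> tphi; have [M hM] := test_function_bounded tphi.
apply: (bounded_sqi measurable_domain domain_lty (M := M)) => //.
apply: measurable_funTS; apply: continuous_measurable_x; exact: Ck_continuous (tphi.1 0%N).
Qed.

Lemma test_function_L2xt phi : test_function cyl phi -> L2xt Omega T phi.
Proof.
move=> tphi; have [M hM] := test_function_bounded tphi.
apply: (bounded_sqi measurable_cylinder cylinder_lty (M := M)) => //.
apply: measurable_funTS; apply: continuous_measurable_xt; exact: Ck_continuous (tphi.1 0%N).
Qed.

Lemma test_function_L2t (phi : measurableTypeR R -> R) : test_function It phi -> L2t T phi.
Proof.
move=> tphi; have [M hM] := test_function_bounded tphi.
apply: (bounded_sqi measurable_time time_interval_lty (M := M)) => //.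
apply: measurable_funTS; apply: continuous_measurable_fun; exact: Ck_continuous (tphi.1 0%N).
Qed.

Lemma bump_in_interval k (a b t : R) : bump k a b t != 0 ->
  a + k%:R^-1 <= t <= b - k%:R^-1 /\ (0 < (k%:R : R)^-1).
Proof.
by move=> /bump_support[k0 -> ->]; rewrite invr_gt0 ltr0n.
Qed.

(** The product vanishes outside a closed box, which is compact and contained in the
    open box, hence in the cylinder. *)
Lemma test_function_bumps_xt (a b : option 'I_d -> R) k :
  cbox coord_xt a b `<=` cyl ->
  test_function cyl (fun z => \prod_i bump k (a i) (b i) (coord_xt i z)).
Proof.
move=> abD; split.
  move=> j; apply: Ck_prod => i; rewrite -[fun x => _]/(bump k (a i) (b i) \o coord_xt i).
  apply: (Ck_affine (A0 := coord_xt i)).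
  - case: i => [i|] z; last exact: cvg_snd.
    rewrite /coord_xt; apply: (@continuous_comp _ _ _ (fst : spacetime -> 'rV[R]_d)
      (fun x : 'rV[R]_d => x ord0 i)); first exact: cvg_fst.
    exact: coord_continuous.
  - by case: i => [i|] x v t //=; rewrite !mxE.
  - exact: Ck_bump.
pose S i := `[a i + k%:R^-1, b i - k%:R^-1]%classic.
have [k0|k0] := posnP k.
  exists set0; split; [exact: compact0|exact: sub0set|] => z _.
  rewrite (bigD1 None)//= [bump _ _ _ _](_ : _ = 0) ?mul0r//.
  by apply/eqP; apply: contraT => /bump_support[]; rewrite k0.
have k1 : 0 < (k%:R)^-1 :> R by rewrite invr_gt0 ltr0n.
exists ([set x : 'rV[R]_d | forall i, S (Some i) (x ord0 i)] `*` S None); split.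
- apply: compact_setX; last exact: segment_compact.
  by apply: (@rV_compact R d (fun i => S (Some i))) => i; exact: segment_compact.
- move=> z [h1 h2]; apply: abD => -[i|].
    by have := h1 i; rewrite /S /= in_itv/= => /andP[? ?]; apply/andP; split; lra.
  by move: h2; rewrite /S /= in_itv/= => /andP[? ?]; apply/andP; split; lra.
- move=> z nz; apply/eqP; apply: contra_notT nz => nz.
  have h i : a i + k%:R^-1 <= coord_xt i z <= b i - k%:R^-1.
    have : bump k (a i) (b i) (coord_xt i z) != 0.
      by move/prodf_neq0 : nz => /(_ i); apply.
    by move/bump_in_interval => [].
  by split; [move=> i; have := h (Some i)|have := h None]; rewrite /S /= in_itv.
Qed.

Lemma test_function_bumps_t (a b : unit -> R) k :
  cbox coord_t a b `<=` It ->
  test_function It (fun t : measurableTypeR R => \prod_i bump k (a i) (b i) (coord_t i t)).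
Proof.
move=> abD; split.
  move=> j; apply: Ck_prod => i; exact: Ck_bump.
pose S := `[a tt + k%:R^-1, b tt - k%:R^-1]%classic.
have [k0|k0] := posnP k.
  exists set0; split; [exact: compact0|exact: sub0set|] => z _.
  rewrite (bigD1 tt)//= [bump _ _ _ _](_ : _ = 0) ?mul0r//.
  by apply/eqP; apply: contraT => /bump_support[]; rewrite k0.
have k1 : 0 < (k%:R)^-1 :> R by rewrite invr_gt0 ltr0n.
exists S; split; first exact: segment_compact.
- move=> z; rewrite /S /= in_itv/= => /andP[? ?]; apply: abD => -[].
  by rewrite /coord_t; apply/andP; split; lra.
- move=> z nz; apply/eqP; apply: contra_notT nz => /prodf_neq0 /(_ tt isT).
  by move/bump_in_interval => []; rewrite /S /= in_itv.
Qed.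

(** The fundamental lemma of the calculus of variations on the cylinder. *)
Lemma L2xt_orthogonal_eq0 (H : spacetime -> R) : L2xt Omega T H ->
  (forall phi, test_function cyl phi -> dotL2 (lebesgue_xt R d) cyl H phi = 0) ->
  ae_eq (lebesgue_xt R d) cyl H (cst 0).
Proof.
move=> sH orth; apply: (orthogonal_bumps_eq0 measurable_coord_xt cboxes_xt_generate).
- apply: open_locally_cbox_xt; apply: (@openI _ (fst @^-1` Omega) (snd @^-1` It)).
    by apply: open_comp => // z _; exact: cvg_fst.
  by apply: open_comp => [z _|]; [exact: cvg_snd|exact: interval_open].
- exact: sqi_integrable measurable_cylinder cylinder_lty _ sH.
- by move=> a b k abD; apply: orth; exact: test_function_bumps_xt.
Qed.

Lemma L2t_orthogonal_eq0 (h : measurableTypeR R -> R) : L2t T h ->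
  (forall phi, test_function It phi -> dotL2 leb It h phi = 0) ->
  ae_eq leb It h (cst 0).
Proof.
move=> sH orth; apply: (orthogonal_bumps_eq0 measurable_coord_t cboxes_t_generate).
- by apply: open_locally_cbox_t; exact: interval_open.
- exact: sqi_integrable measurable_time time_interval_lty _ sH.
- by move=> a b k abD; apply: orth; exact: test_function_bumps_t.
Qed.

End domain.

(** * Primitives *)

Section primitives.
Context {R : realType}.
Local Notation leb := (@lebesgue_measure R).
Implicit Types (T t s : R) (g h : measurableTypeR R -> R).
Local Notation int T g := (leb.-integrable (time_interval T) (EFin \o g)).

Definition prim g t : R := \int[leb]_(s in time_interval t) g s.

Lemma prim_le0 g t : t <= 0 -> prim g t = 0.
Proof.
move=> t0; rewrite /prim /time_interval set_itv_ge ?Rintegral_set0//.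
by rewrite bnd_simp -leNgt.
Qed.

Lemma time_interval_sub t T : t <= T -> time_interval t `<=` time_interval T.
Proof. by move=> tT; apply: subset_itvl; rewrite bnd_simp. Qed.

Lemma integrable_prefix g t T : t <= T -> int T g -> int t g.
Proof.
move=> tT; apply: integrableS; [exact: measurable_itv..|].
exact: time_interval_sub.
Qed.

Lemma primD g h T t : t <= T -> int T g -> int T h ->
  prim (fun s => g s + h s) t = prim g t + prim h t.
Proof.
by move=> tT Ig Ih; apply: RintegralD => //; [exact: measurable_itv|
  exact: integrable_prefix Ig|exact: integrable_prefix Ih].
Qed.

Lemma primZ a g T t : t <= T -> int T g -> prim (fun s => a * g s) t = a * prim g t.
Proof.
by move=> tT Ig; apply: RintegralZl => //; [exact: measurable_itv|
  exact: integrable_prefix Ig].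
Qed.

Lemma ae_eq_prim g h T t : t <= T -> int T g -> int T h ->
  ae_eq leb (time_interval T) g h -> prim g t = prim h t.
Proof.
move=> tT Ig Ih gh; apply: ae_eq_Rintegral.
- exact: measurable_itv.
- exact: measurable_of_integrable (integrable_prefix tT Ig).
- exact: measurable_of_integrable (integrable_prefix tT Ih).
- by apply: ae_eq_subset gh; exact: time_interval_sub.
Qed.

Lemma prim_indicator g T t : t <= T ->
  prim g t = \int[leb]_(s in time_interval T) ((s < t)%R%:R * g s).
Proof.
move=> tT; rewrite /prim.
rewrite (_ : time_interval t = time_interval T `&` [set s | s < t]).
  rewrite Rintegral_mkcondr; apply: eq_Rintegral => s _.
  rewrite patchE; case: ifPn => [/set_mem /= ->|st]; first by rewrite mul1r.
  suff -> : (s < t) = false by rewrite mul0r.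
  by apply/negP => st'; move: st; rewrite mem_set.
apply/seteqP; split=> s; rewrite /time_interval /= !in_itv/=.
  by move=> /andP[-> st]; rewrite (lt_le_trans st).
by move=> [/andP[-> _] ->].
Qed.

Lemma le_prim_norm g T t : t <= T -> int T g ->
  `|prim g t| <= \int[leb]_(s in time_interval T) `|g s|.
Proof.
move=> tT Ig; rewrite (prim_indicator _ tT).
have mI := measurable_itv (Interval (BRight 0) (BLeft T)) : measurable (time_interval T).
have mlt : measurable_fun (time_interval T) (fun s : measurableTypeR R => (s < t)%R%:R : R).
  apply: (measurable_comp (F := setT) (f := fun b : bool => (b%:R : R))) => //.
  by apply: measurable_fun_ltr => //; exact: measurable_cst.
have Il : int T (fun s => (s < t)%R%:R * g s).
  apply: (le_integrableR mI (g := fun s => `|g s|)).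
  - by apply: measurable_funM => //; exact: measurable_of_integrable Ig.
  - exact: integrable_norm.
  - by move=> s _; case: (s < t); rewrite ?mul1r ?mul0r ?normr0.
apply: le_trans (le_normr_Rintegral mI Il) _.
apply: le_Rintegral => //.
- exact: integrable_norm.
- exact: integrable_norm.
- by move=> s _; case: (s < t); rewrite ?mul1r ?mul0r ?normr0.
Qed.

Section fubini_square.
Variables (T : R) (g h : measurableTypeR R -> R).
Hypotheses (Ig : int T g) (Ih : int T h).
Let I := time_interval T.
Let mI : measurable I. Proof. exact: measurable_itv. Qed.

Lemma integrable_triangle (r : rel R) :
  measurable_fun (setT : set (measurableTypeR R * measurableTypeR R)) (fun z => r z.1 z.2) ->
  (leb \x leb)%E.-integrable (I `*` I)
    (EFin \o (fun z : measurableTypeR R * measurableTypeR R => (r z.1 z.2)%:R * (g z.1 * h z.2))).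
Proof.
move=> mr; have mII : measurable (I `*` I) by exact: measurableX.
have Igh := integrable_tensor mI mI Ig Ih.
apply: (le_integrableR mII _ (integrable_norm Igh)).
  apply: measurable_funM; last exact: measurable_of_integrable Igh.
  by apply: measurable_funTS; exact: (measurableT_comp (f := fun b : bool => (b%:R : R))).
move=> z _; rewrite /=; case: (r _ _).
  by rewrite mul1r.
by rewrite mul0r normr0.
Qed.

(** Integrating [g s * h t] over the triangles [s < t] and [t < s] covers the
    square up to its diagonal, which is a null set. *)
Lemma integration_by_parts_prim :
  \int[leb]_(t in I) (g t * prim h t) + \int[leb]_(t in I) (prim g t * h t) =
  prim g T * prim h T.
Proof.
have mlt : measurable_fun (setT : set (measurableTypeR R * measurableTypeR R)) (fun z => z.2 < z.1).
  by apply: measurable_fun_ltr; [exact: measurable_snd|exact: measurable_fst].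
have mgt : measurable_fun (setT : set (measurableTypeR R * measurableTypeR R)) (fun z => z.1 < z.2).
  by apply: measurable_fun_ltr; [exact: measurable_fst|exact: measurable_snd].
have mtt : measurable_fun (setT : set (measurableTypeR R * measurableTypeR R)) (fun z => true).
  exact: measurable_cst.
have J1 := integrable_triangle (r := fun s t => t < s) mlt.
have J2 := integrable_triangle (r := fun s t => s < t) mgt.
have J3 := integrable_triangle (r := fun _ _ => true) mtt.
have -> : \int[leb]_(t in I) (g t * prim h t) =
    \int[(leb \x leb)%E]_(z in I `*` I) ((z.2 < z.1)%R%:R * (g z.1 * h z.2)).
  rewrite (Rintegral_fubini1 mI mI J1); apply: eq_Rintegral => t /set_mem It.
  have tT : t <= T by move: It; rewrite /I /time_interval /= in_itv/= => /andP[_ /ltW].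
  rewrite (prim_indicator _ tT) -RintegralZl//.
    by apply: eq_Rintegral => s _ /=; ring.
  apply: (le_integrableR mI _ (integrable_norm Ih)).
    apply: measurable_funM; last exact: measurable_of_integrable Ih.
    apply: (measurable_comp (F := setT) (f := fun b : bool => (b%:R : R))) => //.
    by apply: measurable_fun_ltr => //; exact: measurable_cst.
  by move=> s _ /=; case: (s < t); rewrite ?mul1r ?mul0r ?normr0.
have -> : \int[leb]_(t in I) (prim g t * h t) =
    \int[(leb \x leb)%E]_(z in I `*` I) ((z.1 < z.2)%R%:R * (g z.1 * h z.2)).
  rewrite (Rintegral_fubini2 mI mI J2); apply: eq_Rintegral => t /set_mem It.
  have tT : t <= T by move: It; rewrite /I /time_interval /= in_itv/= => /andP[_ /ltW].
  rewrite (prim_indicator _ tT) -RintegralZr//.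
    by apply: eq_Rintegral => s _ /=; ring.
  apply: (le_integrableR mI _ (integrable_norm Ig)).
    apply: measurable_funM; last exact: measurable_of_integrable Ig.
    apply: (measurable_comp (F := setT) (f := fun b : bool => (b%:R : R))) => //.
    by apply: measurable_fun_ltr => //; exact: measurable_cst.
  by move=> s _ /=; case: (s < t); rewrite ?mul1r ?mul0r ?normr0.
have -> : prim g T * prim h T =
    \int[(leb \x leb)%E]_(z in I `*` I) (true%:R * (g z.1 * h z.2)).
  rewrite (Rintegral_fubini1 mI mI J3) -RintegralZr//.
  apply: eq_Rintegral => t _; rewrite -RintegralZl//.
  by apply: eq_Rintegral => s _; rewrite mul1r.
have mII : measurable (I `*` I) by exact: measurableX.
rewrite -RintegralD//; apply: ae_eq_Rintegral => //.
- exact: measurable_of_integrable (integrableDR mII J1 J2).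
- exact: measurable_of_integrable J3.
have diag : {ae (leb \x leb)%E, forall z : measurableTypeR R * measurableTypeR R, z.1 != z.2}.
  have mE : measurable [set z : measurableTypeR R * measurableTypeR R | z.1 = z.2].
    have meq : measurable_fun (setT : set (measurableTypeR R * measurableTypeR R)) (fun z => z.1 == z.2).
      by apply: measurable_fun_eqr; [exact: measurable_fst|exact: measurable_snd].
    have mtrue : measurable [set true] by [].
    have := meq measurableT _ mtrue; rewrite setTI.
    by congr measurable; apply/seteqP; split=> z /= /eqP.
  exists [set z | z.1 = z.2]; split=> //; last by move=> z /= /negP; rewrite negbK => /eqP.
  rewrite /product_measure1 /= integral0_eq// => x _ /=.
  rewrite (_ : xsection _ _ = [set x]) ?lebesgue_measure_set1//.
  by apply/seteqP; split=> y; rewrite /xsection/= inE.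
apply: filterS diag => z + _; rewrite neq_lt => /orP[] zz; rewrite zz (lt_gtF zz) /=; ring.
Qed.

End fubini_square.
End primitives.

(** * The weighted product in time *)

#[export] Hint Resolve measurable_time : core.

Section calculus.
Context {R : realType}.
Local Notation leb := (@lebesgue_measure R).
Local Notation int T g := (leb.-integrable (time_interval T) (EFin \o g)).

Lemma measurable_prim (g : measurableTypeR R -> R) T : int T g ->
  measurable_fun (time_interval T) (prim g).
Proof.
move=> Ig.
have I1 : int T (fun=> 1).
  apply: sqi_integrable => //; first exact: time_interval_lty.
  by apply: sqi_cst => //; exact: time_interval_lty.
have mr : measurable_fun (setT : set (measurableTypeR R * measurableTypeR R)) (fun z => z.1 < z.2).
  by apply: measurable_fun_ltr; [exact: measurable_fst|exact: measurable_snd].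
have J := integrable_triangle Ig I1 (r := fun s t => s < t) mr.
have := measurable_of_integrable (integrable_int_section (measurable_time T) (measurable_time T) J).
apply: eq_measurable_fun => t /set_mem; rewrite /time_interval /= in_itv/= => /andP[_ /ltW tT].
by rewrite (prim_indicator _ tT); apply: eq_Rintegral => s _ /=; rewrite mulr1.
Qed.

Lemma L2t_prim (g : measurableTypeR R -> R) T : int T g -> L2t T (prim g).
Proof.
move=> Ig; apply: (bounded_sqi (measurable_time T) (time_interval_lty T)
  (M := \int[leb]_(s in time_interval T) `|g s|)).
  exact: measurable_prim.
move=> t; rewrite /time_interval /= in_itv/= => /andP[_ /ltW tT].
exact: le_prim_norm.
Qed.

Lemma integrable_mul_prim (g h : measurableTypeR R -> R) T a : int T g -> int T h ->
  int T (fun s => g s * (a + prim h s)).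
Proof.
move=> Ig Ih.
apply: (le_integrableR (measurable_time T) (g := fun s => (`|a| + \int[leb]_(s in time_interval T) `|h s|) * `|g s|)).
- apply: measurable_funM; first exact: measurable_of_integrable Ig.
  by apply: measurable_funD => //; exact: measurable_prim.
- by apply: integrableZR => //; exact: integrable_norm.
- move=> t; rewrite /time_interval /= in_itv/= => /andP[_ /ltW tT].
  rewrite normrM mulrC ler_wpM2r// (le_trans (ler_normD _ _))// lerD2l.
  exact: le_prim_norm.
Qed.

Lemma integration_by_parts_affine (g h : measurableTypeR R -> R) T a b :
  int T g -> int T h ->
  \int[leb]_(t in time_interval T) (g t * (b + prim h t)) +
  \int[leb]_(t in time_interval T) (h t * (a + prim g t)) =
  (a + prim g T) * (b + prim h T) - a * b.
Proof.
move=> Ig Ih.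
have E (f k : measurableTypeR R -> R) c : int T f -> int T k ->
    \int[leb]_(t in time_interval T) (f t * (c + prim k t)) =
    c * prim f T + \int[leb]_(t in time_interval T) (f t * prim k t).
  move=> If Ik.
  under eq_Rintegral do rewrite mulrDr.
  rewrite RintegralD//.
  - by rewrite RintegralZr// mulrC.
  - by apply: eq_integrable (integrableZR (measurable_time T) c If) => // x _ /=; rewrite mulrC.
  - have := integrable_mul_prim 0 If Ik.
    by apply: eq_integrable => // x _ /=; rewrite add0r.
rewrite !E//.
have := integration_by_parts_prim Ig Ih.
under [X in _ + X]eq_Rintegral do rewrite mulrC.
by move=> H; rewrite addrACA H; ring.
Qed.

Lemma prim_product_rule (g h : measurableTypeR R -> R) T a b t :
  int T g -> int T h -> t <= T ->
  (a + prim g t) * (b + prim h t) =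
  a * b + prim (fun s => g s * (b + prim h s) + h s * (a + prim g s)) t.
Proof.
move=> Ig Ih tT; have Igt := integrable_prefix tT Ig; have Iht := integrable_prefix tT Ih.
have -> : prim (fun s => g s * (b + prim h s) + h s * (a + prim g s)) t =
    (a + prim g t) * (b + prim h t) - a * b.
  by rewrite -integration_by_parts_affine// -RintegralD//; exact: integrable_mul_prim.
by ring.
Qed.

Lemma prim_derive (phi dphi : R -> R) t :
  (forall x : R, is_derive x 1 phi (dphi x)) -> continuous dphi -> 0 <= t ->
  prim dphi t = phi t - phi 0.
Proof.
move=> D cd; rewrite le_eqVlt => /predU1P[<-|t0]; first by rewrite prim_le0// subrr.
have cphi : continuous phi.
  move=> x; apply/differentiable_continuous/derivable1_diffP.
  exact: (@ex_derive _ _ _ _ _ _ _ (D x)).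
have cw : {within `[0, t], continuous dphi} by exact: continuous_subspaceT.
have := continuous_FTC2 (f := dphi) (F := phi) t0 cw.
have Icc : leb.-integrable `[0, t] (EFin \o dphi).
  by apply: continuous_compact_integrable => //; exact: segment_compact.
rewrite /prim /time_interval => H.
have -> : \int[leb]_(s in `]0, t[%classic) dphi s = \int[leb]_(s in `[0, t]%classic) dphi s.
  rewrite Rintegral_itv_bndo_bndc; last first.
    by apply: integrableS Icc => //; apply: subset_itv; rewrite bnd_simp.
  rewrite Rintegral_itv_obnd_cbnd//.
  by apply: integrableS Icc => //; apply: subset_itv; rewrite bnd_simp.
rewrite /Rintegral H//; first split.
- by move=> x _; exact: (@ex_derive _ _ _ _ _ _ _ (D x)).
- exact: cvg_at_right_filter (cphi 0).
- exact: cvg_at_left_filter (cphi t).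
- by move=> x _; rewrite derive1E (@derive_val _ _ _ _ _ _ _ (D x)).
Qed.

Section weighted.
Variables (T : R).
Hypothesis T0 : 0 < T.
Local Notation It := (time_interval T).
Implicit Types f g h : measurableTypeR R -> R.

Definition weight (s : R) : R := expR (- (s / T)).

Definition dot_w f g : R := \int[leb]_(s in It) (f s * g s * weight s).

Lemma continuous_weight : continuous weight.
Proof.
move=> x; apply: continuous_comp; last exact: continuous_expR.
by apply: cvgN; apply: cvgMr_tmp; exact: cvg_id.
Qed.

Lemma measurable_weight (D : set (measurableTypeR R)) : measurable_fun D weight.
Proof. by apply: measurable_funTS; apply: continuous_measurable_fun; exact: continuous_weight. Qed.

Lemma weight_gt0 s : 0 < weight s. Proof. exact: expR_gt0. Qed.

Lemma weight_le1 s : 0 <= s -> weight s <= 1.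
Proof. by move=> s0; rewrite expR_le1 oppr_le0 divr_ge0// ltW. Qed.

Lemma weightT : weight T = expR (-1).
Proof. by rewrite /weight divff// gt_eqF. Qed.

Lemma is_derive_weight (x : R) : is_derive x 1 weight (- T^-1 * weight x).
Proof.
have d1 : is_derive x 1 (fun s : R => - (s / T)) (- T^-1).
  have -> : (fun s : R => - (s / T)) = (fun s => - T^-1 *: s).
    by apply/funext => s; rewrite /GRing.scale/= mulNr mulrC.
  by apply: (@is_derive_eq _ _ _ _ _ _ _ _ (is_deriveZ _ (is_derive_id _ _))); rewrite /GRing.scale/= mulr1.
have := @is_derive1_comp _ expR _ x _ _ (is_derive_expR _) d1.
by move=> d2; apply: (@is_derive_eq _ _ _ _ _ _ _ _ d2); rewrite mulrC.
Qed.

Lemma weight_prim t : 0 <= t -> weight t = 1 + prim (fun s => - T^-1 * weight s) t.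
Proof.
move=> t0; rewrite (prim_derive is_derive_weight)//; last first.
  by move=> x; apply: cvgMl_tmp; exact: continuous_weight.
by rewrite /weight mul0r oppr0 expR0; ring.
Qed.

Lemma weight_sqi g : L2t T g -> L2t T (fun s => g s * weight s).
Proof.
move=> sg; under eq_fun do rewrite mulrC.
apply: (sqi_bounded (measurable_time T) (M := 1)) => //; first exact: measurable_weight.
apply: aeW => s; rewrite /time_interval /= in_itv/= => /andP[/ltW s0 _].
by rewrite ger0_norm ?weight_le1// ltW// weight_gt0.
Qed.

Lemma dot_wE f g : dot_w f g = dotL2 leb It f (fun s => g s * weight s).
Proof. by apply: eq_Rintegral => s _; rewrite mulrA. Qed.

Lemma dot_wC f g : dot_w f g = dot_w g f.
Proof. by apply: eq_Rintegral => s _; rewrite [f s * _]mulrC. Qed.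

Lemma integrable_w f g : L2t T f -> L2t T g -> int T (fun s => f s * g s * weight s).
Proof.
move=> sf sg; apply: eq_integrable (sqiM_integrable (measurable_time T) sf (weight_sqi sg)) => //.
by move=> s _ /=; rewrite mulrA.
Qed.

Lemma dot_wDl f g h : L2t T f -> L2t T g -> L2t T h ->
  dot_w (fun s => f s + g s) h = dot_w f h + dot_w g h.
Proof. by move=> sf sg sh; rewrite !dot_wE dotL2Dl//; exact: weight_sqi. Qed.

Lemma dot_wZl a f h : L2t T f -> L2t T h -> dot_w (fun s => a * f s) h = a * dot_w f h.
Proof. by move=> sf sh; rewrite !dot_wE dotL2Zl//; exact: weight_sqi. Qed.

Lemma dot_wDr f g h : L2t T f -> L2t T g -> L2t T h ->
  dot_w h (fun s => f s + g s) = dot_w h f + dot_w h g.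
Proof. by move=> *; rewrite dot_wC dot_wDl// ![dot_w _ h]dot_wC. Qed.

Lemma dot_wZr a f h : L2t T f -> L2t T h -> dot_w h (fun s => a * f s) = a * dot_w h f.
Proof. by move=> *; rewrite dot_wC dot_wZl// [dot_w _ h]dot_wC. Qed.

Lemma dot_w_suml (J : Type) (r : seq J) (a : J -> R) (f : J -> _) h :
  (forall i, L2t T (f i)) -> L2t T h ->
  dot_w (fun s => \sum_(i <- r) a i * f i s) h = \sum_(i <- r) a i * dot_w (f i) h.
Proof.
move=> sf sh; rewrite dot_wE dotL2_suml//; last exact: weight_sqi.
by apply: eq_bigr => i _; rewrite dot_wE.
Qed.

Lemma dot_w_ge0 f : 0 <= dot_w f f.
Proof.
apply: Rintegral_ge0 => s _; rewrite mulr_ge0//; last exact/ltW/weight_gt0.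
by rewrite -expr2 sqr_ge0.
Qed.

Lemma ae_eq_dot_w f f' g g' : L2t T f -> L2t T f' -> L2t T g -> L2t T g' ->
  ae_eq leb It f f' -> ae_eq leb It g g' -> dot_w f g = dot_w f' g'.
Proof.
move=> sf sf' sg sg' ff' gg'; rewrite !dot_wE.
apply: ae_eq_dotL2 => //; [exact: sf.1|exact: sf'.1|exact: (weight_sqi sg).1|exact: (weight_sqi sg').1|].
by apply: filterS gg' => s gs Is; rewrite gs.
Qed.

Lemma dot_w_eq0 f : L2t T f -> dot_w f f = 0 -> ae_eq leb It f (cst 0).
Proof.
move=> sf f0.
have p0 s : It s -> 0 <= f s * f s * weight s.
  by move=> _; rewrite mulr_ge0//; [rewrite -expr2 sqr_ge0|exact/ltW/weight_gt0].
apply: filterS (Rintegral_eq0_ae (measurable_time T) (integrable_w sf sf) p0 f0) => s H Is.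
move: (H Is) => /eqP; rewrite mulf_eq0 (gt_eqF (weight_gt0 _)) orbF mulf_eq0 orbb.
by move/eqP.
Qed.

(** The product of two primitives is a primitive, and so is the weight; the last term
    comes from the derivative of the weight. It makes the pairing of a function with its
    own derivative coercive. *)
Lemma weighted_integration_by_parts g h a b : L2t T g -> L2t T h ->
  dot_w g (fun s => b + prim h s) + dot_w h (fun s => a + prim g s) =
  expR (-1) * (a + prim g T) * (b + prim h T) - a * b
  + T^-1 * dot_w (fun s => a + prim g s) (fun s => b + prim h s).
Proof.
move=> sg sh.
have Ig := sqi_integrable (measurable_time T) (time_interval_lty T) sg.
have Ih := sqi_integrable (measurable_time T) (time_interval_lty T) sh.
have sc c : L2t T (fun=> c) by apply: sqi_cst => //; exact: time_interval_lty.
have sP : L2t T (fun s => a + prim g s) := sqiD (measurable_time T) (sc a) (L2t_prim Ig).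
have sQ : L2t T (fun s => b + prim h s) := sqiD (measurable_time T) (sc b) (L2t_prim Ih).
pose f s := g s * (b + prim h s) + h s * (a + prim g s).
have If : int T f by apply: integrableDR => //; exact: integrable_mul_prim.
have sK : L2t T weight.
  apply: (bounded_sqi (measurable_time T) (time_interval_lty T) (M := 1)).
    exact: measurable_weight.
  move=> s; rewrite /time_interval /= in_itv/= => /andP[/ltW s0 _].
  by rewrite ger0_norm ?weight_le1// ltW// weight_gt0.
have IK : int T (fun s => - T^-1 * weight s).
  by apply: integrableZR => //; exact: (sqi_integrable (measurable_time T) (time_interval_lty T) sK).
have := integration_by_parts_affine (a * b) 1 If IK.
rewrite -weight_prim ?ltW// weightT -(prim_product_rule a b Ig Ih (lexx T)) mulr1.
have -> : \int[leb]_(t in It) (f t * (1 + prim (fun s => - T^-1 * weight s) t)) =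
    dot_w g (fun s => b + prim h s) + dot_w h (fun s => a + prim g s).
  rewrite -RintegralD//; try exact: integrable_w.
  apply: eq_Rintegral => s /set_mem; rewrite /time_interval /= in_itv/= => /andP[/ltW s0 _].
  by rewrite -weight_prim// /f; ring.
have -> : \int[leb]_(t in It) (- T^-1 * weight t * (a * b + prim f t)) =
    - T^-1 * dot_w (fun s => a + prim g s) (fun s => b + prim h s).
  rewrite -RintegralZl//; last exact: integrable_w.
  apply: eq_Rintegral => s /set_mem; rewrite /time_interval /= in_itv/= => /andP[_ /ltW sT].
  by rewrite -(prim_product_rule a b Ig Ih sT); ring.
have alg (x t y p q k ab : R) : x + - t * y = p * q * k - ab -> x = k * p * q - ab + t * y.
  by move=> E; rewrite (_ : x = x + - t * y + t * y); [rewrite E|]; ring.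
exact: alg.
Qed.

End weighted.
End calculus.

(** * Weak derivatives in time *)

Section weak_derivatives_in_time.
Context {R : realType} (T : R).
Hypothesis T0 : 0 < T.
Local Notation leb := (@lebesgue_measure R).
Local Notation It := (time_interval T).
Local Notation dot := (dotL2 leb It).
Implicit Types u g h phi : measurableTypeR R -> R.

Lemma time_interval_measure t : 0 < t -> leb (time_interval t) = t%:E.
Proof.
by move=> t0; rewrite /time_interval lebesgue_measure_itv/= lte_fin t0 -EFinB subr0.
Qed.

Lemma L2t_integrable g : L2t T g -> leb.-integrable It (EFin \o g).
Proof. exact: (sqi_integrable (measurable_time T) (time_interval_lty T)). Qed.

Lemma L2t_cst c : L2t T (fun=> c).
Proof. by apply: sqi_cst => //; exact: time_interval_lty. Qed.

Lemma time_support (K : set R) : compact K -> K `<=` It ->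
  exists2 e : R, 0 < e & forall x, K x -> e <= x <= T - e.
Proof.
move=> cK KI; have oK : open (~` K).
  by apply: closed_openC; apply: compact_closed cK; exact: norm_hausdorff.
have [e0 /= e00 H0] : exists2 e : R, 0 < e & ball (0 : R) e `<=` ~` K.
  apply/nbhs_ballP; apply: open_nbhs_nbhs; split=> //.
  by move=> /KI; rewrite /time_interval /= in_itv/= ltxx.
have [e1 /= e10 H1] : exists2 e : R, 0 < e & ball T e `<=` ~` K.
  apply/nbhs_ballP; apply: open_nbhs_nbhs; split=> //.
  by move=> /KI; rewrite /time_interval /= in_itv/= ltxx andbF.
exists (Num.min e0 e1); first by rewrite lt_min e00.
move=> x Kx; have := KI x Kx; rewrite /time_interval /= in_itv/= => /andP[x0 xT].
have h0 : ~ ball (0 : R) e0 x by move=> /H0.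
have h1 : ~ ball T e1 x by move=> /H1.
have [m0 m1] : Num.min e0 e1 <= e0 /\ Num.min e0 e1 <= e1 by rewrite !ge_min !lexx orbT.
apply/andP; split.
  rewrite leNgt; apply/negP => xe; apply: h0; rewrite /ball /= sub0r normrN gtr0_norm//; lra.
rewrite leNgt; apply/negP => xe; apply: h1; rewrite /ball /= gtr0_norm ?subr_gt0//; lra.
Qed.

Lemma Ck_antiderivative (F f : R -> R) : (forall x : R, is_derive x 1 F (f x)) ->
  smooth f -> smooth F.
Proof.
move=> D sf.
have cF : continuous F.
  move=> x; apply/differentiable_continuous/derivable1_diffP.
  exact: (@ex_derive _ _ _ _ _ _ _ (D x)).
case=> [|k] //; split=> // v.
have Dv x := @derive_direction _ F x v (@ex_derive _ _ _ _ _ _ _ (D x)).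
split; first by move=> x; have [] := Dv x.
rewrite (_ : (fun x => _) = (fun x => v * f x)); first by apply: Ck_cstM; exact: sf.
by apply/funext => x; rewrite (Dv x).2 (@derive_val _ _ _ _ _ _ _ (D x)).
Qed.

(** To the right of the support of th, its antiderivative from the left is the integral
    of th, that is, 0. *)
Lemma antiderivative_test_function (th : R -> R) : test_function (It : set R) th ->
  \int[leb]_(s in It) th s = 0 ->
  exists2 F : R -> R, test_function (It : set R) F & forall x, 'D_1 F x = th x.
Proof.
move=> tth th0; have [sth [K [cK KI thK]]] := tth.
have [e e0 Ke] := time_support cK KI.
have th_out x : ~ (e <= x <= T - e) -> th x = 0.
  by move=> nx; apply: thK => Kx; apply: nx; exact: Ke.
have cth : continuous th := Ck_continuous (sth 0%N).
have Ith : leb.-integrable setT (EFin \o th).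
  have := (integrable_mkcond _ (measurable_time T)).1 (L2t_integrable (test_function_L2t tth)).
  apply: eq_integrable => // x _; rewrite patchE; case: ifPn => // xI.
  rewrite /= th_out// => /andP[h1 h2]; move: xI; rewrite mem_set//.
  by rewrite /time_interval /= in_itv/=; apply/andP; split; lra.
pose F x := \int[leb]_(t in `]-oo, x]%classic) th t.
have DF (x : R) : is_derive x 1 F (th x).
  have xx1 : x < x + 1 by rewrite ltrDl.
  have Ix : leb.-integrable [set` Interval -oo%O (BRight (x + 1))] (EFin \o th).
    by apply: integrableS Ith => //; exact: measurable_itv.
  have [d1 d2] := continuous_FTC1 xx1 Ix (ltNyr _) (cth x).
  by apply: DeriveDef; [exact: d1|rewrite -derive1E].
exists F; last by move=> x; rewrite (@derive_val _ _ _ _ _ _ _ (DF x)).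
split; first exact: (Ck_antiderivative DF sth).
exists `[e, T - e]%classic; split; first exact: segment_compact.
  by move=> x; rewrite /time_interval /= !in_itv/= => /andP[h1 h2]; apply/andP; split; lra.
move=> x; rewrite /= in_itv/= => nx; rewrite /F.
have [xe|ex] := ltP x e.
  transitivity (\int[leb]_(t in `]-oo, x]%classic) (0 : R)); last first.
    by rewrite Rintegral_cst ?mul0r//; exact: measurable_itv.
  apply: eq_Rintegral => t /set_mem; rewrite /= in_itv/= => tx.
  by rewrite th_out// => /andP[h1 _]; lra.
rewrite -th0 Rintegral_mkcond [RHS]Rintegral_mkcond; apply: eq_Rintegral => t _.
rewrite !patchE; case: ifPn => t1; case: ifPn => t2 //.
  rewrite th_out// => /andP[h1 h2]; move: t2; rewrite mem_set//.
  by rewrite /time_interval /= in_itv/=; apply/andP; split; lra.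
rewrite th_out// => /andP[h1 h2]; move: t1; rewrite mem_set//.
rewrite /= in_itv/=; apply: le_trans h2 _.
by rewrite leNgt; apply/negP => xT; apply: nx; rewrite ex ltW.
Qed.

Lemma exists_test_function_unit : exists2 eta : R -> R,
  test_function (It : set R) eta & \int[leb]_(s in It) eta s = 1.
Proof.
have [[phi tphi phi0]|H] := pselect (exists2 phi : R -> R, test_function (It : set R) phi &
    \int[leb]_(s in It) phi s != 0).
  exists (fun x => (\int[leb]_(s in It) phi s)^-1 * phi x); first exact: test_functionZ.
  rewrite RintegralZl//; first by rewrite mulVf.
  exact/L2t_integrable/test_function_L2t.
have : ae_eq leb It (fun=> 1 : R) (cst 0).
  apply: (L2t_orthogonal_eq0 (T := T)); first exact: L2t_cst.
  move=> phi tphi; rewrite /dotL2; under eq_Rintegral do rewrite mul1r.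
  by apply/eqP/negP => /negP nz; apply: H; exists phi.
move=> [N [mN N0 sub]]; have : (leb It <= leb N)%E.
  apply: le_measure; rewrite ?inE//.
  by move=> x Ix; apply: sub => /= /(_ Ix) /eqP; rewrite oner_eq0.
by rewrite N0 time_interval_measure// lee_fin leNgt T0.
Qed.

(** The lemma of du Bois-Reymond. Let eta be a test function of integral 1: any test function
    psi differs from a multiple of eta by a function of integral 0, which is the
    derivative of a test function. *)
Lemma constant_of_weak_deriv0 w : L2t T w ->
  (forall phi, test_function It phi -> dot w ('D_1 phi) = 0) ->
  exists c, ae_eq leb It w (cst c).
Proof.
move=> sw orth; have [eta teta eta1] := exists_test_function_unit.
have seta := test_function_L2t teta; have s1 := L2t_cst 1.
exists (dot w eta).
have : ae_eq leb It (fun s => w s - dot w eta) (cst 0).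
  apply: (L2t_orthogonal_eq0 (T := T)); first exact: (sqiB (measurable_time T) sw (L2t_cst _)).
  move=> psi tpsi; have spsi := test_function_L2t tpsi.
  pose c := \int[leb]_(s in It) psi s.
  have tth : test_function It (fun s => psi s + - c * eta s).
    by apply: test_functionD => //; exact: test_functionZ.
  have [||F tF FE] := @antiderivative_test_function (fun s => psi s + - c * eta s) => //.
    rewrite RintegralD//; [|exact: L2t_integrable|].
      by rewrite RintegralZl//; [rewrite eta1 -/c; ring|exact: L2t_integrable].
    by apply: integrableZR => //; exact: L2t_integrable.
  have := orth F tF; rewrite (_ : 'D_1 F = fun s => psi s + - c * eta s); last exact/funext.
  have sceta : L2t T (fun s => - c * eta s) by exact: sqiZ.
  rewrite dotL2Dr// dotL2Zr// => H.
  rewrite dotL2Bl//; last exact: L2t_cst.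
  have -> : dot (fun=> dot w eta) psi = dot w eta * c.
    rewrite /c -RintegralZl//; exact: L2t_integrable.
  by move: H; lra.
by apply: filterS => s H Is; apply/eqP; rewrite -subr_eq0; apply/eqP; exact: H.
Qed.

Lemma weak_deriv_unique u g h : is_weak_deriv T u g -> is_weak_deriv T u h ->
  ae_eq leb It g h.
Proof.
move=> [sg Hg] [sh Hh].
have : ae_eq leb It (fun s => g s - h s) (cst 0).
  apply: (L2t_orthogonal_eq0 (T := T)); first exact: sqiB.
  move=> phi tphi; rewrite dotL2Bl//; last exact: test_function_L2t.
  by have := Hg phi tphi; rewrite Hh// => /oppr_inj ->; rewrite subrr.
by apply: filterS => s H Is; apply/eqP; rewrite -subr_eq0; apply/eqP; exact: H.
Qed.

Lemma L2t_derive_test phi : test_function It phi -> L2t T ('D_1 phi).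
Proof. by move=> tphi; apply: test_function_L2t; exact: test_function_derive. Qed.

Lemma weak_deriv_linear a u v g h : L2t T u -> L2t T v ->
  is_weak_deriv T u g -> is_weak_deriv T v h ->
  is_weak_deriv T (fun s => a * u s + v s) (fun s => a * g s + h s).
Proof.
move=> su sv [sg Hg] [sh Hh].
have sag : L2t T (fun s => a * g s) by exact: sqiZ.
have sau : L2t T (fun s => a * u s) by exact: sqiZ.
split; first exact: sqiD.
move=> phi tphi; have sp := test_function_L2t tphi; have sdp := L2t_derive_test tphi.
by rewrite !dotL2Dl// !dotL2Zl// Hg// Hh//; ring.
Qed.

Lemma ae_eq_weak_deriv u v g : measurable_fun It u -> measurable_fun It v ->
  ae_eq leb It u v -> is_weak_deriv T u g -> is_weak_deriv T v g.
Proof.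
move=> mu mv uv [sg Hg]; split=> // phi tphi; rewrite -Hg//.
have mp := (L2t_derive_test tphi).1.
apply: (ae_eq_dotL2 (measurable_time T) mv mu mp mp (ae_eq_sym uv)); exact: ae_eq_refl.
Qed.

Lemma prim_weak_deriv g : L2t T g -> is_weak_deriv T (prim g) g.
Proof.
move=> sg; split=> // phi tphi; have Ig := L2t_integrable sg.
have [sphi [K [cK KI phiK]]] := tphi.
have phi0 : phi 0 = 0 by apply: phiK => /KI; rewrite /time_interval /= in_itv/= ltxx.
have phiT : phi T = 0 by apply: phiK => /KI; rewrite /time_interval /= in_itv/= ltxx andbF.
have D (x : R) : is_derive x 1 phi ('D_1 phi x).
  by apply: DeriveDef => //; have [_ /(_ 1)[+ _]] := sphi 1%N; exact.
have cd : continuous ('D_1 phi).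
  by have [_ /(_ 1)[_ +]] := sphi 1%N.
have pE t : 0 <= t -> prim ('D_1 phi) t = phi t.
  by move=> t0; rewrite (prim_derive D cd t0) phi0 subr0.
have Id : leb.-integrable It (EFin \o ('D_1 phi)) by exact/L2t_integrable/L2t_derive_test.
have := integration_by_parts_prim Ig Id; rewrite (pE T (ltW T0)) phiT mulr0.
have -> : \int[leb]_(t in It) (g t * prim ('D_1 phi) t) = dot g phi.
  apply: eq_Rintegral => t /set_mem; rewrite /time_interval /= in_itv/= => /andP[/ltW t0 _].
  by rewrite pE.
by rewrite /dotL2; lra.
Qed.

(** The primitive of g differs from u by a constant. Both are continuous and
    vanish at 0, so that the constant is 0. *)
Lemma H10_left_prim u g : H10_left T u -> is_weak_deriv T u g ->
  ae_eq leb It u (prim g).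
Proof.
move=> [su _ [ub [cub ub0 uub]]] Hug; have sg := Hug.1; have Ig := L2t_integrable sg.
have sp : L2t T (prim g) := L2t_prim Ig.
have [c wc] : exists c, ae_eq leb It (fun s => u s - prim g s) (cst c).
  apply: constant_of_weak_deriv0; first exact: sqiB.
  move=> phi tphi; have sdp := L2t_derive_test tphi.
  by rewrite dotL2Bl// Hug.2// (prim_weak_deriv sg).2// subrr.
suff c0 : c = 0.
  apply: filterS wc => s H Is; apply/eqP; rewrite -subr_eq0; apply/eqP.
  by rewrite H.
apply/eqP/negP => /negP c0; have nc : 0 < `|c| / 2 by rewrite divr_gt0 ?normr_gt0.
(* near 0 both the continuous representative and the primitive are small *)
have near0 : \forall t \near (0 : R)^'+, `|ub t| < `|c| / 2.
  have : ub @ 0^'+ --> (0 : R).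
    by have [_ + _] := (continuous_within_itvP ub T0).1 cub; rewrite ub0.
  by move/cvgr0Pnorm_lt => /(_ _ nc).
have near1 : \forall t \near (0 : R)^'+, `|prim g t| < `|c| / 2.
  pose G := normL2 leb It g.
  have G0 : 0 <= G by exact: sqrtr_ge0.
  near=> t.
  have t0 : 0 < t by near: t; exact: nbhs_right_gt.
  have tT : t <= T by near: t; exact: nbhs_right_le.
  have sgt : square_integrable leb (time_interval t) g.
    split; first exact: measurable_of_integrable (integrable_prefix tT Ig).
    by apply: integrableS sg.2 => //; exact: time_interval_sub.
  have s1 : square_integrable leb (time_interval t) (fun=> 1 : R).
    by apply: sqi_cst => //; exact: time_interval_lty.
  have -> : prim g t = dotL2 leb (time_interval t) g (fun=> 1).
    by apply: eq_Rintegral => s _; rewrite mulr1.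
  rewrite -(@ltr_pXn2r _ 2)// ?nnegrE ?ltW// real_normK ?num_real//.
  apply: le_lt_trans (dotL2_CS (measurable_time t) sgt s1) _.
  have -> : dotL2 leb (time_interval t) (fun=> 1 : R) (fun=> 1) = t.
    have E := Rintegral_cst leb (measurable_time t) (1 * 1 : R).
    rewrite /dotL2 E !mul1r -[RHS]/(fine t%:E); congr fine; exact: time_interval_measure.
  have : dotL2 leb (time_interval t) g g <= G ^+ 2.
    rewrite normL2_sqr// /dotL2.
    rewrite -(setIidr (time_interval_sub tT)) Rintegral_mkcondr.
    apply: le_Rintegral => //.
    - apply: (@eq_integrable _ _ _ leb It (measurable_time T)
          (((fun s => (g s * g s)%:E) \_ (time_interval t))%E)).
        by move=> s _; rewrite /= restrict_EFin.
      apply/integrable_restrict => //; rewrite setIidr; last exact: time_interval_sub.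
      exact: (sqiM_integrable (measurable_time t) sgt sgt).
    - exact: sqiM_integrable.
    - move=> s _; rewrite patchE; case: ifP => // _.
      by rewrite -expr2 sqr_ge0.
  move=> H; apply: le_lt_trans (ler_wpM2r (ltW t0) H) _.
  apply: (@le_lt_trans _ _ ((G ^+ 2 + 1) * t)).
    by have := sqr_ge0 G; nra.
  rewrite mulrC -ltr_pdivlMr ?ltr_wpDl ?sqr_ge0//; near: t.
  by apply: nbhs_right_lt; rewrite divr_gt0 ?exprn_gt0// ltr_wpDl ?sqr_ge0.
have [e /= e0 He] : exists2 e : R, 0 < e & forall t, 0 < t -> t < e ->
    `|ub t| < `|c| / 2 /\ `|prim g t| < `|c| / 2.
  have [e /= e0 He] := filterI near0 near1; exists e => // t t0 te.
  by apply: He => //; rewrite /ball /= sub0r normrN gtr0_norm.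
have [N [mN N0 sub]] := filterI uub wc.
pose m := Num.min e T.
have m0 : 0 < m by rewrite lt_min e0.
have : (leb (time_interval m) <= leb N)%E.
  apply: le_measure; rewrite ?inE//.
  move=> t; rewrite /time_interval /= in_itv/= => /andP[t0]; rewrite lt_min => /andP[te tT].
  apply: sub => -[H1 H2].
  have It' : It t by rewrite /time_interval /= in_itv/= t0.
  have [h1 h2] := He t t0 te.
  have cE : ub t - prim g t = c by rewrite -H1// H2.
  have : `|c| < `|c| by rewrite -{1}cE; apply: le_lt_trans (ler_normB _ _) _; lra.
  by rewrite ltxx.
by rewrite N0 time_interval_measure// lee_fin leNgt m0.
Unshelve. all: by end_near. Qed.

End weak_derivatives_in_time.

(** * Weak gradients and the energy form *)

Lemma ge0_le_epsilon (R : realFieldType) (x K : R) : 0 <= K ->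
  (forall e, 0 < e -> x <= K * e) -> x <= 0.
Proof.
move=> K0 H; apply/ler_addgt0Pl => e e0; rewrite addr0.
have K1 : 0 < K + 1 by rewrite ltr_wpDl.
apply: le_trans (H (e / (K + 1)) (divr_gt0 e0 K1)) _.
by rewrite mulrCA ler_piMr ?(ltW e0)// ler_pdivrMr// mul1r lerDl.
Qed.

Section weak_gradients.
Context {R : realType} {d : nat} (Omega : set 'rV[R]_d).
Hypotheses (oO : open Omega) (bO : bounded_set Omega).
Local Notation L2 := (L2x Omega).
Local Notation dot := (dotx Omega).
Local Notation wg := (weak_grad Omega).
Local Notation mu := (lebesgue_rV d).
Implicit Types (v w : 'rV[R]_d -> R) (p q : 'rV[R]_d -> 'rV[R]_d) (i : 'I_d).

Let mO : measurable Omega := measurable_domain oO.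

Lemma weak_gradP v : H1x Omega v -> is_weak_grad Omega v (wg v).
Proof. by move=> [_ [p vp]]; by apply: (@xgetPex _ (fun=> 0) [set p | is_weak_grad Omega v p]); exists p. Qed.

Lemma weak_grad_L2 v i : H1x Omega v -> L2 (fun x => wg v x ord0 i).
Proof. by move/weak_gradP => /(_ i)[]. Qed.

Lemma L2x_derive_test phi (e : 'rV[R]_d) : test_function Omega phi -> L2 ('D_e phi).
Proof. by move=> tphi; apply: test_function_L2x => //; exact: test_function_derive. Qed.

(** The weak gradient is chosen among the weak gradients, and this set only
    depends on the class of v modulo equality almost everywhere; hence equality,
    and not only equality almost everywhere, below. *)
Lemma ae_eq_weak_grad v w : measurable_fun Omega v -> measurable_fun Omega w ->
  ae_eq mu Omega v w -> wg v = wg w.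
Proof.
move=> mv mw vw; rewrite /weak_grad; congr (xget _ _); apply/funext => p.
apply/propext; have E i phi : test_function Omega phi ->
    dot v ('D_(delta_mx ord0 i) phi) = dot w ('D_(delta_mx ord0 i) phi).
  move=> tphi; have mp := (L2x_derive_test (delta_mx ord0 i) tphi).1.
  exact: (ae_eq_dotL2 mO mv mw mp mp vw (ae_eq_refl _ _ _)).
by split=> H i; have [h1 h2] := H i; split=> // phi tphi; have := h2 phi tphi; rewrite E.
Qed.

Lemma dot_coord_le p i : (forall j, L2 (fun x => p x ord0 j)) ->
  normx Omega (fun x => p x ord0 i) <= normv_x Omega p.
Proof.
move=> sp; rewrite ler_wsqrtr// /dotv_x (bigD1 i)//= lerDl sumr_ge0// => j _.
exact: dotL2_ge0.
Qed.

Lemma H10x_approx v e : H10x Omega v -> 0 < e -> exists phi,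
  [/\ test_function Omega phi, normx Omega (fun x => v x - phi x) <= e &
    forall i, normx Omega (fun x => wg v x ord0 i - 'D_(delta_mx ord0 i) phi x) <= e].
Proof.
move=> [H1v +] e0 => /(_ e e0)[phi [tphi lt]]; exists phi.
have n0 : 0 <= normx Omega (v \- phi) by exact: sqrtr_ge0.
have n1 : 0 <= normv_x Omega (wg v \- classical_grad phi) by exact: sqrtr_ge0.
split=> //.
  rewrite -(@ler_pXn2r _ 2)// ?nnegrE// ?(ltW e0)//.
  by apply: le_trans (ltW lt); rewrite lerDl sqr_ge0.
move=> i; apply: (@le_trans _ _ (normv_x Omega (wg v \- classical_grad phi))).
  have -> : (fun x => wg v x ord0 i - 'D_(delta_mx ord0 i) phi x) =
    (fun x => (wg v \- classical_grad phi) x ord0 i).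
    by apply/funext => x; rewrite !mxE.
  apply: dot_coord_le => j.
  have -> : (fun x => (wg v \- classical_grad phi) x ord0 j) =
    (fun x => wg v x ord0 j - 'D_(delta_mx ord0 j) phi x).
    by apply/funext => x; rewrite !mxE.
  by apply: sqiB => //; [exact: weak_grad_L2|exact: L2x_derive_test].
rewrite -(@ler_pXn2r _ 2)// ?nnegrE// ?(ltW e0)//.
by apply: le_trans (ltW lt); rewrite lerDr sqr_ge0.
Qed.

(** The difference of both sides is orthogonal to the test functions. It is also a limit
    of gradients of test functions, by the density built in [H10x]; the
    components of these gradients are test functions, so the difference is
    orthogonal to itself. *)
Lemma weak_grad_linear a v w : H10x Omega v -> H10x Omega w ->
  H10x Omega (fun x => a * v x + w x) -> forall i,
  ae_eq mu Omega (fun x => wg (fun x => a * v x + w x) x ord0 i)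
    (fun x => a * wg v x ord0 i + wg w x ord0 i).
Proof.
move=> hv hw hs i; set s := (fun x => a * v x + w x) in hs *.
have [sv H1v] := (hv.1.1, hv.1); have [sw H1w] := (hw.1.1, hw.1); have H1s := hs.1.
pose D (f : 'rV[R]_d -> R) : 'rV[R]_d -> R := 'D_(delta_mx ord0 i) f.
have gv := weak_grad_L2 i H1v; have gw := weak_grad_L2 i H1w; have gs := weak_grad_L2 i H1s.
have gav : L2 (fun x => a * wg v x ord0 i) by exact: sqiZ.
have gavw : L2 (fun x => a * wg v x ord0 i + wg w x ord0 i) by exact: sqiD.
pose q := fun x => wg s x ord0 i - (a * wg v x ord0 i + wg w x ord0 i).
have sq : L2 q by exact: sqiB.
have orth phi : test_function Omega phi -> dot q phi = 0.
  move=> tphi; have sp := test_function_L2x oO bO tphi.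
  have sdp := L2x_derive_test (delta_mx ord0 i) tphi.
  have av : L2 (fun x => a * v x) by exact: sqiZ.
  rewrite /dotx dotL2Bl// dotL2Dl// dotL2Zl//.
  have grad f : H1x Omega f -> dotL2 mu Omega (fun x => wg f x ord0 i) phi =
      - dotL2 mu Omega f ('D_(delta_mx ord0 i) phi).
    by move=> hf; have := (weak_gradP hf i).2 phi tphi; rewrite /dotx => ->; rewrite opprK.
  rewrite !grad// [dotL2 _ _ s _](dotL2Dl mO av sw sdp) dotL2Zl//.
  have cancel (X Y : R) : - (a * X + Y) - (a * - X - Y) = 0 by ring.
  exact: cancel.
have q0 : dot q q = 0.
  apply/eqP; rewrite eq_le dotL2_ge0 andbT.
  apply: (@ge0_le_epsilon _ _ (normx Omega q * (2 + `|a|))).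
    by rewrite mulr_ge0 ?addr_ge0 ?sqrtr_ge0.
  move=> e e0; have [pv [tv _ /(_ i) nv]] := H10x_approx hv e0.
  have [pw [tw _ /(_ i) nw]] := H10x_approx hw e0.
  have [ps [ts _ /(_ i) ns]] := H10x_approx hs e0.
  have dv := L2x_derive_test (delta_mx ord0 i) tv; have dw := L2x_derive_test (delta_mx ord0 i) tw.
  have ds := L2x_derive_test (delta_mx ord0 i) ts.
  pose th x := D ps x + (- a * D pv x + -1 * D pw x).
  have tth : test_function Omega th.
    apply: test_functionD; first exact: test_function_derive.
    by apply: test_functionD; apply: test_functionZ; exact: test_function_derive.
  have sth := test_function_L2x oO bO tth.
  have -> : dot q q = dot q (fun x => q x - th x).
    have E := dotL2Br mO sq sth sq; rewrite /dotx E.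
    by have := orth th tth; rewrite /dotx => ->; rewrite subr0.
  apply: le_trans (ler_norm _) _.
  apply: le_trans (dotL2_le_norm mO sq (sqiB mO sq sth)) _.
  rewrite -mulrA ler_wpM2l ?sqrtr_ge0//.
  have s1 : L2 (fun x => wg s x ord0 i - D ps x) by exact: sqiB.
  have s2 : L2 (fun x => wg v x ord0 i - D pv x) by exact: sqiB.
  have s3 : L2 (fun x => wg w x ord0 i - D pw x) by exact: sqiB.
  have s2' : L2 (fun x => - a * (wg v x ord0 i - D pv x)) by exact: sqiZ.
  have s3' : L2 (fun x => -1 * (wg w x ord0 i - D pw x)) by exact: sqiZ.
  have -> : (fun x => q x - th x) = (fun x => (wg s x ord0 i - D ps x) +
      (- a * (wg v x ord0 i - D pv x) + -1 * (wg w x ord0 i - D pw x))).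
    by apply/funext => x; rewrite /q /th; ring.
  apply: le_trans (normL2D mO s1 (sqiD mO s2' s3')) _.
  apply: le_trans (lerD (lexx _) (normL2D mO s2' s3')) _.
  rewrite !normL2Z// normrN normrN1 mul1r.
  apply: le_trans (lerD ns (lerD (ler_wpM2l (normr_ge0 a) nv) nw)) _.
  by have sum (A : R) : e + (A * e + e) = (2 + A) * e; [ring|rewrite sum].
apply: filterS (dotL2_eq0 mO sq q0) => x H Ox.
by apply/eqP; rewrite -subr_eq0; apply/eqP; exact: H.
Qed.

Section subspace.
Variable S : set ('rV[R]_d -> R).
Hypothesis hS : finite_dim_subspace mu Omega (H10x Omega) S.

Lemma subspace_H10x v : S v -> H10x Omega v.
Proof. by case: hS => + _ _ _; apply. Qed.

Lemma subspace_L2 v : S v -> L2 v.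
Proof. by move/subspace_H10x => [[]]. Qed.

Lemma subspace_sum (I : Type) (r : seq I) (a : I -> R) (v : I -> 'rV[R]_d -> R) :
  (forall k, S (v k)) -> S (fun x => \sum_(k <- r) a k * v k x).
Proof.
case: hS => _ S0 SD _ Sv; elim: r => [|k r IH].
  by under eq_fun do rewrite big_nil.
by under eq_fun do rewrite big_cons; exact: SD.
Qed.

Lemma weak_grad0 i : ae_eq mu Omega (fun x => wg (fun=> 0) x ord0 i) (cst 0).
Proof.
have S0 : S (fun=> 0) by case: hS.
have h0 := subspace_H10x S0.
have h0' : H10x Omega (fun x => 1 * (fun=> 0) x + (fun=> 0) x).
  by rewrite (_ : (fun x => _) = fun=> 0)//; apply/funext => x; rewrite mul1r addr0.
have := weak_grad_linear h0 h0 h0' i.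
rewrite (_ : (fun x => 1 * 0 + 0) = fun=> 0); last by apply/funext => x; rewrite mul1r addr0.
by apply: filterS => x H Ox; have := H Ox; rewrite mul1r /=; lra.
Qed.

Lemma weak_grad_sum (I : Type) (r : seq I) (a : I -> R) (v : I -> 'rV[R]_d -> R) :
  (forall k, S (v k)) -> forall i,
  ae_eq mu Omega (fun x => wg (fun x => \sum_(k <- r) a k * v k x) x ord0 i)
    (fun x => \sum_(k <- r) a k * wg (v k) x ord0 i).
Proof.
move=> Sv i; elim: r => [|k r IH].
  have -> : (fun x => \sum_(k <- [::]) a k * v k x) = (fun=> 0).
    by apply/funext => x; rewrite big_nil.
  by apply: filterS (weak_grad0 i) => x H Ox; rewrite big_nil; exact: H.
have Ssum := subspace_sum r a Sv.
have := @weak_grad_linear (a k) (v k) (fun x => \sum_(k <- r) a k * v k x)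
  (subspace_H10x (Sv k)) (subspace_H10x Ssum).
have E : (fun x => \sum_(k <- k :: r) a k * v k x) =
    (fun x => a k * v k x + \sum_(k <- r) a k * v k x).
  by apply/funext => x; rewrite big_cons.
rewrite -E => /(_ (subspace_H10x (subspace_sum _ a Sv)) i).
apply: filterS2 IH => x H1 H2 Ox.
by rewrite H2// H1// big_cons.
Qed.

End subspace.

Section energy_form.
Variable c : 'rV[R]_d -> R.
Hypothesis mc : measurable_fun Omega c.
Variable M : R.
Hypothesis cM : {ae mu, forall x, Omega x -> `|c x| <= M}.

Definition energy v w : R := dotv_x Omega (fun x => c x ^+ 2 *: wg v x) (wg w).

Lemma energyE v w : energy v w =
  \sum_(i < d) dot (fun x => c x * wg v x ord0 i) (fun x => c x * wg w x ord0 i).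
Proof.
apply: eq_bigr => i _; apply: eq_Rintegral => x _; rewrite mxE; ring.
Qed.

Lemma energy_congr v v' w w' : wg v = wg v' -> wg w = wg w' -> energy v w = energy v' w'.
Proof. by rewrite /energy => -> ->. Qed.

Lemma energyC v w : energy v w = energy w v.
Proof. by rewrite !energyE; apply: eq_bigr => i _; rewrite /dotx dotL2C. Qed.

Lemma energy_ge0 v : 0 <= energy v v.
Proof. by rewrite energyE sumr_ge0// => i _; exact: dotL2_ge0. Qed.

Lemma c_weak_grad_L2 v i : H1x Omega v -> L2 (fun x => c x * wg v x ord0 i).
Proof. by move=> h; apply: sqi_bounded cM _ => //; exact: weak_grad_L2. Qed.

Lemma c2_weak_grad_L2 v i : H1x Omega v -> L2 (fun x => c x ^+ 2 * wg v x ord0 i).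
Proof.
move=> h; under eq_fun do rewrite expr2 -mulrA.
by apply: sqi_bounded cM _ => //; exact: c_weak_grad_L2.
Qed.

Lemma energy_sqr v : energy v v = normv_x Omega (fun x => c x *: wg v x) ^+ 2.
Proof.
rewrite sqr_sqrtr; last by rewrite sumr_ge0// => i _; exact: dotL2_ge0.
by rewrite energyE; apply: eq_bigr => i _; apply: eq_Rintegral => x _; rewrite !mxE.
Qed.

Lemma ae_eq_energyl v w z : H1x Omega z -> H1x Omega v -> H1x Omega w ->
  (forall i, ae_eq mu Omega (fun x => wg v x ord0 i) (fun x => wg w x ord0 i)) ->
  energy v z = energy w z.
Proof.
move=> hz hv hw vw; rewrite !energyE; apply: eq_bigr => i _.
have mz := (c_weak_grad_L2 i hz).1.
apply: (ae_eq_dotL2 mO (c_weak_grad_L2 i hv).1 (c_weak_grad_L2 i hw).1 mz mz); last exact: ae_eq_refl.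
by apply: filterS (vw i) => x H Ox; rewrite H.
Qed.

Section subspace_energy.
Variable S : set ('rV[R]_d -> R).
Hypothesis hS : finite_dim_subspace mu Omega (H10x Omega) S.

Lemma energy_suml (I : Type) (r : seq I) (a : I -> R) (v : I -> 'rV[R]_d -> R) z :
  (forall k, S (v k)) -> H1x Omega z ->
  energy (fun x => \sum_(k <- r) a k * v k x) z = \sum_(k <- r) a k * energy (v k) z.
Proof.
move=> Sv hz; under eq_bigr do rewrite energyE mulr_sumr.
rewrite exchange_big/= energyE; apply: eq_bigr => i _.
have Hk k := c_weak_grad_L2 i (subspace_H10x hS (Sv k)).1.
have mz := c_weak_grad_L2 i hz.
have Hs := c_weak_grad_L2 i (subspace_H10x hS (subspace_sum hS r a Sv)).1.
have -> : dot (fun x => c x * wg (fun x => \sum_(k <- r) a k * v k x) x ord0 i)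
    (fun x => c x * wg z x ord0 i) =
   dot (fun x => \sum_(k <- r) a k * (c x * wg (v k) x ord0 i)) (fun x => c x * wg z x ord0 i).
  apply: (ae_eq_dotL2 mO Hs.1 _ mz.1 mz.1); last exact: ae_eq_refl.
    by have /sqi_measurable := sqi_sum mO r a Hk.
  apply: filterS (weak_grad_sum hS r a Sv i) => x H Ox; rewrite H// mulr_sumr.
  by apply: eq_bigr => k _; rewrite mulrCA.
by rewrite /dotx dotL2_suml.
Qed.

Lemma energy_sumr (I : Type) (r : seq I) (a : I -> R) (v : I -> 'rV[R]_d -> R) z :
  (forall k, S (v k)) -> H1x Omega z ->
  energy z (fun x => \sum_(k <- r) a k * v k x) = \sum_(k <- r) a k * energy z (v k).
Proof.
move=> Sv hz; rewrite (energyC z) (energy_suml r a Sv hz).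
exact: (eq_bigr _ (fun k _ => congr1 ( *%R (a k)) (energyC (v k) z))).
Qed.

End subspace_energy.

Section lower_bound.
Variables (c0 C : R).
Hypothesis c00 : 0 < c0.
Hypothesis C0 : 0 < C.
Hypothesis cc0 : {ae mu, forall x, Omega x -> c0 <= c x}.
Hypothesis poincare : poincare_constant Omega C.

(** Poincare's inequality, where c0 <= c brings in the coefficient. *)
Lemma poincare_energy v : H10x Omega v -> dot v v <= (C / c0) ^+ 2 * energy v v.
Proof.
move=> hv; have := poincare hv.
rewrite -(@ler_pXn2r _ 2)// ?nnegrE ?mulr_ge0 ?sqrtr_ge0 ?(ltW C0)//.
rewrite normL2_sqr exprMn sqr_sqrtr; last by rewrite sumr_ge0// => i _; exact: dotL2_ge0.
move=> H; apply: (le_trans H); rewrite exprMn -[leRHS]mulrA; apply: (ler_wpM2l (sqr_ge0 C)).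
rewrite exprVn ler_pdivlMl ?exprn_gt0// energyE /dotv_x mulr_sumr ler_sum// => i _.
have g := weak_grad_L2 i hv.1; have cg := c_weak_grad_L2 i hv.1.
rewrite -RintegralZl//; last exact: sqiM_integrable.
apply: ae_le_Rintegral => //.
- by apply: integrableZR => //; exact: sqiM_integrable.
- exact: sqiM_integrable.
apply: filterS cc0 => x H1 Ox; have {}H1 := H1 Ox.
rewrite [leRHS]mulrACA -!expr2 ler_wpM2r ?sqr_ge0// lerXn2r ?nnegrE// ?(ltW c00)//.
exact/ltW/(lt_le_trans c00 H1).
Qed.

End lower_bound.

(** Integration by parts against functions of [H10x], by density of the test
    functions. *)
Lemma weak_div_energy U0 w v : H10x Omega U0 -> H10x Omega v ->
  is_weak_div Omega (fun x => c x ^+ 2 *: wg U0 x) w -> energy U0 v = - dot w v.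
Proof.
move=> hU hv [sw Hw]; apply/eqP; rewrite -subr_eq0 opprK -normr_eq0 eq_le normr_ge0 andbT.
set p := (fun x => c x ^+ 2 *: wg U0 x).
have sp i : L2 (fun x => p x ord0 i).
  have := c2_weak_grad_L2 i hU.1; congr square_integrable.
  by apply/funext => x; rewrite mxE.
apply: (@ge0_le_epsilon _ _ (\sum_(i < d) normx Omega (fun x => p x ord0 i) + normx Omega w)).
  by rewrite addr_ge0 ?sumr_ge0 ?sqrtr_ge0// => i _; exact: sqrtr_ge0.
move=> e e0; have [phi [tphi n1 n2]] := H10x_approx hv e0.
have sphi := test_function_L2x oO bO tphi.
have sdphi i := L2x_derive_test (delta_mx ord0 i) tphi.
have sg i := weak_grad_L2 i hv.1.
have -> : energy U0 v + dot w v =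
    \sum_(i < d) dot (fun x => p x ord0 i) (fun x => wg v x ord0 i - 'D_(delta_mx ord0 i) phi x)
    + dot w (fun x => v x - phi x).
  rewrite /dotx (dotL2Br mO hv.1.1 sphi sw).
  rewrite (eq_bigr _ (fun i _ => dotL2Br mO (sg i) (sdphi i) (sp i))) sumrB.
  have -> : \sum_(i < d) dotL2 mu Omega (fun x => p x ord0 i) ('D_(delta_mx ord0 i) phi)
      = - dotL2 mu Omega w phi.
    rewrite -[RHS](Hw phi tphi); apply: eq_bigr => i _; congr dotL2.
    by apply/funext => x; rewrite mxE.
  have cancel (X Y Z : R) : X + Y = X - - Z + (Y - Z) by ring.
  exact: cancel.
apply: le_trans (ler_normD _ _) _; rewrite mulrDl; apply: lerD.
  rewrite mulr_suml; apply: le_trans (ler_norm_sum _ _ _) _; apply: ler_sum => i _.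
  apply: le_trans (dotL2_le_norm mO (sp i) (sqiB mO (sg i) (sdphi i))) _.
  exact: (ler_wpM2l (sqrtr_ge0 _) (n2 i)).
apply: le_trans (dotL2_le_norm mO sw (sqiB mO hv.1.1 sphi)) _.
exact: (ler_wpM2l (sqrtr_ge0 _) n1).
Qed.

End energy_form.
End weak_gradients.

(** * Simultaneous diagonalization *)

Section codiagonalization.
Context {R : realType} {V : lmodType R}.
Implicit Types (u v w : V) (f : V -> V -> R).

Definition symmetric_bilinear f :=
  (forall a u v w, f (a *: u + v) w = a * f u w + f v w) /\ (forall u v, f u v = f v u).

Section form.
Variable f : V -> V -> R.
Hypothesis hf : symmetric_bilinear f.

Lemma form0l w : f 0 w = 0.
Proof. by have := hf.1 (-1) 0 0 w; rewrite scaler0 addr0 mulN1r addNr. Qed.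

Lemma formDl u v w : f (u + v) w = f u w + f v w.
Proof. by rewrite -[u]scale1r hf.1 mul1r scale1r. Qed.

Lemma formZl a u w : f (a *: u) w = a * f u w.
Proof. by rewrite -[a *: u]addr0 hf.1 form0l addr0. Qed.

Lemma formC u v : f u v = f v u. Proof. exact: hf.2. Qed.

Lemma formDr u v w : f w (u + v) = f w u + f w v.
Proof. by rewrite formC formDl !(formC w). Qed.

Lemma formZr a u w : f w (a *: u) = a * f w u.
Proof. by rewrite formC formZl formC. Qed.

Lemma form_suml (I : Type) (r : seq I) (F : I -> V) w :
  f (\sum_(i <- r) F i) w = \sum_(i <- r) f (F i) w.
Proof. by elim/big_rec2: _ => [|i x y _ <-]; rewrite ?form0l ?formDl. Qed.

Lemma form_sumr (I : Type) (r : seq I) (F : I -> V) w :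
  f w (\sum_(i <- r) F i) = \sum_(i <- r) f w (F i).
Proof. by rewrite formC form_suml; apply: eq_bigr => i _; rewrite formC. Qed.

Hypothesis f0 : forall u, 0 <= f u u.

Lemma form_null u : f u u = 0 -> forall w, f u w = 0.
Proof.
move=> uu w; apply/eqP/negP => /negP uw.
have := f0 (w + (- (f w w + 1) / (2 * f u w)) *: u).
rewrite !(formDl, formDr, formZl, formZr) uu (formC w u).
set t := _ / _; have : t * f u w = - (f w w + 1) / 2.
  by rewrite /t; field; rewrite uw.
move=> E; have := f0 w; lra.
Qed.

Lemma form_nullD u v : f u u = 0 -> f v v = 0 -> f (u + v) (u + v) = 0.
Proof.
by move=> u0 v0; rewrite formDl !formDr u0 v0 (form_null u0) (form_null v0) !addr0.
Qed.

Lemma form_nullZ a u : f u u = 0 -> f (a *: u) (a *: u) = 0.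
Proof. by move=> u0; rewrite formZl formZr u0 !mulr0. Qed.

Lemma form_null_sum (I : Type) (r : seq I) (F : I -> V) :
  (forall i, f (F i) (F i) = 0) -> f (\sum_(i <- r) F i) (\sum_(i <- r) F i) = 0.
Proof.
move=> F0; elim: r => [|i r IH]; first by rewrite big_nil form0l.
by rewrite big_cons; exact: form_nullD.
Qed.

End form.

Lemma continuous_sum (T : topologicalType) (I : Type) (r : seq I) (F : I -> T -> R) :
  (forall i, continuous (F i)) -> continuous (fun x => \sum_(i <- r) F i x).
Proof.
move=> cF x; elim: r => [|i r IH].
  by under eq_fun do rewrite big_nil; exact: cvg_cst.
by under eq_fun do rewrite big_cons; apply: cvgD => //; exact: cF.
Qed.

Definition comb m (b : 'I_m -> V) (x : 'rV[R]_m) : V := \sum_j x ord0 j *: b j.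

Definition inspan m (b : 'I_m -> V) v := exists x, v = comb b x.

Lemma inspan_elt m (b : 'I_m -> V) j : inspan b (b j).
Proof.
exists (delta_mx ord0 j); rewrite /comb (bigD1 j)//= mxE !eqxx scale1r big1 ?addr0// => i ij.
by rewrite mxE eqxx (negbTE ij) scale0r.
Qed.

Lemma inspanD m (b : 'I_m -> V) u v : inspan b u -> inspan b v -> inspan b (u + v).
Proof.
move=> [x ->] [y ->]; exists (x + y); rewrite /comb -big_split/=.
by apply: eq_bigr => j _; rewrite mxE scalerDl.
Qed.

Lemma inspanZ m (b : 'I_m -> V) a u : inspan b u -> inspan b (a *: u).
Proof.
move=> [x ->]; exists (a *: x); rewrite /comb scaler_sumr.
by apply: eq_bigr => j _; rewrite mxE scalerA.
Qed.

Lemma inspan_comb m p (b : 'I_m -> V) (w : 'I_p -> V) v :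
  (forall k, inspan b (w k)) -> inspan w v -> inspan b v.
Proof.
move=> bw [x ->]; rewrite /comb; elim/big_ind: _ => //.
- by exists 0; rewrite /comb big1// => j _; rewrite mxE scale0r.
- exact: inspanD.
- by move=> j _; exact: inspanZ.
Qed.

Lemma combZ m (b : 'I_m -> V) a x : comb b (a *: x) = a *: comb b x.
Proof.
by rewrite /comb scaler_sumr; apply: eq_bigr => j _; rewrite mxE scalerA.
Qed.

Variables (al be : V -> V -> R).
Hypotheses (hal : symmetric_bilinear al) (hbe : symmetric_bilinear be).
Hypothesis be0 : forall u, 0 <= be u u.

Definition residual n (e : 'I_n -> V) v := v - \sum_k be v (e k) *: e k.

Lemma residual_linear n (e : 'I_n -> V) a u v :
  residual e (a *: u + v) = a *: residual e u + residual e v.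
Proof.
rewrite /residual scalerBr scaler_sumr addrACA -opprD -big_split/=; congr (_ - _).
by apply: eq_bigr => k _; rewrite hbe.1 scalerDl scalerA.
Qed.

Lemma residual0 n (e : 'I_n -> V) : residual e 0 = 0.
Proof.
by have := residual_linear e (-1) 0 0; rewrite scaler0 addr0 scaleN1r addNr.
Qed.

Lemma residual_comb n (e : 'I_n -> V) m (b : 'I_m -> V) x :
  residual e (comb b x) = comb (residual e \o b) x.
Proof.
rewrite /comb; elim/big_rec2: _ => [|j u v _ <-]; first exact: residual0.
by rewrite residual_linear.
Qed.

Lemma continuous_form_comb f m (b : 'I_m -> V) : symmetric_bilinear f ->
  continuous (fun x : 'rV[R]_m => f (comb b x) (comb b x)).
Proof.
move=> hf.
have -> : (fun x : 'rV[R]_m => f (comb b x) (comb b x)) =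
    (fun x => \sum_i \sum_j x ord0 i * x ord0 j * f (b i) (b j)).
  apply/funext => x; rewrite /comb (form_suml hf); apply: eq_bigr => i _.
  rewrite (form_sumr hf); apply: eq_bigr => j _.
  by rewrite (formZl hf) (formZr hf) mulrA.
have c1 (c : R) i j : continuous (fun x : 'rV[R]_m => x ord0 i * x ord0 j * c).
  have c0 k : continuous (fun x : 'rV[R]_m => x ord0 k) by exact: coord_continuous.
  move=> x; apply: (@continuousM _ _ (fun x : 'rV[R]_m => x ord0 i * x ord0 j) (fun=> c)).
    by apply: continuousM; exact: c0.
  exact: cst_continuous.
by apply: continuous_sum => i; apply: continuous_sum => j; exact: c1.
Qed.

Lemma compact_sphere m :
  compact [set x : 'rV[R]_m | \sum_j x ord0 j ^+ 2 = 1].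
Proof.
apply: bounded_closed_compact.
  exists 1; split=> // M M1 x /= x1; apply: ltW; apply: le_lt_trans M1.
  rewrite /Num.Def.normr/= mx_normrE; apply/bigmax_leP; split=> // -[i j] _ /=.
  rewrite (ord1 i) -(@ler_pXn2r _ 2)// ?nnegrE// real_normK ?num_real// expr1n -x1.
  by rewrite (bigD1 j)//= lerDl sumr_ge0// => k _; exact: sqr_ge0.
rewrite (_ : [set x | _] = (fun x : 'rV[R]_m => \sum_j x ord0 j ^+ 2) @^-1` [set 1])//.
apply: closed_comp; last exact: closed_eq.
have c1 j : continuous (fun x : 'rV[R]_m => x ord0 j ^+ 2).
  have c0 : continuous (fun x : 'rV[R]_m => x ord0 j) by exact: coord_continuous.
  by move=> x; apply: (@continuousM _ _ (fun x : 'rV[R]_m => x ord0 j) (fun x => x ord0 j)); exact: c0.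
by move=> x _; exact: continuous_sum.
Qed.

(** The quotient al / be attains its minimum q on the unit sphere of coordinates. The form
    al - q be is nonnegative and vanishes at the minimizer, which is therefore
    orthogonal to the whole span for this form. *)
Lemma rayleigh_minimizer m (b : 'I_m.+1 -> V) :
  (forall x, x != 0 -> be (comb b x) (comb b x) != 0) ->
  exists x lam, x != 0 /\ forall v, inspan b v -> al (comb b x) v = lam * be (comb b x) v.
Proof.
move=> pd; pose S := [set x : 'rV[R]_m.+1 | \sum_j x ord0 j ^+ 2 = 1].
have S_neq0 x : S x -> x != 0.
  rewrite /S /= => x1; apply/eqP => x0; move: x1; rewrite x0 big1; last first.
    by move=> j _; rewrite mxE expr0n.
  by move/eqP; rewrite eq_sym oner_eq0.
pose q x := al (comb b x) (comb b x) / be (comb b x) (comb b x).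
have [||x Sx minx] := @EVT_min_rV R m.+1 q S _ (@compact_sphere m.+1).
- exists (delta_mx ord0 ord0); rewrite /S /= (bigD1 ord0)//= mxE !eqxx expr1n big1 ?addr0//.
  by move=> i i0; rewrite mxE eqxx (negbTE i0) expr0n.
- apply/subspace_continuousP => y Sy; apply: cvg_within_filter.
  apply: cvgM; first exact: continuous_form_comb.
  by apply: cvgV; [exact/pd/S_neq0|exact: continuous_form_comb].
have {}Sx : S x by rewrite -inE.
have x0 := S_neq0 x Sx; exists x, (q x); split=> //.
pose ga u v := al u v - q x * be u v.
have hga : symmetric_bilinear ga.
  split=> [a u v w|u v]; last by rewrite /ga (formC hal) (formC hbe).
  by rewrite /ga hal.1 hbe.1; ring.
have gax : ga (comb b x) (comb b x) = 0.
  by rewrite /ga /q divfK ?subrr//; exact: pd.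
have ga0 y : 0 <= ga (comb b y) (comb b y).
  have [->|y0] := eqVneq y 0.
    rewrite (_ : comb b 0 = 0) ?(form0l hga)//.
    by rewrite /comb big1// => j _; rewrite mxE scale0r.
  pose r := \sum_j y ord0 j ^+ 2.
  have r0 : 0 < r.
    have [j yj] : exists j, y ord0 j != 0.
      apply/existsP; apply: contraNT y0; rewrite negb_exists => /forallP H.
      by apply/eqP/rowP => j; rewrite mxE; apply/eqP; rewrite -[_ == _]negbK.
    rewrite /r (bigD1 j)//= ltr_wpDr//; first by rewrite sumr_ge0// => k _; exact: sqr_ge0.
    by rewrite lt0r sqr_ge0 sqrf_eq0 yj.
  have sr : Num.sqrt r != 0 by rewrite gt_eqF// sqrtr_gt0.
  pose z := (Num.sqrt r)^-1 *: y.
  have Sz : S z.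
    rewrite /S /= /z; under eq_bigr do rewrite mxE exprMn.
    by rewrite -mulr_sumr exprVn sqr_sqrtr ?ltW// mulVf// gt_eqF.
  have bz : 0 < be (comb b z) (comb b z) by rewrite lt0r be0 pd// S_neq0.
  have := minx z (mem_set Sz); rewrite {2}/q ler_pdivlMr// -subr_ge0 -/(ga _ _) => gz.
  have -> : y = Num.sqrt r *: z by rewrite /z scalerA divff// scale1r.
  rewrite combZ (formZl hga) (formZr hga) mulrA mulr_ge0// -expr2 sqr_ge0//.
move=> v [y ->]; apply/eqP; rewrite -subr_eq0 -/(ga _ _); apply/eqP.
apply/eqP/negP => /negP xy.
have := ga0 (y + (- (ga (comb b y) (comb b y) + 1) / (2 * ga (comb b x) (comb b y))) *: x).
have -> a (u w : 'rV[R]_m.+1) : comb b (u + a *: w) = comb b u + a *: comb b w.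
  by rewrite -combZ /comb -big_split/=; apply: eq_bigr => j _; rewrite mxE scalerDl.
rewrite !(formDl hga, formDr hga, formZl hga, formZr hga) gax (formC hga (comb b y)).
set t := _ / _; have : t * ga (comb b x) (comb b y) = - (ga (comb b y) (comb b y) + 1) / 2.
  by rewrite /t; field; rewrite xy.
by move=> E; have := ga0 y; lra.
Qed.

Lemma unlift_bigop m (j0 : 'I_m.+1) (F : 'I_m.+1 -> V) :
  \sum_j F j = F j0 + \sum_(k < m) F (lift j0 k).
Proof. by rewrite (bigD1_ord j0). Qed.

(** Induction on the spanning family. If some combination of it is null for be, one vector
    can be dropped. Otherwise a minimizer of the Rayleigh quotient is split off, and the
    other vectors are projected on its orthogonal. The family spans up to null
    vectors only, because be is semidefinite: it will be the product of L^2 on functions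
    that are not identified when equal almost everywhere. *)
Theorem codiagonalization m (b : 'I_m -> V) :
  exists n (e : 'I_n -> V) (lam : 'I_n -> R),
  [/\ forall k, inspan b (e k), forall k l, be (e k) (e l) = (k == l)%:R,
      forall k l, al (e k) (e l) = lam k * (k == l)%:R &
      forall j, be (residual e (b j)) (residual e (b j)) = 0].
Proof.
elim: m b => [|m IH] b.
  by exists 0%N, (fun=> 0), (fun=> 0); split=> [[]|[]|[]|[]].
have [[x [x0 Nx]]|pd] := pselect (exists x, x != 0 /\ be (comb b x) (comb b x) = 0).
  have [j0 xj0] : exists j, x ord0 j != 0.
    apply/existsP; apply: contraNT x0; rewrite negb_exists => /forallP H.
    by apply/eqP/rowP => j; rewrite mxE; apply/eqP; rewrite -[_ == _]negbK.
  have [n [e [lam [e1 e2 e3 e4]]]] := IH (b \o lift j0).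
  exists n, e, lam; split=> //.
    by move=> k; apply: inspan_comb (e1 k) => i; exact: inspan_elt.
  have rl k : be (residual e (b (lift j0 k))) (residual e (b (lift j0 k))) = 0 by exact: e4.
  suff r0 : be (residual e (b j0)) (residual e (b j0)) = 0.
    by move=> j; case: (unliftP j0 j) => [k ->|->].
  have Nr : be (residual e (comb b x)) (residual e (comb b x)) = 0.
    rewrite /residual (_ : \sum_k _ = 0) ?subr0// big1// => k _.
    by rewrite (form_null hbe be0 Nx) scale0r.
  have E : residual e (b j0) = (x ord0 j0)^-1 *: (residual e (comb b x) +
      (-1) *: \sum_(k < m) x ord0 (lift j0 k) *: residual e (b (lift j0 k))).
    rewrite residual_comb /comb (unlift_bigop j0)/= scaleN1r addrK.
    by rewrite scalerA mulVf// scale1r.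
  rewrite E; apply: (form_nullZ hbe); apply: (form_nullD hbe be0) => //.
  apply: (form_nullZ hbe); apply: (form_null_sum hbe be0) => k.
  exact: (form_nullZ hbe).
have {}pd x : x != 0 -> be (comb b x) (comb b x) != 0.
  by move=> x0; apply/eqP => Nx; apply: pd; exists x.
have [x [l0 [x0 eig]]] := rayleigh_minimizer pd.
have [j0 xj0] : exists j, x ord0 j != 0.
  apply/existsP; apply: contraNT x0; rewrite negb_exists => /forallP H.
  by apply/eqP/rowP => j; rewrite mxE; apply/eqP; rewrite -[_ == _]negbK.
pose N2 := be (comb b x) (comb b x).
have N20 : 0 < N2 by rewrite lt0r pd//= be0.
pose nu := (Num.sqrt N2)^-1.
have nu0 : nu != 0 by rewrite invr_eq0 gt_eqF// sqrtr_gt0.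
pose e0 := nu *: comb b x.
have Se0 : inspan b e0 by apply: inspanZ; exists x.
have e00 : be e0 e0 = 1.
  rewrite /e0 (formZl hbe) (formZr hbe) mulrA -expr2 exprVn sqr_sqrtr ?ltW//.
  by rewrite mulVf// gt_eqF.
have eig0 v : inspan b v -> al e0 v = l0 * be e0 v.
  by move=> Sv; rewrite /e0 (formZl hal) (formZl hbe) eig// mulrCA.
pose b' k := b (lift j0 k) - be (b (lift j0 k)) e0 *: e0.
have Sb' k : inspan b (b' k).
  by rewrite /b' -scaleNr; apply: inspanD; [exact: inspan_elt|exact: inspanZ].
have b'0 k : be e0 (b' k) = 0.
  by rewrite /b' -scaleNr (formDr hbe) (formZr hbe) e00 mulr1 (formC hbe e0) subrr.
have [n [e [lam [e1 e2 e3 e4]]]] := IH b'.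
have Se k : inspan b (e k) by exact: inspan_comb (e1 k).
have ee0 k : be e0 (e k) = 0.
  have [y ->] := e1 k; rewrite /comb (form_sumr hbe) big1// => i _.
  by rewrite (formZr hbe) b'0 mulr0.
have ae0 k : al e0 (e k) = 0 by rewrite eig0// ee0 mulr0.
pose e' (k : 'I_n.+1) := if unlift ord0 k is Some i then e i else e0.
pose lam' (k : 'I_n.+1) := if unlift ord0 k is Some i then lam i else l0.
have resE v : residual e' v = v - be v e0 *: e0 - \sum_k be v (e k) *: e k.
  rewrite /residual big_ord_recl /e' unlift_none opprD addrA; congr (_ - _).
  by apply: eq_bigr => k _; rewrite liftK.
exists n.+1, e', lam'; split.
- by move=> k; rewrite /e'; case: unliftP.
- move=> k l; rewrite /e'; case: (unliftP ord0 k) => [i ->|->]; case: (unliftP ord0 l) => [j ->|->].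
  + by rewrite e2 (inj_eq (@lift_inj _ _)).
  + by rewrite (formC hbe) ee0.
  + by rewrite ee0.
  + by rewrite e00 eqxx.
- move=> k l; rewrite /e' /lam'; case: (unliftP ord0 k) => [i ->|->]; case: (unliftP ord0 l) => [j ->|->].
  + by rewrite e3 (inj_eq (@lift_inj _ _)).
  + by rewrite (formC hal) ae0 mulr0.
  + by rewrite ae0 mulr0.
  + by rewrite eig0// e00.
have rl k : be (residual e' (b (lift j0 k))) (residual e' (b (lift j0 k))) = 0.
  suff -> : residual e' (b (lift j0 k)) = residual e (b' k) by exact: e4.
  rewrite resE /residual; congr (_ - _); apply: eq_bigr => i _; congr (_ *: _).
  by rewrite /b' -scaleNr (formDl hbe) (formZl hbe) ee0 mulr0 addr0.
have re0 : residual e' e0 = 0.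
  rewrite resE e00 scale1r subrr big1 ?subr0// => k _.
  by rewrite ee0 scale0r.
have rb0 : be (residual e' (b j0)) (residual e' (b j0)) = 0.
  have : residual e' (comb b x) = 0.
    have -> : comb b x = nu^-1 *: e0 + 0 by rewrite /e0 scalerA mulVf// scale1r addr0.
    by rewrite residual_linear re0 residual0 scaler0 addr0.
  rewrite residual_comb /comb (unlift_bigop j0)/= => E.
  have -> : residual e' (b j0) = (x ord0 j0)^-1 *:
      ((-1) *: \sum_(k < m) x ord0 (lift j0 k) *: residual e' (b (lift j0 k))).
    move/eqP: E; rewrite addr_eq0 scaleN1r => /eqP <-.
    by rewrite scalerA mulVf// scale1r.
  apply: (form_nullZ hbe); apply: (form_nullZ hbe); apply: (form_null_sum hbe be0) => k.
  exact: (form_nullZ hbe).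
by move=> j; case: (unliftP j0 j) => [k ->|->].
Qed.

End codiagonalization.

(** * Estimates for one mode, in real numbers *)

(** It suffices that r vanishes on the kernel of M, and a vector of the kernel annihilates
    the quadratic form of M. *)
Lemma solvable_of_kernel (R : fieldType) n (M : 'M[R]_n) (r : 'rV[R]_n) :
  (forall y : 'cV[R]_n, y^T *m M *m y = 0 -> r *m y = 0) -> exists x, x *m M = r.
Proof.
move=> H; have : (r <= M)%MS.
  rewrite submxE; apply/eqP/matrixP => i j; rewrite [RHS]mxE.
  pose y : 'cV_n := cokermx M *m delta_mx j ord0.
  have My : M *m y = 0 by rewrite /y mulmxA mulmx_coker mul0mx.
  have : r *m y = 0 by apply: H; rewrite -mulmxA My mulmx0.
  by rewrite /y mulmxA -colE => /matrixP /(_ i ord0); rewrite !mxE.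
by move/submxP => [x ->]; exists x.
Qed.

(** The power 32 of 1 - 1/32 <= exp (- 1/32), by rounded successive squares. *)
Lemma expRN1_ge {R : realType} : 9 / 25 <= expR (-1) :> R.
Proof.
have h : 31 / 32 <= expR (- (1 / 32)) :> R.
  by have := expR_ge1Dx (- (1 / 32) : R); lra.
have -> : (-1 : R) = - (1 / 32) * 32%:R by field.
rewrite expRM_natr; set x := expR _ in h *.
have sq (a y : R) : 0 <= a -> a <= y -> a ^+ 2 <= y ^+ 2.
  by move=> a0 ay; rewrite lerXn2r ?nnegrE// (le_trans a0).
have h2 : 61 / 65 <= x ^+ 2 by apply: le_trans (sq _ _ _ h); lra.
have h4 : 59 / 67 <= (x ^+ 2) ^+ 2 by apply: le_trans (sq _ _ _ h2); lra.
have h8 : 31 / 40 <= ((x ^+ 2) ^+ 2) ^+ 2 by apply: le_trans (sq _ _ _ h4); lra.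
have h16 : 3 / 5 <= (((x ^+ 2) ^+ 2) ^+ 2) ^+ 2 by apply: le_trans (sq _ _ _ h8); lra.
have -> : x ^+ 32 = ((((x ^+ 2) ^+ 2) ^+ 2) ^+ 2) ^+ 2 by rewrite -!exprM.
by apply: le_trans (sq _ _ _ h16); lra.
Qed.

Lemma expRN1_onem_le {R : realType} : 1 - expR (-1) <= 16 / 25 :> R.
Proof. by have := @expRN1_ge R; lra. Qed.

Section real_estimates.
Context {R : realType}.
Implicit Types (T kap lam : R).

Lemma le_of_sqr_le_mul (a b : R) : 0 <= a -> 0 <= b -> a ^+ 2 <= b * a -> a <= b.
Proof.
move=> a0 b0 H; have [->//|an] := eqVneq a 0.
have ap : 0 < a by rewrite lt0r an.
by rewrite -(ler_pM2r ap) -expr2.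
Qed.

(** Here G, H, U, W, Fn stand for the squared norms of u', v', u, v, f and the lower case
    letters for the products of these functions. The energy lam U + W is
    bounded by the work fg of f on u'; as u' is the projection of v, G <= W closes the bound of the
    energy by 4 T^2 Fn. Since v' is the projection of f - lam u, the norm of v' costs Fn
    and the energy, and kap^2 lam >= 1 absorbs the factor lam^-1. *)
Lemma forced_estimate T kap lam (G H U W Fn fg fh uh vg : R) :
  0 < T -> 0 < lam -> 1 <= kap ^+ 2 * lam ->
  0 <= G -> 0 <= H -> 0 <= U -> 0 <= W -> 0 <= Fn ->
  lam * U + W <= 2 * T * fg ->
  G = vg -> vg ^+ 2 <= W * G -> fg ^+ 2 <= Fn * G ->
  H = fh - lam * uh -> fh ^+ 2 <= Fn * H -> uh ^+ 2 <= U * H ->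
  G + lam^-1 * H + lam * U + W <= 4 * (kap ^+ 2 + 4 * T ^+ 2) * Fn.
Proof.
move=> T0 lam0 klam G0 H0 U0 W0 F0 En Gv vG fG HE fH uH.
have GW : G <= W by apply: le_of_sqr_le_mul => //; rewrite {1}Gv.
have lU : 0 <= lam * U by rewrite mulr_ge0// ltW.
have E0 : 0 <= lam * U + W by rewrite addr_ge0.
have T4 : 0 <= 4 * T ^+ 2 by rewrite mulr_ge0 ?sqr_ge0.
have EF : lam * U + W <= 4 * T ^+ 2 * Fn.
  apply: le_of_sqr_le_mul => //; first exact: mulr_ge0.
  apply: (@le_trans _ _ ((2 * T * fg) ^+ 2)).
    by rewrite lerXn2r ?nnegrE// (le_trans E0 En).
  rewrite exprMn (_ : (2 * T) ^+ 2 = 4 * T ^+ 2); last by ring.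
  rewrite -mulrA; apply: (ler_wpM2l T4).
  by apply: (le_trans fG); rewrite ler_wpM2l//; lra.
have HU : H <= 2 * Fn + 2 * lam ^+ 2 * U.
  apply: le_of_sqr_le_mul => //.
    by have := mulr_ge0 (sqr_ge0 lam) U0; lra.
  have s0 := sqr_ge0 (fh + lam * uh).
  have l2 : lam ^+ 2 * uh ^+ 2 <= lam ^+ 2 * (U * H) by rewrite ler_wpM2l ?sqr_ge0.
  by rewrite {1}HE; nra.
have Hl : lam^-1 * H <= 2 * kap ^+ 2 * Fn + 2 * (lam * U).
  rewrite ler_pdivrMl//.
  have : Fn <= kap ^+ 2 * lam * Fn by rewrite ler_peMl.
  by move: HU; nra.
have kF : 0 <= kap ^+ 2 * Fn by rewrite mulr_ge0 ?sqr_ge0.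
have TF : 0 <= T ^+ 2 * Fn by rewrite mulr_ge0 ?sqr_ge0.
by move: EF Hl GW; lra.
Qed.

(** With w = v + v0, the functions u and w solve the problem without data except for
    w(0) = v0: the energy lam U + Wp of (u, w) is at most m = T v0^2. The letters G, H, U, W, Wp
    are the squared norms of u', v', u, v, w, and w1, K1 are the product of w with 1 and the
    squared norm of 1. The crude bounds G <= Wp and W <= 2 Wp + O(m) miss the constant 4 only
    when Wp carries most of the energy. If om T is large, integration by parts between
    u and w bounds G by lam^-1 H <= lam U and a part of m. If it is small, v is the primitive
    of v' and W is bounded by T^2 H, hence by lam U. *)
Lemma initial_velocity_estimate T lam om (G H U W Wp v0 w1 K1 uh vh e uT wT uw : R) :
  0 < T -> 0 < om -> lam = om ^+ 2 -> 0 <= e -> K1 <= 16 / 25 * T ->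
  0 <= G -> 0 <= H -> 0 <= U -> 0 <= W -> 0 <= Wp ->
  lam * U + Wp + e * T * (lam * uT ^+ 2 + wT ^+ 2) = T * v0 ^+ 2 ->
  G <= Wp ->
  H = - lam * uh -> uh ^+ 2 <= U * H ->
  G - lam^-1 * H = e * uT * wT + T^-1 * uw ->
  2 * om * uw <= lam * U + Wp ->
  W <= 2 * T * vh -> vh ^+ 2 <= H * W ->
  W = Wp - 2 * v0 * w1 + v0 ^+ 2 * K1 ->
  - (2 * v0 * w1) <= 20 / 21 * Wp + 21 / 20 * (v0 ^+ 2 * K1) ->
  G + lam^-1 * H + lam * U + W <= 4 * (T * v0 ^+ 2).
Proof.
move=> T0 om0 lamE e0 K1T G0 H0 U0 W0 Wp0 En GWp HE uH GH uwU Wv vH WE Ww.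
have lam0 : 0 < lam by rewrite lamE exprn_gt0.
have lU : 0 <= lam * U by rewrite mulr_ge0// ltW.
have HU : H <= lam ^+ 2 * U.
  apply: le_of_sqr_le_mul => //; first exact: mulr_ge0 (sqr_ge0 _) U0.
  have l2 : lam ^+ 2 * uh ^+ 2 <= lam ^+ 2 * (U * H) by rewrite ler_wpM2l ?sqr_ge0.
  by rewrite {1}HE; nra.
have Hl : lam^-1 * H <= lam * U by rewrite ler_pdivrMl// mulrA -expr2.
pose m := T * v0 ^+ 2.
have m0 : 0 <= m by rewrite mulr_ge0 ?sqr_ge0// ltW.
have Xs : lam * U + Wp <= m.
  have : 0 <= e * T * (lam * uT ^+ 2 + wT ^+ 2).
    apply: mulr_ge0; first exact: mulr_ge0 e0 (ltW T0).
    by rewrite addr_ge0 ?sqr_ge0//; exact: mulr_ge0 (ltW lam0) (sqr_ge0 _).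
  by rewrite /m -En; lra.
have W1 : W <= 41 / 21 * Wp + 41 / 20 * (16 / 25) * m.
  have : v0 ^+ 2 * K1 <= 16 / 25 * m.
    by have := ler_wpM2l (sqr_ge0 v0) K1T; rewrite /m; lra.
  by move: WE Ww; lra.
(* the threshold 6/5 leaves room in both cases *)
have [omT|omT] := leP (6 / 5) (om * T).
  have Gu : om * T * G <= om * T * (lam^-1 * H) + m / 2.
    have t1 : 2 * om * (uT * wT) <= lam * uT ^+ 2 + wT ^+ 2.
      by rewrite lamE; have := sqr_ge0 (om * uT - wT); nra.
    have t2 := ler_wpM2l (mulr_ge0 e0 (ltW T0)) t1.
    have := congr1 (fun x => om * T * x) GH; rewrite mulrBr mulrDr.
    rewrite (_ : om * T * (T^-1 * uw) = om * uw); last by field; rewrite gt_eqF.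
    by move: En; rewrite -/m; nra.
  have Gm : G <= lam^-1 * H + 5 / 12 * m.
    have [Gs|Gs] := leP G (lam^-1 * H); first by lra.
    have : 6 / 5 * (G - lam^-1 * H) <= om * T * (G - lam^-1 * H) by rewrite ler_wpM2r//; lra.
    by move: Gu; lra.
  by rewrite -/m; lra.
have T4 : 0 <= 4 * T ^+ 2 by rewrite mulr_ge0 ?sqr_ge0.
have W2 : W <= 4 * T ^+ 2 * H.
  apply: le_of_sqr_le_mul => //; first exact: mulr_ge0.
  apply: (@le_trans _ _ ((2 * T * vh) ^+ 2)).
    by rewrite lerXn2r ?nnegrE// (le_trans W0 Wv).
  rewrite exprMn (_ : (2 * T) ^+ 2 = 4 * T ^+ 2); last by ring.
  by rewrite -[leRHS]mulrA; apply: (ler_wpM2l T4).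
have W3 : W <= 144 / 25 * (lam * U).
  have h1 : 4 * T ^+ 2 * H <= 4 * T ^+ 2 * (lam ^+ 2 * U) by rewrite ler_wpM2l.
  have h2 : (om * T) ^+ 2 <= (6 / 5) ^+ 2.
    by rewrite lerXn2r ?nnegrE ?mulr_ge0 ?ltW// ltW.
  have h3 : (om * T) ^+ 2 * (lam * U) <= (6 / 5) ^+ 2 * (lam * U) by rewrite ler_wpM2r.
  have h4 : T ^+ 2 * (lam ^+ 2 * U) = (om * T) ^+ 2 * (lam * U) by rewrite lamE; ring.
  by lra.
by rewrite -/m; lra.
Qed.

End real_estimates.

(** * The time problem of one mode *)

(** Integrals are replaced by variables, because [lra] and [ring] compare their atoms up to
    conversion. *)
Ltac abstract_dots :=
  repeat match goal with
  | |- context [dot_w ?T ?f ?g] => generalize (dot_w T f g)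
  | |- context [prim ?g ?t] => generalize (prim g t)
  end; clear; intros.
Ltac lra_dots := abstract_dots; lra.
Ltac ring_dots := abstract_dots; ring.

Section mode_problem.
Context {R : realType} (T : R).
Hypothesis T0 : 0 < T.
Local Notation leb := (@lebesgue_measure R).
Local Notation It := (time_interval T).
Local Notation L2 := (L2t T).
Local Notation dot := (dot_w T).
Variable St : set (measurableTypeR R -> R).
Hypothesis hSt : finite_dim_subspace leb It (H10_left T) St.
Local Notation D := (derivatives T St).
Implicit Types (f g h l : measurableTypeR R -> R).

Lemma dot_w_quadratic a g h : L2 g -> L2 h ->
  dot (fun s => a * g s + h s) (fun s => a * g s + h s) =
  a ^+ 2 * dot g g + 2 * a * dot g h + dot h h.
Proof.
move=> Lg Lh; have Lag := sqiZ (measurable_time T) a Lg; have Ls := sqiD (measurable_time T) Lag Lh.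
rewrite (dot_wDl T0 Lag Lh Ls) (dot_wDr T0 Lag Lh Lag) (dot_wDr T0 Lag Lh Lh).
rewrite (dot_wZl T0 a Lg Lag) (dot_wZl T0 a Lg Lh) (dot_wZr T0 a Lg Lg) (dot_wZr T0 a Lg Lh).
rewrite (dot_wC T h g); ring_dots.
Qed.

Lemma dot_w_CS f g : L2 f -> L2 g -> dot f g ^+ 2 <= dot f f * dot g g.
Proof.
move=> sf sg; apply: sqr_le_of_quadratic_ge0; last exact: dot_w_ge0.
by move=> t; rewrite -(dot_w_quadratic t sf sg) dot_w_ge0.
Qed.

Lemma time_space_L2 u : St u -> L2 u.
Proof. by case: hSt => + _ _ _ => /[apply] -[]. Qed.

Lemma derivatives_L2 g : D g -> L2 g. Proof. by move=> [u _ []]. Qed.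

Lemma derivatives_linear a g h : D g -> D h -> D (fun s => a * g s + h s).
Proof.
move=> [u Su ug] [v Sv vh]; exists (fun s => a * u s + v s).
  by case: hSt => _ _ + _; apply.
by apply: weak_deriv_linear => //; exact: time_space_L2.
Qed.

Lemma derivatives0 : D (fun=> 0).
Proof.
case: hSt => _ S0 _ _; exists (fun=> 0) => //; split; first exact: L2t_cst.
by move=> phi _; rewrite !dotL2_0l oppr0.
Qed.

Lemma derivatives_sum (I : Type) (r : seq I) (a : I -> R) (g : I -> measurableTypeR R -> R) :
  (forall k, D (g k)) -> D (fun s => \sum_(k <- r) a k * g k s).
Proof.
move=> Dg; elim: r => [|k r IH].
  by under eq_fun do rewrite big_nil; exact: derivatives0.
by under eq_fun do rewrite big_cons; exact: derivatives_linear.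
Qed.

Lemma weak_deriv_sum (I : Type) (r : seq I) (a : I -> R) (u g : I -> measurableTypeR R -> R) :
  (forall k, St (u k)) -> (forall k, is_weak_deriv T (u k) (g k)) ->
  is_weak_deriv T (fun s => \sum_(k <- r) a k * u k s) (fun s => \sum_(k <- r) a k * g k s).
Proof.
move=> Su ug; elim: r => [|k r IH].
  under eq_fun do rewrite big_nil; under [X in is_weak_deriv _ _ X]eq_fun do rewrite big_nil.
  split; first exact: L2t_cst.
  by move=> phi _; rewrite !dotL2_0l oppr0.
under eq_fun do rewrite big_cons; under [X in is_weak_deriv _ _ X]eq_fun do rewrite big_cons.
apply: weak_deriv_linear => //; first exact: time_space_L2.
by apply: sqi_sum => // i; exact: time_space_L2.
Qed.

Lemma derivatives_span : exists m (d : 'I_m -> measurableTypeR R -> R),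
  (forall k, D (d k)) /\
  forall g, D g -> exists a : 'I_m -> R, ae_eq leb It g (fun s => \sum_k a k * d k s).
Proof.
case: hSt => SH S0 SD [m [b [Sb bspan]]].
have /choice[d bd] : forall k, exists d, is_weak_deriv T (b k) d.
  by move=> k; have [_ [g bg] _] := SH _ (Sb k); exists g.
exists m, d; split; first by move=> k; exists (b k).
move=> g [u Su ug]; have [a ua] := bspan u Su; exists a.
have sb k : L2 (b k) by exact: time_space_L2.
apply: (weak_deriv_unique _ (weak_deriv_sum _ a Sb bd)).
apply: ae_eq_weak_deriv ug => //; first exact: (time_space_L2 Su).1.
have : L2 (fun s => \sum_k a k * b k s) by exact: sqi_sum.
by case.
Qed.

Lemma prim_sum (I : Type) (r : seq I) (a : I -> R) (g : I -> measurableTypeR R -> R) t :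
  (forall k, L2 (g k)) -> t <= T ->
  prim (fun s => \sum_(k <- r) a k * g k s) t = \sum_(k <- r) a k * prim (g k) t.
Proof.
move=> sg tT; have Ig k := L2t_integrable (sg k).
rewrite /prim Rintegral_sum//.
  by apply: eq_bigr => k _; rewrite -(primZ _ tT (Ig k)).
by move=> k; apply: integrable_prefix tT _; exact: integrableZR.
Qed.

Lemma dot_prim_sum (I : Type) (r : seq I) (a : I -> R) (g : I -> measurableTypeR R -> R) l :
  (forall k, L2 (g k)) -> L2 l ->
  dot (prim (fun s => \sum_(k <- r) a k * g k s)) l = \sum_(k <- r) a k * dot (prim (g k)) l.
Proof.
move=> sg sl; rewrite -dot_w_suml//; last by move=> k; exact/L2t_prim/L2t_integrable.
apply: eq_Rintegral => t /set_mem; rewrite /time_interval /= in_itv/= => /andP[_ /ltW tT].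
by rewrite prim_sum.
Qed.

Lemma prim_L2 g : L2 g -> L2 (prim g). Proof. by move/L2t_integrable; exact: L2t_prim. Qed.

(** The coercivity on which everything rests: in the integration by parts, the boundary
    term is nonnegative and the decay of the weight adds the squared norm of the
    primitive. *)
Lemma dot_prim_ge g : L2 g -> T^-1 * dot (prim g) (prim g) <= 2 * dot (prim g) g.
Proof.
move=> sg; have := weighted_integration_by_parts T0 0 0 sg sg.
have -> : (fun s => 0 + prim g s) = prim g by apply/funext => s; rewrite add0r.
rewrite !add0r mul0r subr0 (dot_wC _ g) => H.
have : 0 <= expR (-1) * prim g T * prim g T.
  by rewrite -mulrA mulr_ge0 ?expR_ge0// -expr2 sqr_ge0.
by move: H; move: (expR (-1)) (T^-1); lra_dots.
Qed.

Lemma dot_prim_le g : L2 g -> dot (prim g) (prim g) <= 2 * T * dot (prim g) g.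
Proof.
by move=> sg; have := dot_prim_ge sg; rewrite ler_pdivrMl// mulrA (mulrC T).
Qed.

Lemma dot_prim_ge0 g : L2 g -> 0 <= dot (prim g) g.
Proof.
move=> sg; have := dot_prim_ge sg.
have : 0 <= T^-1 * dot (prim g) (prim g) by rewrite mulr_ge0 ?dot_w_ge0// invr_ge0 ltW.
by lra.
Qed.

Lemma prim_null g : L2 g -> dot (prim g) g = 0 -> ae_eq leb It g (cst 0).
Proof.
move=> sg g0; have sp := prim_L2 sg.
have p0 : dot (prim g) (prim g) = 0.
  have := dot_prim_ge sg; rewrite g0 mulr0 => H; apply/eqP; rewrite eq_le dot_w_ge0 andbT.
  by rewrite -(pmulr_rle0 _ (_ : 0 < T^-1)) ?invr_gt0.
have pae := dot_w_eq0 T0 sp p0.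
have wd : is_weak_deriv T (cst 0) g.
  apply: ae_eq_weak_deriv pae (prim_weak_deriv T0 sg); first exact: sp.1.
  exact: measurable_cst.
have wd0 : is_weak_deriv T (cst 0) (cst 0).
  by split=> [|phi _]; [exact: L2t_cst|rewrite !dotL2_0l oppr0].
exact: weak_deriv_unique wd wd0.
Qed.

(** The equations satisfied by the time coefficients of one spatial mode with
    eigenvalue lam, in terms of the derivatives g, h of these coefficients. *)
Definition mode_solution lam f (v0 : R) g h :=
  [/\ D g, D h, forall l, D l -> dot h l + lam * dot (prim g) l = dot f l &
    forall l, D l -> - dot g l + dot (prim h) l = - v0 * dot (fun=> 1) l].

Definition mode_form lam g h l k :=
  dot h l + lam * dot (prim g) l - dot g k + dot (prim h) k.

Lemma mode_form_suml lam (I : Type) (r : seq I) (x : I -> R) (G H : I -> measurableTypeR R -> R) l k :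
  (forall i, L2 (G i)) -> (forall i, L2 (H i)) -> L2 l -> L2 k ->
  mode_form lam (fun s => \sum_(i <- r) x i * G i s) (fun s => \sum_(i <- r) x i * H i s) l k =
  \sum_(i <- r) x i * mode_form lam (G i) (H i) l k.
Proof.
move=> sG sH sl sk; rewrite /mode_form !dot_w_suml// !dot_prim_sum//.
rewrite mulr_sumr -!big_split -sumrB -big_split /=; apply: eq_bigr => i _; ring.
Qed.

Lemma mode_form_sumr lam (I : Type) (r : seq I) (x : I -> R) (G H : I -> measurableTypeR R -> R) g h :
  (forall i, L2 (G i)) -> (forall i, L2 (H i)) -> L2 g -> L2 h ->
  mode_form lam g h (fun s => \sum_(i <- r) x i * G i s) (fun s => \sum_(i <- r) x i * H i s) =
  \sum_(i <- r) x i * mode_form lam g h (G i) (H i).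
Proof.
move=> sG sH sg sh; rewrite /mode_form.
rewrite (dot_wC _ h) (dot_wC _ (prim g)) (dot_wC _ g) (dot_wC _ (prim h)).
rewrite !dot_w_suml//; try exact: prim_L2.
rewrite mulr_sumr -!big_split -sumrB -big_split /=; apply: eq_bigr => i _.
rewrite (dot_wC _ h) (dot_wC _ (prim g)) (dot_wC _ g) (dot_wC _ (prim h)).
move: (x i); ring_dots.
Qed.

Lemma mode_form_null lam g h : 0 < lam -> L2 g -> L2 h -> mode_form lam g h g h = 0 ->
  ae_eq leb It g (cst 0) /\ ae_eq leb It h (cst 0).
Proof.
move=> lam0 sg sh; rewrite /mode_form (dot_wC _ h g) => E.
have g1 := dot_prim_ge0 sg; have h1 := dot_prim_ge0 sh.
have lg : 0 <= lam * dot (prim g) g by rewrite mulr_ge0// ltW.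
have lg0 : lam * dot (prim g) g = 0 by lra.
split; apply: prim_null => //; last by lra.
by move/eqP: lg0; rewrite mulf_eq0 (gt_eqF lam0) => /eqP.
Qed.

(** The form is definite, so that its matrix on a spanning family, invertible or
    not, has every admissible right-hand side in its range. *)
Lemma mode_solution_exists lam f v0 : 0 < lam -> L2 f -> exists g h, mode_solution lam f v0 g h.
Proof.
move=> lam0 sf; have [m [d [Dd dspan]]] := derivatives_span.
have s1 := L2t_cst T 1.
pose G (k : 'I_(m + m)) := if fintype.split k is inl i then d i else fun=> 0.
pose H (k : 'I_(m + m)) := if fintype.split k is inr i then d i else fun=> 0.
have DG k : D (G k) by rewrite /G; case: fintype.split => // _; exact: derivatives0.
have DH k : D (H k) by rewrite /H; case: fintype.split => // _; exact: derivatives0.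
have sG k := derivatives_L2 (DG k); have sH k := derivatives_L2 (DH k).
pose rhs l k := dot f l - v0 * dot (fun=> 1) k.
pose M := \matrix_(k, l) mode_form lam (G k) (H k) (G l) (H l).
pose r := \row_l rhs (G l) (H l).
have [x xM] : exists x, x *m M = r.
  apply: solvable_of_kernel => y yMy.
  pose g s := \sum_k y k ord0 * G k s; pose h s := \sum_k y k ord0 * H k s.
  have sg : L2 g by exact: sqi_sum.
  have sh : L2 h by exact: sqi_sum.
  have : mode_form lam g h g h = 0.
    move/matrixP: yMy => /(_ ord0 ord0); rewrite [RHS]mxE => <-.
    rewrite mode_form_suml// -mulmxA !mxE; apply: eq_bigr => k _; rewrite !mxE; congr (_ * _).
    rewrite mode_form_sumr//; apply: eq_bigr => l _.
    by rewrite mxE mulrC.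
  move=> /(mode_form_null lam0 sg sh)[g0 h0].
  apply/matrixP => i j; rewrite [RHS]mxE (ord1 i) (ord1 j) mxE.
  transitivity (rhs g h).
    rewrite /rhs (dot_wC _ f) (dot_wC _ (fun=> 1)) !dot_w_suml// mulr_sumr -sumrB.
    apply: eq_bigr => k _; rewrite mxE /rhs (dot_wC _ f) (dot_wC _ (fun=> 1)); ring.
  have z0 : L2 (cst 0) := L2t_cst T 0.
  rewrite /rhs (ae_eq_dot_w T0 sf sf sg z0 (ae_eq_refl _ _ _) g0).
  rewrite (ae_eq_dot_w T0 s1 s1 sh z0 (ae_eq_refl _ _ _) h0).
  by rewrite (dot_wC _ f) (dot_wC _ (fun=> 1)) !dot_wE// !dotL2_0l mulr0 subr0.
pose g s := \sum_k x ord0 k * G k s; pose h s := \sum_k x ord0 k * H k s.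
have Dg : D g by exact: derivatives_sum.
have Dh : D h by exact: derivatives_sum.
have sg := derivatives_L2 Dg; have sh := derivatives_L2 Dh; have sd k := derivatives_L2 (Dd k).
have spg := prim_L2 sg; have sph := prim_L2 sh.
have E j : mode_form lam g h (G j) (H j) = rhs (G j) (H j).
  move/matrixP: xM => /(_ ord0 j); rewrite [RHS]mxE => <-.
  by rewrite mode_form_suml// mxE; apply: eq_bigr => k _; rewrite mxE.
have dot0 (k : measurableTypeR R -> R) : dot k (fun=> 0) = 0 by rewrite dot_wC dot_wE// dotL2_0l.
have El k l (a : 'I_m -> R) : L2 k -> D l -> ae_eq leb It l (fun s => \sum_i a i * d i s) ->
    dot k l = \sum_i a i * dot k (d i).
  move=> sk Dl la; have sl : L2 (fun s => \sum_k a k * d k s) by exact: sqi_sum.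
  rewrite (ae_eq_dot_w T0 sk sk (derivatives_L2 Dl) sl (ae_eq_refl _ _ _) la).
  by rewrite dot_wC dot_w_suml//; apply: eq_bigr => i _; rewrite dot_wC.
exists g, h; split=> // l Dl; have [a la] := dspan l Dl.
- rewrite !(El _ _ _ _ Dl la)// mulr_sumr -big_split /=; apply: eq_bigr => i _.
  have := E (lshift m i); rewrite /mode_form /rhs /G /H.
  rewrite (unsplitK (inl i)) !dot0 => Ei; rewrite mulrCA -mulrDr; congr (_ * _).
  by move: Ei; lra.
- rewrite !(El _ _ _ _ Dl la)// mulr_sumr -sumrN -big_split /=; apply: eq_bigr => i _.
  have := E (rshift m i); rewrite /mode_form /rhs /G /H.
  rewrite (unsplitK (inr i)) !dot0 => Ei; rewrite mulrCA -mulrN -mulrDr; congr (_ * _).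
  by move: Ei; lra.
Qed.

Lemma mode_solution_unique lam g h : 0 < lam -> mode_solution lam (fun=> 0) 0 g h ->
  ae_eq leb It g (cst 0) /\ ae_eq leb It h (cst 0).
Proof.
move=> lam0 [Dg Dh E1 E2]; apply: (mode_form_null lam0); try exact: derivatives_L2.
have := E1 g Dg; have := E2 h Dh; rewrite oppr0 mul0r.
have -> : dot (fun=> 0) g = 0 by rewrite dot_wE// dotL2_0l.
by rewrite /mode_form (dot_wC _ h g); lra.
Qed.

Lemma mode_solution_linear a lam f1 f2 v1 v2 g1 h1 g2 h2 : L2 f1 -> L2 f2 ->
  mode_solution lam f1 v1 g1 h1 -> mode_solution lam f2 v2 g2 h2 ->
  mode_solution lam (fun s => a * f1 s + f2 s) (a * v1 + v2)
    (fun s => a * g1 s + g2 s) (fun s => a * h1 s + h2 s).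
Proof.
move=> sf1 sf2 [Dg1 Dh1 E1 E2] [Dg2 Dh2 E3 E4].
have sg1 := derivatives_L2 Dg1; have sg2 := derivatives_L2 Dg2.
have sh1 := derivatives_L2 Dh1; have sh2 := derivatives_L2 Dh2.
have dlin f g l : L2 f -> L2 g -> L2 l -> dot (fun s => a * f s + g s) l = a * dot f l + dot g l.
  by move=> sf sg sl; rewrite dot_wDl ?dot_wZl//; exact: sqiZ.
have plin g k l : L2 g -> L2 k -> L2 l ->
    dot (prim (fun s => a * g s + k s)) l = a * dot (prim g) l + dot (prim k) l.
  move=> sg sk sl; rewrite -dlin//; try exact: prim_L2.
  apply: eq_Rintegral => t /set_mem; rewrite /time_interval /= in_itv/= => /andP[_ /ltW tT].
  rewrite (primD tT (g := fun s => a * g s)) ?(primZ a tT (L2t_integrable sg))//.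
  - by apply: integrableZR => //; exact: L2t_integrable.
  - exact: L2t_integrable.
split; [exact: derivatives_linear|exact: derivatives_linear| |].
- move=> l Dl; have sl := derivatives_L2 Dl; rewrite !(dlin, plin)// -E1// -E3//; ring_dots.
- move=> l Dl; have sl := derivatives_L2 Dl; rewrite !(dlin, plin)//.
  have e2 := congr1 (fun x => a * x) (E2 l Dl); have e4 := E4 l Dl; move: e2 e4 => /=; lra_dots.
Qed.

(** The share of one mode in the square of the discrete norm. *)
Definition mode_energy lam g h :=
  dot g g + lam^-1 * dot h h + lam * dot (prim g) (prim g) + dot (prim h) (prim h).

(** Testing with g and h bounds the energy by the work of f against g; testing with h
    alone then bounds h. *)
Lemma mode_solution_forced kap lam f g h : 0 < lam -> 1 <= kap ^+ 2 * lam -> L2 f ->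
  mode_solution lam f 0 g h ->
  mode_energy lam g h <= 4 * (kap ^+ 2 + 4 * T ^+ 2) * dot f f.
Proof.
move=> lam0 klam sf [Dg Dh E1 E2].
have sg := derivatives_L2 Dg; have sh := derivatives_L2 Dh.
have spg := prim_L2 sg; have sph := prim_L2 sh.
apply: (@forced_estimate _ T kap lam _ _ _ _ _ (dot f g) (dot f h) (dot (prim g) h) (dot (prim h) g))
  => //; try exact: dot_w_ge0.
- have := E1 g Dg; have := E2 h Dh; rewrite oppr0 mul0r (dot_wC _ h g) => e2 e1.
  have := lerD (ler_wpM2l (ltW lam0) (dot_prim_le sg)) (dot_prim_le sh).
  have -> : dot (prim h) h = dot g h by move: e2; lra_dots.
  move=> /le_trans; apply; rewrite -e1 le_eqVlt; apply/orP; left; apply/eqP.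
  by move: (T) (lam); ring_dots.
- by have := E2 g Dg; rewrite oppr0 mul0r; lra_dots.
- exact: dot_w_CS.
- exact: dot_w_CS.
- by have := E1 h Dh; lra_dots.
- exact: dot_w_CS.
- exact: dot_w_CS.
Qed.

Lemma dot_cst1 : dot (fun=> 1) (fun=> 1) = T * (1 - expR (-1)).
Proof.
have sK : L2 (weight T).
  apply: (bounded_sqi (measurable_time T) (time_interval_lty T) (M := 1)).
    exact: measurable_weight.
  move=> s; rewrite /time_interval /= in_itv/= => /andP[/ltW s0 _].
  by rewrite ger0_norm ?(weight_le1 T0)// ltW// weight_gt0.
have := weight_prim T (ltW T0); rewrite weightT// => ->.
rewrite (primZ _ (lexx T) (L2t_integrable sK)) opprD addrA subrr add0r.
rewrite mulNr opprK mulrA divff ?gt_eqF// mul1r.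
by apply: eq_Rintegral => s _; rewrite !mul1r.
Qed.

(** Besides the tests with g and h, the bound uses the weighted integration by parts
    for the three pairs among u and w = v0 + v, with w(0) = v0. *)
Lemma mode_solution_initial lam v0 g h : 0 < lam ->
  mode_solution lam (fun=> 0) v0 g h -> mode_energy lam g h <= 4 * (T * v0 ^+ 2).
Proof.
move=> lam0 [Dg Dh E1 E2].
have sg := derivatives_L2 Dg; have sh := derivatives_L2 Dh.
have spg := prim_L2 sg; have sph := prim_L2 sh; have s1 := L2t_cst T 1.
have sc := L2t_cst T v0.
pose w s := v0 + prim h s.
have sw : L2 w by exact: sqiD.
have dotw1 l : L2 l -> dot w l = v0 * dot (fun=> 1) l + dot (prim h) l.
  move=> sl; rewrite /w dot_wDl// -dot_wZl//; congr (_ + _).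
  by apply: eq_Rintegral => s _; rewrite mulr1.
have dot0 (k : measurableTypeR R -> R) : dot (fun=> 0) k = 0 by rewrite dot_wE// dotL2_0l.
have gw l : D l -> dot g l = dot w l.
  by move=> Dl; rewrite dotw1; [have := E2 l Dl; lra|exact: derivatives_L2].
have hg l : D l -> dot h l = - lam * dot (prim g) l.
  by move=> Dl; have := E1 l Dl; rewrite dot0; lra.
pose om := Num.sqrt lam.
have om0 : 0 < om by rewrite sqrtr_gt0.
have omE : lam = om ^+ 2 by rewrite sqr_sqrtr// ltW.
have zp (k : measurableTypeR R -> R) : (fun s => 0 + prim k s) = prim k by apply/funext => s; rewrite add0r.
have ib1 := weighted_integration_by_parts T0 0 0 sg sg.
have ib2 := weighted_integration_by_parts T0 v0 v0 sh sh.
have ib3 := weighted_integration_by_parts T0 0 v0 sg sh.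
rewrite !zp !add0r in ib1 ib3; rewrite -/w in ib2 ib3.
have GW := gw g Dg; have HW := gw h Dh.
have LG := hg g Dg; have LH := hg h Dh.
have Ti x : T * (T^-1 * x) = x by rewrite mulrA divff ?mul1r// gt_eqF.
have sq a f k : L2 f -> L2 k -> 0 <= a ^+ 2 * dot f f + 2 * a * dot f k + dot k k.
  by move=> sf sk; rewrite -(dot_w_quadratic a sf sk) dot_w_ge0.
apply: (@initial_velocity_estimate _ T lam om _ _ _ _ (dot w w) v0 (dot w (fun=> 1))
  (dot (fun=> 1) (fun=> 1)) (dot (prim g) h) (dot (prim h) h) (expR (-1)) (prim g T) (w T)
  (dot (prim g) w)) => //; try exact: dot_w_ge0.
- by rewrite dot_cst1 mulrC; exact: (ler_wpM2r (ltW T0) expRN1_onem_le).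
- have A : dot h w = - lam * dot g (prim g).
    by rewrite dot_wC -HW dot_wC LG (dot_wC _ (prim g) g).
  rewrite A -/(w T) in ib2.
  have e1 := congr1 (fun x => T * lam * x) ib1; have e2 := congr1 (fun x => T * x) ib2.
  have t1 := Ti (lam * dot (prim g) (prim g)); have t2 := Ti (dot w w).
  by move: e1 e2 t1 t2 => /=; move: (T^-1) (expR (-1)); lra_dots.
- apply: le_of_sqr_le_mul; try exact: dot_w_ge0.
  by rewrite {1}GW; exact: dot_w_CS.
- exact: dot_w_CS.
- rewrite (dot_wC _ g w) -GW (dot_wC _ h (prim g)) in ib3.
  have -> : lam^-1 * dot h h = - dot (prim g) h.
    by rewrite LH mulNr mulrN mulrA mulVf ?mul1r// gt_eqF.
  by move: ib3; rewrite mul0r subr0 opprK.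
- by have := sq (- om) (prim g) w spg sw; rewrite sqrrN -omE; move: (om) (lam); lra_dots.
- exact: dot_prim_le.
- by rewrite mulrC; exact: dot_w_CS.
- have -> : dot (prim h) (prim h) = dot (fun s => - v0 * 1 + w s) (fun s => - v0 * 1 + w s).
    by apply: eq_Rintegral => s _; rewrite /w mulr1; ring.
  have -> : dot (fun s => - v0 * 1 + w s) (fun s => - v0 * 1 + w s) =
      (- v0) ^+ 2 * dot (fun=> 1) (fun=> 1) + 2 * - v0 * dot w (fun=> 1) + dot w w.
    by rewrite (dot_wC _ w); exact: (dot_w_quadratic (- v0) s1 sw).
  by move: (v0); ring_dots.
(* Young's inequality with the parameter 20/21 expected by the real estimate *)
- have := sq (20 / 21) w (fun s => v0 * 1) sw (sqiZ (measurable_time T) v0 s1).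
  have -> : dot w (fun s => v0 * 1) = v0 * dot w (fun=> 1) by apply: dot_wZr.
  have -> : dot (fun s => v0 * 1) (fun s => v0 * 1) = v0 * (v0 * dot (fun=> 1) (fun=> 1)).
    transitivity (v0 * dot (fun=> 1) (fun s => v0 * 1)); last by congr (_ * _); apply: dot_wZr.
    by apply: dot_wZl => //; exact: (sqiZ (measurable_time T) v0 s1).
  by move: (v0); lra_dots.
Qed.

End mode_problem.

(** * Eigenvectors of the discrete operator *)

Section eigenbasis.
Context {R : realType} {d : nat} (Omega : set 'rV[R]_d).
Hypotheses (oO : open Omega) (bO : bounded_set Omega).
Variable c : 'rV[R]_d -> R.
Hypothesis mc : measurable_fun Omega c.
Variable M : R.
Local Notation mu := (lebesgue_rV d).
Hypothesis cM : {ae mu, forall x, Omega x -> `|c x| <= M}.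
Variable S : set ('rV[R]_d -> R).
Hypothesis hS : finite_dim_subspace mu Omega (H10x Omega) S.
Local Notation dot := (dotx Omega).
Local Notation energy := (energy Omega c).

Let mO : measurable Omega := measurable_domain oO.

(** The eigenvectors of the discrete operator: the energy and the product of L^2 are
    diagonalized together on coefficient vectors, and a function that is null for
    the product of L^2 vanishes almost everywhere. *)
Lemma eigenbasis : exists n (e : 'I_n -> 'rV[R]_d -> R) (lam : 'I_n -> R),
  [/\ forall k, S (e k), forall k l, dot (e k) (e l) = (k == l)%:R,
      forall k l, energy (e k) (e l) = lam k * (k == l)%:R &
      forall v, S v -> ae_eq mu Omega v (fun x => \sum_k dot v (e k) * e k x)].
Proof.
have [_ _ _ [m [b [Sb bspan]]]] := hS.
pose vec (x : 'rV[R]_m) y := \sum_j x ord0 j * b j y.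
have Svec x : S (vec x) by exact: (subspace_sum hS).
have sb j : L2x Omega (b j) := subspace_L2 hS (Sb j).
have svec x : L2x Omega (vec x) := subspace_L2 hS (Svec x).
have hb j : H1x Omega (b j) := (subspace_H10x hS (Sb j)).1.
have hvec x : H1x Omega (vec x) := (subspace_H10x hS (Svec x)).1.
pose be x y := dot (vec x) (vec y).
pose al x y := energy (vec x) (vec y).
have beE x v : L2x Omega v -> dot (vec x) v = \sum_j x ord0 j * dot (b j) v.
  by move=> sv; rewrite /dotx /vec (dotL2_suml mO).
have alE x v : H1x Omega v -> energy (vec x) v = \sum_j x ord0 j * energy (b j) v.
  by move=> hv; rewrite /vec (energy_suml oO bO mc cM hS).
have hbe : symmetric_bilinear be.
  split=> [a u v w|u v]; last by rewrite /be /dotx dotL2C.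
  rewrite /be !beE// mulr_sumr -big_split/=; apply: eq_bigr => j _.
  by rewrite !mxE mulrDl mulrA.
have hal : symmetric_bilinear al.
  split=> [a u v w|u v]; last by rewrite /al energyC.
  rewrite /al !alE// mulr_sumr -big_split/=; apply: eq_bigr => j _.
  by rewrite !mxE mulrDl mulrA.
have be0 u : 0 <= be u u by exact: dotL2_ge0.
pose bb (j : 'I_m) : 'rV[R]_m := delta_mx ord0 j.
have vecb j : vec (bb j) = b j.
  apply/funext => y; rewrite /vec (bigD1 j)//= mxE !eqxx mul1r big1 ?addr0// => i ij.
  by rewrite mxE eqxx (negbTE ij) mul0r.
have [n [e [lam [_ e2 e3 e4]]]] := codiagonalization hal hbe be0 bb.
exists n, (fun k => vec (e k)), lam; split=> //.
move=> v Sv; have [a va] := bspan v Sv; have sv := subspace_L2 hS Sv.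
pose E k := vec (e k).
have sE k : L2x Omega (E k) by exact: svec.
have bj j : ae_eq mu Omega (b j) (fun x => \sum_k dot (b j) (E k) * E k x).
  have := dotL2_eq0 mO (svec _) (e4 j).
  have -> : vec (residual be e (bb j)) = (fun x => b j x - \sum_k dot (b j) (E k) * E k x).
    apply/funext => x.
    have vecB (y z : 'rV[R]_m) : vec (y - z) x = vec y x - vec z x.
      rewrite /vec -sumrB; apply: eq_bigr => i _.
      by rewrite !mxE mulrBl.
    rewrite /residual vecB vecb; congr (_ - _).
    transitivity (\sum_i \sum_k be (bb j) (e k) * e k ord0 i * b i x).
      apply: eq_bigr => i _; rewrite summxE mulr_suml; apply: eq_bigr => k _.
      by rewrite mxE.
    rewrite exchange_big/=; apply: eq_bigr => k _; rewrite /E {2}/vec mulr_sumr /be vecb.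
    by apply: eq_bigr => i _; rewrite mulrA.
  by apply: filterS => x H Ox; apply/eqP; rewrite -subr_eq0; apply/eqP; exact: H.
have coef k : dot v (E k) = \sum_j a j * dot (b j) (E k).
  rewrite /dotx -(dotL2_suml mO)//; last exact: sE.
  have s2 : L2x Omega (fun x => \sum_j a j * b j x) by exact: sqi_sum.
  exact: (ae_eq_dotL2 mO sv.1 s2.1 (sE k).1 (sE k).1 va (ae_eq_refl _ _ _)).
have ball : {ae mu, forall x, forall j, Omega x -> b j x = \sum_k dot (b j) (E k) * E k x}.
  have h (N : nat) : {ae mu, forall x, forall j : 'I_m, j = N :> nat -> Omega x ->
      b j x = \sum_k dot (b j) (E k) * E k x}.
    have [Nm|mN] := ltnP N m; last by apply: aeW => x j jN; have := ltn_ord j; rewrite jN ltnNge mN.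
    apply: filterS (bj (Ordinal Nm)) => x H j jN Ox.
    by have -> : j = Ordinal Nm; [exact: val_inj|exact: H].
  by have /ae_foralln := h; apply: filterS => x H j; exact: (H j j erefl).
apply: filterS (filterI va ball) => x [H1 H2] Ox; rewrite H1//.
under [RHS]eq_bigr do rewrite coef mulr_suml.
rewrite exchange_big/=; apply: eq_bigr => j _; rewrite H2// mulr_sumr.
by apply: eq_bigr => k _; rewrite mulrA.
Qed.

End eigenbasis.

(** * The weighted product on the cylinder *)

Section spacetime_products.
Context {R : realType} {d : nat} (Omega : set 'rV[R]_d).
Hypotheses (oO : open Omega) (bO : bounded_set Omega).
Variable T : R.
Hypothesis T0 : 0 < T.
Local Notation spacetime := ('rV[R]_d * measurableTypeR R)%type.
Local Notation It := (time_interval T).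
Local Notation cyl := (cylinder Omega T).
Local Notation leb := (@lebesgue_measure R).
Local Notation mu := (lebesgue_rV d).
Local Notation xt := (lebesgue_xt R d).
Implicit Types U V W : spacetime -> R.

Let mO : measurable Omega := measurable_domain oO.
Let mC : measurable cyl := measurable_cylinder oO T.

Definition half_weight (s : R) : R := expR (- (s / T) / 2).

Lemma half_weight_sqr s : half_weight s * half_weight s = weight T s.
Proof. by rewrite /half_weight -expRD -splitr. Qed.

Lemma half_weight_le1 s : 0 <= s -> half_weight s <= 1.
Proof.
move=> s0; rewrite /half_weight -expR0 ler_expR mulNr oppr_le0.
by apply: divr_ge0 => //; apply: divr_ge0 => //; exact: ltW.
Qed.

Lemma measurable_half_weight : measurable_fun (setT : set (measurableTypeR R)) half_weight.
Proof.
apply: measurableT_comp; first exact: measurable_expR.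
apply: measurable_funM; last exact: measurable_cst.
apply: measurable_funN; apply: measurable_funM; [exact: measurable_id|exact: measurable_cst].
Qed.

Lemma ae_slice_L2x U : L2xt Omega T U ->
  {ae leb, forall s, It s -> L2x Omega (fun x => U (x, s))}.
Proof.
move=> [mU U2]; apply: filterS (ae_integrable_section mO (measurable_time T) U2) => s H Is.
by split; [exact: (measurable_section mO (measurable_time T) mU Is)|exact: H].
Qed.

Lemma half_weight_L2xt U : L2xt Omega T U -> L2xt Omega T (fun z => U z * half_weight z.2).
Proof.
move=> LU; have -> : (fun z => U z * half_weight z.2) = (fun z => half_weight z.2 * U z).
  by apply/funext => z; rewrite mulrC.
apply: (@sqi_bounded _ _ _ _ _ mC 1) => //.
  apply: measurable_funTS; exact: (measurableT_comp measurable_half_weight measurable_snd).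
apply: aeW => -[x s] [_ /= Is].
have s0 : 0 <= s by move: Is; rewrite /time_interval /= in_itv/= => /andP[/ltW].
by rewrite ger0_norm ?expR_ge0// half_weight_le1.
Qed.

(** Multiplying by the square root of the weight turns the weighted product into the product of
    L^2(Q_T), up to Fubini's theorem. *)
Lemma dot_eE U V : L2xt Omega T U -> L2xt Omega T V ->
  dot_e Omega T U V =
  dotL2 xt cyl (fun z => U z * half_weight z.2) (fun z => V z * half_weight z.2).
Proof.
move=> LU LV.
have I := sqiM_integrable mC (half_weight_L2xt LU) (half_weight_L2xt LV).
rewrite /dotL2 /cylinder /lebesgue_xt (Rintegral_fubini2 mO (measurable_time T) I).
apply: (ae_eq_Rintegral_any (measurable_time T)).
  exact: (measurable_of_integrable (integrable_int_section mO (measurable_time T) I)).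
apply: filterS (filterI (ae_slice_L2x LU) (ae_slice_L2x LV)) => s [LUs LVs] Is.
have I2 := sqiM_integrable mO (LUs Is) (LVs Is).
rewrite /dotx /dotL2 -/(weight T s) -half_weight_sqr -RintegralZr//.
by apply: eq_Rintegral => x _; rewrite mulrACA.
Qed.

Lemma norm_e_sqr U : norm_e Omega T U ^+ 2 = dot_e Omega T U U.
Proof.
rewrite sqr_sqrtr//; apply: Rintegral_ge0 => s _.
by rewrite mulr_ge0// ?expR_ge0//; exact: dotL2_ge0.
Qed.

Lemma norm_eE U : L2xt Omega T U ->
  norm_e Omega T U = normL2 xt cyl (fun z => U z * half_weight z.2).
Proof. by move=> LU; rewrite /norm_e dot_eE. Qed.

Lemma norm_eD U V : L2xt Omega T U -> L2xt Omega T V ->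
  norm_e Omega T (fun z => U z + V z) <= norm_e Omega T U + norm_e Omega T V.
Proof.
move=> LU LV; have LUV := sqiD mC LU LV.
rewrite !norm_eE//.
have -> : (fun z => (U z + V z) * half_weight z.2) =
    (fun z => U z * half_weight z.2 + V z * half_weight z.2).
  by apply/funext => z; rewrite mulrDl.
by apply: (normL2D mC); exact: half_weight_L2xt.
Qed.

Lemma dot_eDl U V W : L2xt Omega T U -> L2xt Omega T V -> L2xt Omega T W ->
  dot_e Omega T (fun z => U z + V z) W = dot_e Omega T U W + dot_e Omega T V W.
Proof.
move=> LU LV LW; have LUV := sqiD mC LU LV.
rewrite !dot_eE//.
have -> : (fun z => (U z + V z) * half_weight z.2) =
    (fun z => U z * half_weight z.2 + V z * half_weight z.2).
  by apply/funext => z; rewrite mulrDl.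
by apply: (dotL2Dl mC); exact: half_weight_L2xt.
Qed.

Lemma time_independent_L2xt (v : 'rV[R]_d -> R) : L2x Omega v -> L2xt Omega T (time_independent v).
Proof.
move=> Lv; have := sqi_tensor mO (measurable_time T) Lv (L2t_cst T 1).
by congr square_integrable; apply/funext => z; rewrite mulr1.
Qed.

Lemma norm_e_time_independent (v : 'rV[R]_d -> R) : L2x Omega v ->
  norm_e Omega T (time_independent v) <= Num.sqrt T * normx Omega v.
Proof.
move=> Lv.
have T0' := ltW T0.
rewrite /norm_e /normx /normL2 -sqrtrM// ler_sqrt; last first.
  by rewrite mulr_ge0// dotL2_ge0.
rewrite /dot_e /time_independent /= -/(dotx Omega v v).
have v0 : 0 <= dotx Omega v v := dotL2_ge0 _ _ _.
have <- : \int[leb]_(s in It) dotx Omega v v = T * dotx Omega v v.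
  rewrite Rintegral_cst// mulrC; congr (_ * _).
  exact: (congr1 fine (time_interval_measure T0)).
apply: (ae_le_Rintegral (measurable_time T)).
- have := sqiM_integrable (measurable_time T) (weight_sqi T0 (L2t_cst T 1)) (L2t_cst T (dotx Omega v v)).
  by apply: eq_integrable => // s _; rewrite /= mul1r mulrC.
- exact: (L2t_integrable (L2t_cst T _)).
- apply: aeW => s; rewrite /time_interval /= in_itv/= => /andP[/ltW s0 _].
  by rewrite ler_piMr// weight_le1.
Qed.

End spacetime_products.

(** * Expansions over the eigenvectors *)

Section modal_expansions.
Context {R : realType} {d : nat} (Omega : set 'rV[R]_d).
Hypotheses (oO : open Omega) (bO : bounded_set Omega).
Variable T : R.
Hypothesis T0 : 0 < T.
Variable c : 'rV[R]_d -> R.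
Hypothesis mc : measurable_fun Omega c.
Variable M : R.
Local Notation spacetime := ('rV[R]_d * measurableTypeR R)%type.
Local Notation It := (time_interval T).
Local Notation cyl := (cylinder Omega T).
Local Notation leb := (@lebesgue_measure R).
Local Notation mu := (lebesgue_rV d).
Local Notation xt := (lebesgue_xt R d).
Hypothesis cM : {ae mu, forall x, Omega x -> `|c x| <= M}.
Variable Sx : set ('rV[R]_d -> R).
Hypothesis hSx : finite_dim_subspace mu Omega (H10x Omega) Sx.
Local Notation dot := (dotx Omega).
Local Notation energy := (energy Omega c).
Variables (n : nat) (e : 'I_n -> 'rV[R]_d -> R) (lam : 'I_n -> R).
Hypothesis Se : forall k, Sx (e k).
Hypothesis e_orthonormal : forall k l, dot (e k) (e l) = (k == l)%:R.
Hypothesis e_energy : forall k l, energy (e k) (e l) = lam k * (k == l)%:R.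
Implicit Types (U V W : spacetime -> R) (u g h : 'I_n -> measurableTypeR R -> R).
Implicit Types (a b : 'I_n -> R) (v w : 'rV[R]_d -> R).

Let mO : measurable Omega := measurable_domain oO.
Let mC : measurable cyl := measurable_cylinder oO T.

Definition synth a : 'rV[R]_d -> R := fun x => \sum_k a k * e k x.

Definition modal u : spacetime -> R := fun z => synth (fun k => u k z.2) z.1.

Definition coef W k : measurableTypeR R -> R := fun s => dot (fun x => W (x, s)) (e k).

Lemma e_L2 k : L2x Omega (e k). Proof. exact: (subspace_L2 hSx). Qed.

Lemma H10x_H1x v : H10x Omega v -> H1x Omega v. Proof. by case. Qed.

Lemma e_H1x k : H1x Omega (e k). Proof. exact/H10x_H1x/(subspace_H10x hSx). Qed.

Lemma synth_subspace a : Sx (synth a). Proof. exact: (subspace_sum hSx). Qed.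

Lemma synth_L2 a : L2x Omega (synth a).
Proof. exact: (subspace_L2 hSx (synth_subspace a)). Qed.

Lemma sum_kronecker a k : \sum_i a i * (i == k)%:R = a k.
Proof.
rewrite (bigD1 k)//= eqxx mulr1 big1 ?addr0// => i /negPf ->; exact: mulr0.
Qed.

Lemma dotx_synthr w a : L2x Omega w -> dot w (synth a) = \sum_k a k * dot w (e k).
Proof. move=> Lw; exact: (dotL2_sumr mO _ _ e_L2 Lw). Qed.

Lemma dotx_synthE a k : dot (synth a) (e k) = a k.
Proof.
rewrite /dotx dotL2C -/(dotx _ _ _) dotx_synthr; last exact: e_L2.
by rewrite -[RHS]sum_kronecker; apply: eq_bigr => i _; rewrite e_orthonormal eq_sym.
Qed.

Lemma energy_synthr w a : H1x Omega w -> energy w (synth a) = \sum_k a k * energy w (e k).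
Proof. move=> Lw; exact: (energy_sumr oO bO mc cM hSx _ _ Se Lw). Qed.

Lemma energy_synthE a k : energy (synth a) (e k) = lam k * a k.
Proof.
rewrite energyC energy_synthr; last exact: e_H1x.
rewrite mulrC -[RHS](sum_kronecker (fun i => a i * lam k)); apply: eq_bigr => i _.
by rewrite e_energy eq_sym -mulrA; case: eqP => [->|].
Qed.

(** Bessel's inequality: the residual of the orthogonal projection has a nonnegative square. *)
Lemma bessel w : L2x Omega w -> \sum_k dot w (e k) ^+ 2 <= dot w w.
Proof.
move=> Lw; set p := synth (fun k => dot w (e k)).
have Lp : L2x Omega p by exact: synth_L2.
have := dotL2_ge0 mu Omega (fun x => w x - p x).
have Lwp := sqiB mO Lw Lp.
rewrite (dotL2Bl mO Lw Lp Lwp) (dotL2Br mO Lw Lp Lw) (dotL2Br mO Lw Lp Lp).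
rewrite (dotL2C _ _ p w) -!/(dotx _ _ _).
have wp : dot w p = \sum_k dot w (e k) ^+ 2.
  by rewrite dotx_synthr//; apply: eq_bigr => k _; rewrite expr2.
have pp : dot p p = \sum_k dot w (e k) ^+ 2.
  rewrite [in LHS]/p dotx_synthr//; apply: eq_bigr => k _.
  by rewrite dotx_synthE expr2.
by rewrite wp pp subrr subr0 subr_ge0.
Qed.

Section expansion.
Variables (U : spacetime -> R) (u : 'I_n -> measurableTypeR R -> R).
Hypothesis LU : L2xt Omega T U.
Hypothesis Uu : ae_eq xt cyl U (modal u).

Lemma ae_slice_expansion : {ae leb, forall s, It s ->
  ae_eq mu Omega (fun x => U (x, s)) (synth (fun k => u k s))}.
Proof.
have := ae_eq_sections (m1 := mu) (m2 := leb) (A := Omega) (B := It) Uu.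
by apply: filterS => s H /H.
Qed.

(** At almost every time, the slice of U equals its expansion almost everywhere, and [weak_grad]
    takes the same value on both. *)
Lemma ae_slice_grad : {ae leb, forall s, It s ->
  weak_grad Omega (fun x => U (x, s)) = weak_grad Omega (synth (fun k => u k s))}.
Proof.
apply: filterS (filterI (ae_slice_L2x oO LU) ae_slice_expansion) => s [L E] Is.
apply: (ae_eq_weak_grad oO bO) (E Is); [exact: (L Is).1 | exact: (synth_L2 _).1].
Qed.

Lemma ae_slice_dot w : L2x Omega w -> {ae leb, forall s, It s ->
  dot w (fun x => U (x, s)) = \sum_k u k s * dot w (e k)}.
Proof.
move=> Lw; apply: filterS (filterI (ae_slice_L2x oO LU) ae_slice_expansion) => s [L E] Is.
rewrite -dotx_synthr//; have Ls := synth_L2 (fun k => u k s).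
by apply: (ae_eq_dotL2 mO Lw.1 Lw.1 (L Is).1 Ls.1 _ (E Is)); exact: ae_eq_refl.
Qed.

Lemma ae_coef k : ae_eq leb It (coef U k) (u k).
Proof.
apply: filterS (ae_slice_dot (e_L2 k)) => s H Is.
rewrite /coef /dotx dotL2C -/(dotx _ _ _) H// -[RHS](sum_kronecker (fun i => u i s)).
by apply: eq_bigr => i _; rewrite e_orthonormal eq_sym.
Qed.

End expansion.

Lemma coef_L2t W k : L2xt Omega T W -> L2t T (coef W k).
Proof.
move=> LW; have Le := time_independent_L2xt oO T (e_L2 k).
have mcoef : measurable_fun It (coef W k).
  have I := integrable_int_section mO (measurable_time T) (sqiM_integrable mC LW Le).
  exact: (measurable_of_integrable I).
have IG := integrable_int_section mO (measurable_time T) (sqiM_integrable mC LW LW).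
have mG := measurable_of_integrable IG.
split => //.
(* the square of the coefficient is below the squared norm of the slice at almost every
   time only *)
pose g s := Num.max (coef W k s ^+ 2) (dot (fun x => W (x, s)) (fun x => W (x, s))).
have mc2 : measurable_fun It (fun s => coef W k s ^+ 2) by exact: measurable_funX.
apply: (le_integrableR (measurable_time T) (g := g)) => //; last first.
  by move=> s _; rewrite ger0_norm ?sqr_ge0// /g le_max lexx.
have mg : measurable_fun It g by exact: measurable_maxr.
apply: (ae_eq_integrable (measurable_time T) mg _ IG).
apply: filterS (ae_slice_L2x oO LW) => s L Is; rewrite /g max_r//.
by have := dotL2_CS mO (L Is) (e_L2 k); rewrite -!/(dotx _ _ _) e_orthonormal eqxx mulr1.
Qed.

(** Products of functions that are sums over the modes for almost every time reduce to
    products of functions of time. *)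
Lemma weighted_sum_of_products (q : measurableTypeR R -> R) a u g :
  (forall k, L2t T (u k)) -> (forall k, L2t T (g k)) ->
  {ae leb, forall s, It s -> q s = \sum_k a k * (u k s * g k s)} ->
  \int[leb]_(s in It) (q s * expR (- (s / T))) = \sum_k a k * dot_w T (u k) (g k).
Proof.
move=> Lu Lg H.
have I k : leb.-integrable It (EFin \o (fun s => a k * (u k s * g k s * weight T s))).
  exact/(integrableZR (measurable_time T))/(integrable_w T0).
transitivity (\int[leb]_(s in It) \sum_k a k * (u k s * g k s * weight T s)).
  apply: (ae_eq_Rintegral_any (measurable_time T)).
    exact: (measurable_of_integrable (integrable_sumR (measurable_time T) (index_enum 'I_n) I)).
  apply: filterS H => s H Is; rewrite H// mulr_suml.
  by apply: eq_bigr => k _; rewrite -!mulrA.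
rewrite (Rintegral_sum (measurable_time T) (index_enum 'I_n) I); apply: eq_bigr => k _.
by rewrite RintegralZl//; exact: (integrable_w T0).
Qed.

Section products.
Variables (U L : spacetime -> R) (u l : 'I_n -> measurableTypeR R -> R).
Hypotheses (LU : L2xt Omega T U) (Lu : forall k, L2t T (u k)) (Uu : ae_eq xt cyl U (modal u)).
Hypotheses (LL : L2xt Omega T L) (Ll : forall k, L2t T (l k)) (Ul : ae_eq xt cyl L (modal l)).

Lemma dot_e_coef W : L2xt Omega T W ->
  dot_e Omega T W U = \sum_k dot_w T (coef W k) (u k).
Proof.
move=> LW; rewrite /dot_e (weighted_sum_of_products (a := fun=> 1)
  (fun k => coef_L2t k LW) Lu); first by under eq_bigr do rewrite mul1r.
apply: filterS (filterI (ae_slice_L2x oO LW)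
  (filterI (ae_slice_L2x oO LU) (ae_slice_expansion Uu))) => s [Ws [Us E]] Is.
have Ls := synth_L2 (fun k => u k s).
transitivity (dot (fun x => W (x, s)) (synth (fun k => u k s))).
  by apply: (ae_eq_dotL2 mO (Ws Is).1 (Ws Is).1 (Us Is).1 Ls.1 _ (E Is)); exact: ae_eq_refl.
by rewrite dotx_synthr; [apply: eq_bigr => k _; rewrite mul1r mulrC|exact: Ws].
Qed.

Lemma dot_e_modal : dot_e Omega T L U = \sum_k dot_w T (l k) (u k).
Proof.
rewrite dot_e_coef//; apply: eq_bigr => k _; apply: (ae_eq_dot_w T0) => //.
- exact: coef_L2t.
- exact: ae_coef.
- exact: ae_eq_refl.
Qed.

Lemma ae_slice_energy : {ae leb, forall s, It s ->
  energy (fun x => L (x, s)) (fun x => U (x, s)) = \sum_k lam k * (l k s * u k s)}.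
Proof.
apply: filterS (filterI (ae_slice_grad LL Ul) (ae_slice_grad LU Uu)) => s [Gl Gu] Is.
rewrite (energy_congr _ (Gl Is) (Gu Is)) energy_synthr; last first.
  exact: (H10x_H1x (subspace_H10x hSx (synth_subspace _))).
by apply: eq_bigr => k _; rewrite energy_synthE mulrCA (mulrC (u k s)).
Qed.

Lemma dotv_e_modal : dotv_e Omega T (fun z => c z.1 ^+ 2 *: gradx Omega L z) (gradx Omega U) =
  \sum_k lam k * dot_w T (l k) (u k).
Proof. rewrite /dotv_e; apply: weighted_sum_of_products => //; exact: ae_slice_energy. Qed.

Lemma dotv_e_time_independent (U0 : 'rV[R]_d -> R) : H10x Omega U0 ->
  dotv_e Omega T (fun z => c z.1 ^+ 2 *: gradx Omega (time_independent U0) z) (gradx Omega U) =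
  \sum_k energy U0 (e k) * dot_w T (fun=> 1) (u k).
Proof.
move=> HU0; rewrite /dotv_e; apply: (@weighted_sum_of_products _ _ (fun=> fun=> 1)) => //.
  by move=> k; exact: L2t_cst.
apply: filterS (ae_slice_grad LU Uu) => s Gu Is.
rewrite /gradx /time_independent /= (Gu Is) -/(energy _ _).
transitivity (energy U0 (synth (fun k => u k s))) => //.
rewrite energy_synthr; last exact: H10x_H1x.
by apply: eq_bigr => k _; rewrite mul1r mulrC.
Qed.

Lemma normv_e_sqr (P : spacetime -> 'rV[R]_d) :
  normv_e Omega T P ^+ 2 = dotv_e Omega T P P.
Proof.
rewrite sqr_sqrtr//; apply: Rintegral_ge0 => s _.
by rewrite mulr_ge0// ?expR_ge0//; apply: sumr_ge0 => i _; exact: dotL2_ge0.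
Qed.

End products.

Lemma dotv_e_c_grad V : dotv_e Omega T (fun z => c z.1 *: gradx Omega V z)
    (fun z => c z.1 *: gradx Omega V z) =
  \int[leb]_(s in It) (energy (fun x => V (x, s)) (fun x => V (x, s)) * expR (- (s / T))).
Proof.
apply: eq_Rintegral => s _; rewrite energyE; congr (_ * _).
by apply: eq_bigr => i _; rewrite /gradx; congr dotx; apply/funext => x; rewrite mxE.
Qed.

Lemma normv_e_modal U u : L2xt Omega T U -> (forall k, L2t T (u k)) -> ae_eq xt cyl U (modal u) ->
  normv_e Omega T (fun z => c z.1 *: gradx Omega U z) ^+ 2 = \sum_k lam k * dot_w T (u k) (u k).
Proof.
move=> LU Lu Uu; rewrite normv_e_sqr dotv_e_c_grad.
apply: weighted_sum_of_products => //; exact: ae_slice_energy.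
Qed.

Section newton.
Hypothesis lam0 : forall k, 0 < lam k.
Hypothesis e_span : forall v, Sx v -> ae_eq mu Omega v (synth (fun k => dot v (e k))).

(** The Newton potential divides the coefficient k by lam k, and its energy is its product
    with v. *)
Lemma newton_synth v a : L2x Omega v -> ae_eq mu Omega v (synth a) ->
  energy (newton Omega c Sx v) (newton Omega c Sx v) = \sum_k (lam k)^-1 * (a k * a k).
Proof.
move=> Lv va.
have dva w : L2x Omega w -> dot v w = dot w (synth a).
  move=> Lw; rewrite [RHS]dotL2C.
  by apply: (ae_eq_dotL2 mO Lv.1 (synth_L2 a).1 Lw.1 Lw.1 va); exact: ae_eq_refl.
have [SN HN] : [set w | Sx w /\ forall z, Sx z -> energy w z = dot v z] (newton Omega c Sx v).
  apply: (@xgetPex _ (fun=> 0)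
    [set w | Sx w /\ forall z, Sx z -> energy w z = dot v z]).
  exists (synth (fun k => a k / lam k)); split=> [|z Sz]; first exact: synth_subspace.
  have Lz := subspace_L2 hSx Sz; rewrite dva//.
  have Hs := H10x_H1x (subspace_H10x hSx (synth_subspace (fun k => a k / lam k))).
  have Hz := H10x_H1x (subspace_H10x hSx Sz).
  rewrite energyC energy_synthr// dotx_synthr//; apply: eq_bigr => k _.
  set b := fun k => dot z (e k).
  have -> : energy z (e k) = energy (synth b) (e k).
    apply: (ae_eq_energyl oO mc cM) => //; first exact: e_H1x.
      exact: (H10x_H1x (subspace_H10x hSx (synth_subspace b))).
    move=> i; rewrite (ae_eq_weak_grad oO bO Lz.1 (synth_L2 b).1 (e_span Sz)).
    exact: ae_eq_refl.
  by rewrite energy_synthE mulrA divfK// gt_eqF.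
set N := newton _ _ _ _ in SN HN *.
have LN := subspace_L2 hSx SN.
have HN1 := H10x_H1x (subspace_H10x hSx SN).
rewrite HN// dva// dotx_synthr//; apply: eq_bigr => k _.
rewrite mulrCA; congr (_ * _).
have : energy N (e k) = lam k * dot N (e k).
  set b := fun k => dot N (e k); rewrite -(energy_synthE b k).
  apply: (ae_eq_energyl oO mc cM) => //; first exact: e_H1x.
    exact: (H10x_H1x (subspace_H10x hSx (synth_subspace b))).
  move=> i; rewrite (ae_eq_weak_grad oO bO LN.1 (synth_L2 b).1 (e_span SN)).
  exact: ae_eq_refl.
rewrite HN// dva; last exact: e_L2.
rewrite [X in X = _ -> _]dotL2C -/(dotx _ _ _) dotx_synthE => ->.
by rewrite mulrA mulVf ?mul1r// gt_eqF.
Qed.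

Lemma norm_newton_modal V h : L2xt Omega T V -> (forall k, L2t T (h k)) ->
  ae_eq xt cyl V (modal h) ->
  norm_newton Omega T c Sx V ^+ 2 = \sum_k (lam k)^-1 * dot_w T (h k) (h k).
Proof.
move=> LV Lh Vh; rewrite /norm_newton normv_e_sqr dotv_e_c_grad.
apply: weighted_sum_of_products => //.
apply: filterS (filterI (ae_slice_L2x oO LV) (ae_slice_expansion Vh)) => s [LVs E] Is.
exact: (newton_synth (LVs Is) (E Is)).
Qed.

End newton.
End modal_expansions.

(** * Weak time derivatives of the expansions *)

Section time_derivatives.
Context {R : realType} {d : nat} (Omega : set 'rV[R]_d).
Hypotheses (oO : open Omega) (bO : bounded_set Omega).
Variable T : R.
Hypothesis T0 : 0 < T.
Local Notation spacetime := ('rV[R]_d * measurableTypeR R)%type.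
Local Notation It := (time_interval T).
Local Notation cyl := (cylinder Omega T).
Local Notation leb := (@lebesgue_measure R).
Local Notation mu := (lebesgue_rV d).
Local Notation xt := (lebesgue_xt R d).
Implicit Types (U V W G : spacetime -> R).

Let mO : measurable Omega := measurable_domain oO.
Let mC : measurable cyl := measurable_cylinder oO T.

Lemma test_function_slice (phi : spacetime -> R) (x : 'rV[R]_d) : test_function cyl phi ->
  test_function It (fun s : measurableTypeR R => phi (x, s)).
Proof.
have cA : continuous (fun s : measurableTypeR R => (x, s) : spacetime).
  by move=> s; apply: (cvg_pair (cvg_cst x) cvg_id).
move=> [sphi [K [cK KC phi0]]]; split.
  move=> k.
  apply: (Ck_affine (A := fun s : measurableTypeR R => (x, s) : spacetime)
    (A0 := fun s : measurableTypeR R => (0, s) : spacetime) cA _ (sphi k)).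
  by move=> s v t; congr pair; rewrite /= scaler0 add0r.
exists [set s | K (x, s)]; split.
- have clK : closed K by apply: compact_closed cK; exact: norm_hausdorff.
  have cl : closed [set s : measurableTypeR R | K (x, s)].
    by apply: (@closed_comp _ _ (fun s : measurableTypeR R => (x, s) : spacetime)) => // s _; exact: cA.
  apply: (subclosed_compact cl (@segment_compact R 0 T)) => s /= /KC[_ /=].
  by rewrite /time_interval /= !in_itv/= => /andP[/ltW-> /ltW->].
- by move=> s /= /KC[].
- by move=> s nK; apply: phi0.
Qed.

Lemma derive_slice (phi : spacetime -> R) (x : 'rV[R]_d) (s : measurableTypeR R) :
  'D_((0, 1) : spacetime) phi (x, s) = 'D_1 (fun t : measurableTypeR R => phi (x, t)) s.
Proof.
rewrite /derive.
have -> // : (fun h : R => h^-1 *: ((phi \o shift ((x, s) : spacetime)) (h *: ((0, 1) : spacetime))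
    - phi (x, s))) =
  (fun h : R => h^-1 *: (((fun t : measurableTypeR R => phi (x, t)) \o shift s)
    (h *: (1 : measurableTypeR R)) - phi (x, s))).
apply/funext => h /=; congr (_ *: (phi _ - _)).
by congr pair; rewrite /= scaler0 add0r.
Qed.

Lemma L2xt_derive_test phi : test_function cyl phi ->
  L2xt Omega T ('D_((0, 1) : spacetime) phi).
Proof. move=> tphi; exact: (test_function_L2xt oO bO (test_function_derive _ tphi)). Qed.

(** The time derivative falls on the factor that depends on time: for a fixed point of the
    domain, a test function of the cylinder is a test function of the time interval. *)
Lemma weak_dt_tensor (v : 'rV[R]_d -> R) (u g : measurableTypeR R -> R) phi :
  L2x Omega v -> L2t T u -> is_weak_deriv T u g -> test_function cyl phi ->
  dotL2 xt cyl (fun z => v z.1 * u z.2) ('D_((0, 1) : spacetime) phi) =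
  - dotL2 xt cyl (fun z => v z.1 * g z.2) phi.
Proof.
move=> Lv Lu [Lg H] tphi.
have I1 := sqiM_integrable mC (sqi_tensor mO (measurable_time T) Lv Lu) (L2xt_derive_test tphi).
have I2 := sqiM_integrable mC (sqi_tensor mO (measurable_time T) Lv Lg) (test_function_L2xt oO bO tphi).
have Lphi x := test_function_L2t (test_function_slice x tphi).
rewrite /dotL2 /lebesgue_xt /cylinder (Rintegral_fubini1 mO (measurable_time T) I1).
rewrite -mulN1r -RintegralZl// (Rintegral_fubini1 mO (measurable_time T) (integrableZR mC (-1) I2)).
apply: eq_Rintegral => x _.
transitivity (v x * dotL2 leb It u ('D_1 (fun t : measurableTypeR R => phi (x, t)))).
  rewrite /dotL2 -RintegralZl//; last first.
    exact: (sqiM_integrable (measurable_time T) Lu (L2t_derive_test (test_function_slice x tphi))).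
  by apply: eq_Rintegral => s _; rewrite derive_slice mulrA.
rewrite H; last exact: test_function_slice.
rewrite mulrN -mulNr /dotL2 -RintegralZl//; last first.
  exact: (sqiM_integrable (measurable_time T) Lg (Lphi x)).
by apply: eq_Rintegral => s _; rewrite mulN1r mulNr mulrA.
Qed.

Lemma weak_dt_unique U G1 G2 : is_weak_dt Omega T U G1 -> is_weak_dt Omega T U G2 ->
  ae_eq xt cyl G1 G2.
Proof.
move=> [L1 H1] [L2 H2].
have L12 := sqiB mC L1 L2.
have : ae_eq xt cyl (fun z => G1 z - G2 z) (cst 0).
  apply: (L2xt_orthogonal_eq0 oO bO L12) => phi tphi.
  rewrite (dotL2Bl mC L1 L2 (test_function_L2xt oO bO tphi)).
  by apply/eqP; rewrite subr_eq0 -eqr_opp -H1// -H2.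
by apply: filterS => z H /H /= /eqP; rewrite subr_eq0 => /eqP.
Qed.

Section modal.
Variables (n : nat) (e : 'I_n -> 'rV[R]_d -> R).
Hypothesis e_L2 : forall k, L2x Omega (e k).
Implicit Types u g : 'I_n -> measurableTypeR R -> R.

Lemma modal_L2xt u : (forall k, L2t T (u k)) -> L2xt Omega T (modal e u).
Proof.
move=> Lu.
have := sqi_sum mC (index_enum 'I_n) (fun=> 1)
  (fun k => sqi_tensor mO (measurable_time T) (e_L2 k) (Lu k)).
congr square_integrable; apply/funext => z; apply: eq_bigr => k _.
by rewrite mul1r mulrC.
Qed.

Lemma weak_dt_modal U u g : L2xt Omega T U -> ae_eq xt cyl U (modal e u) ->
  (forall k, L2t T (u k)) -> (forall k, is_weak_deriv T (u k) (g k)) ->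
  L2xt Omega T (weak_dt Omega T U) /\ ae_eq xt cyl (weak_dt Omega T U) (modal e g).
Proof.
move=> LU Uu Lu ug; have Lg k : L2t T (g k) := (ug k).1.
have Hg : is_weak_dt Omega T U (modal e g).
  split; first exact: modal_L2xt.
  move=> phi tphi; have LD := L2xt_derive_test tphi; have Lphi := test_function_L2xt oO bO tphi.
  rewrite (ae_eq_dotL2 mC LU.1 (modal_L2xt Lu).1 LD.1 LD.1 Uu (ae_eq_refl _ _ _)).
  have E (w : 'I_n -> measurableTypeR R -> R) psi : (forall k, L2t T (w k)) -> L2xt Omega T psi ->
      dotL2 xt cyl (modal e w) psi =
      \sum_k dotL2 xt cyl (fun z => e k z.1 * w k z.2) psi.
    move=> Lw Lpsi.
    have -> : modal e w = (fun z => \sum_k 1 * (e k z.1 * w k z.2)).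
      by apply/funext => z; apply: eq_bigr => k _; rewrite mul1r mulrC.
    rewrite (dotL2_suml mC (index_enum 'I_n) (fun=> 1)
      (fun k => sqi_tensor mO (measurable_time T) (e_L2 k) (Lw k)) Lpsi).
    by apply: eq_bigr => k _; rewrite mul1r.
  rewrite !E// -sumrN; apply: eq_bigr => k _; exact: weak_dt_tensor.
have Hw : is_weak_dt Omega T U (weak_dt Omega T U).
  by apply: (@xgetPex _ (fun=> 0) [set G | is_weak_dt Omega T U G]); exists (modal e g).
by split; [case: Hw | exact: weak_dt_unique Hw Hg].
Qed.

Variable Sx : set ('rV[R]_d -> R).
Hypothesis Se : forall k, Sx (e k).
Variable Y : set (measurableTypeR R -> R).
Hypothesis Y_L2 : forall w : measurableTypeR R -> R, Y w -> L2t T w.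

Lemma modal_tensor U u : L2xt Omega T U -> ae_eq xt cyl U (modal e u) -> (forall k, Y (u k)) ->
  tensor Omega T Sx Y U.
Proof.
move=> LU Uu Yu; split=> //; exists n, e, u; split=> //.
apply: filterS Uu => z H Dz; rewrite H//; apply: eq_bigr => k _; exact: mulrC.
Qed.

Hypothesis Y_sum : forall m (a : 'I_m -> R) (u : 'I_m -> measurableTypeR R -> R),
  (forall k, Y (u k)) -> Y (fun s => \sum_k a k * u k s).
Hypothesis e_span : forall v, Sx v -> ae_eq mu Omega v (synth e (fun k => dotx Omega v (e k))).

Lemma tensor_modal U : tensor Omega T Sx Y U -> exists u : 'I_n -> measurableTypeR R -> R,
  [/\ L2xt Omega T U, forall k, Y (u k), forall k, L2t T (u k) & ae_eq xt cyl U (modal e u)].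
Proof.
move=> [LU [m [v [u [Sv Yu Uvu]]]]].
exists (fun k s => \sum_j dotx Omega (v j) (e k) * u j s).
have Yk k : Y (fun s => \sum_j dotx Omega (v j) (e k) * u j s) by exact: Y_sum.
split=> // [k|]; first exact: Y_L2.
have H : {ae xt, forall z, forall j, Omega z.1 ->
    v j z.1 = synth e (fun k => dotx Omega (v j) (e k)) z.1}.
  apply: filter_forall => j.
  exact: (ae_product_fst leb (e_span (Sv j))).
apply: filterS (filterI Uvu H) => -[x s] [E F] /= Cxs; rewrite E//= /modal /synth /=.
under [RHS]eq_bigr do rewrite mulr_suml.
rewrite exchange_big /=; apply: eq_bigr => j _.
rewrite (F j); last by case: Cxs.
by rewrite /synth mulr_suml; apply: eq_bigr => k _; rewrite mulrAC.
Qed.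

End modal.
End time_derivatives.

(** * Minkowski's inequality for the energy of the modes *)

(** Minkowski's inequality for a nonnegative quadratic form: A and C are its values at two
    vectors, B is the value of its polar form. *)
Lemma le_sqr_add (R : realFieldType) (A B C X Y : R) :
  (forall t, 0 <= t ^+ 2 * A + 2 * t * B + C) -> 0 <= A -> 0 <= X -> 0 <= Y ->
  A <= X ^+ 2 -> C <= Y ^+ 2 -> A + 2 * B + C <= (X + Y) ^+ 2.
Proof.
move=> H A0 X0 Y0 AX CY.
have C0 : 0 <= C by have := H 0; rewrite expr0n/=; lra.
have BB := sqr_le_of_quadratic_ge0 H A0.
have BXY : B <= X * Y.
  have XY0 : 0 <= X * Y by exact: mulr_ge0.
  have [B0|B0] := lerP 0 B; last by apply: le_trans (ltW B0) _.
  rewrite -(@ler_pXn2r _ 2)// ?nnegrE// exprMn; apply: le_trans BB _.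
  by apply: ler_pM.
have -> : (X + Y) ^+ 2 = X ^+ 2 + 2 * (X * Y) + Y ^+ 2 by ring.
lra.
Qed.

Section mode_energy_form.
Context {R : realType} (T : R).
Hypothesis T0 : 0 < T.
Local Notation L2 := (L2t T).
Local Notation dot := (dot_w T).
Implicit Types g h : measurableTypeR R -> R.

Lemma dot_prim_quadratic a g h : L2 g -> L2 h ->
  dot (prim (fun s => a * g s + h s)) (prim (fun s => a * g s + h s)) =
  a ^+ 2 * dot (prim g) (prim g) + 2 * a * dot (prim g) (prim h) + dot (prim h) (prim h).
Proof.
move=> Lg Lh; rewrite -(dot_w_quadratic T0); [|exact: L2t_prim (L2t_integrable _)..].
apply: eq_Rintegral => s; rewrite inE /time_interval /= in_itv/= => /andP[_ /ltW sT].
have Ig := L2t_integrable Lg; have Ih := L2t_integrable Lh.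
by rewrite (primD sT (integrableZR (measurable_time T) a Ig) Ih) (primZ a sT Ig).
Qed.

Definition mode_product lam g1 h1 g2 h2 :=
  dot g1 g2 + lam^-1 * dot h1 h2 + lam * dot (prim g1) (prim g2) + dot (prim h1) (prim h2).

Lemma mode_energy_quadratic lam a g1 h1 g2 h2 : L2 g1 -> L2 h1 -> L2 g2 -> L2 h2 ->
  mode_energy T lam (fun s => a * g1 s + g2 s) (fun s => a * h1 s + h2 s) =
  a ^+ 2 * mode_energy T lam g1 h1 + 2 * a * mode_product lam g1 h1 g2 h2
  + mode_energy T lam g2 h2.
Proof.
move=> Lg1 Lh1 Lg2 Lh2; rewrite /mode_energy /mode_product.
rewrite (dot_w_quadratic T0 a Lg1 Lg2) (dot_w_quadratic T0 a Lh1 Lh2).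
rewrite (dot_prim_quadratic a Lg1 Lg2) (dot_prim_quadratic a Lh1 Lh2).
move: (lam^-1) => lami; ring_dots.
Qed.

Lemma mode_energy_ge0 lam g h : 0 < lam -> 0 <= mode_energy T lam g h.
Proof.
move=> l0; have l1 : 0 <= lam^-1 by rewrite invr_ge0 ltW.
by rewrite /mode_energy !addr_ge0// ?mulr_ge0// ?dot_w_ge0// ltW.
Qed.

(** Minkowski's inequality for the energy summed over the modes; the factor 1 is the scalar
    of [mode_solution_linear]. *)
Lemma sum_mode_energy_le n (lam : 'I_n -> R) (g1 h1 g2 h2 : 'I_n -> measurableTypeR R -> R) X Y :
  (forall k, 0 < lam k) ->
  (forall k, L2 (g1 k)) -> (forall k, L2 (h1 k)) ->
  (forall k, L2 (g2 k)) -> (forall k, L2 (h2 k)) -> 0 <= X -> 0 <= Y ->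
  \sum_k mode_energy T (lam k) (g1 k) (h1 k) <= X ^+ 2 ->
  \sum_k mode_energy T (lam k) (g2 k) (h2 k) <= Y ^+ 2 ->
  \sum_k mode_energy T (lam k) (fun s => 1 * g1 k s + g2 k s) (fun s => 1 * h1 k s + h2 k s)
    <= (X + Y) ^+ 2.
Proof.
move=> l0 Lg1 Lh1 Lg2 Lh2 X0 Y0 HX HY.
have E a : \sum_k mode_energy T (lam k) (fun s => a * g1 k s + g2 k s)
    (fun s => a * h1 k s + h2 k s) =
  a ^+ 2 * (\sum_k mode_energy T (lam k) (g1 k) (h1 k)) +
  2 * a * (\sum_k mode_product (lam k) (g1 k) (h1 k) (g2 k) (h2 k)) +
  \sum_k mode_energy T (lam k) (g2 k) (h2 k).
  rewrite 2!mulr_sumr -!big_split /=.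
  by apply: eq_bigr => k _; rewrite mode_energy_quadratic.
rewrite E expr1n mul1r mulr1; apply: le_sqr_add => // [t|].
  by rewrite -E; apply: sumr_ge0 => k _; exact: mode_energy_ge0.
by apply: sumr_ge0 => k _; exact: mode_energy_ge0.
Qed.

End mode_energy_form.

(** * Decoupling and solution of the discrete problem *)

Section mode_problems.
Context {R : realType} {d : nat} (Omega : set 'rV[R]_d).
Hypotheses (oO : open Omega) (bO : bounded_set Omega).
Variable T : R.
Hypothesis T0 : 0 < T.
Variable c : 'rV[R]_d -> R.
Hypothesis mc : measurable_fun Omega c.
Variable M : R.
Local Notation spacetime := ('rV[R]_d * measurableTypeR R)%type.
Local Notation It := (time_interval T).
Local Notation cyl := (cylinder Omega T).
Local Notation leb := (@lebesgue_measure R).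
Local Notation mu := (lebesgue_rV d).
Local Notation xt := (lebesgue_xt R d).
Hypothesis cM : {ae mu, forall x, Omega x -> `|c x| <= M}.
Variable Sx : set ('rV[R]_d -> R).
Hypothesis hSx : finite_dim_subspace mu Omega (H10x Omega) Sx.
Variable St : set (measurableTypeR R -> R).
Hypothesis hSt : finite_dim_subspace leb It (H10_left T) St.
Local Notation energy := (energy Omega c).
Variables (n : nat) (e : 'I_n -> 'rV[R]_d -> R) (lam : 'I_n -> R).
Hypothesis Se : forall k, Sx (e k).
Hypothesis e_orthonormal : forall k l, dotx Omega (e k) (e l) = (k == l)%:R.
Hypothesis e_energy : forall k l, energy (e k) (e l) = lam k * (k == l)%:R.
Hypothesis lam0 : forall k, 0 < lam k.
Hypothesis e_span : forall v, Sx v -> ae_eq mu Omega v (synth e (fun k => dotx Omega v (e k))).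
Variables (F : spacetime -> R) (U0 w V0 : 'rV[R]_d -> R).
Hypothesis LF : L2xt Omega T F.
Hypothesis HU0 : H10x Omega U0.
Hypothesis div_w : is_weak_div Omega (fun x => c x ^+ 2 *: weak_grad Omega U0 x) w.
Hypothesis HV0 : H10x Omega V0.
Local Notation D := (derivatives T St).
Local Notation dot := (dot_w T).

Let mO : measurable Omega := measurable_domain oO.
Let mC : measurable cyl := measurable_cylinder oO T.

(** Integrated by parts in space, the term of the initial displacement becomes the force w,
    the divergence of its flux. *)
Definition force : spacetime -> R := fun z => F z + time_independent w z.
Definition force_coef (k : 'I_n) : measurableTypeR R -> R := coef Omega e force k.
Definition velocity_coef (k : 'I_n) : R := dotx Omega V0 (e k).

Lemma divergence_L2x : L2x Omega w. Proof. by case: div_w. Qed.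
Lemma initial_velocity_L2x : L2x Omega V0. Proof. by case: HV0 => -[]. Qed.

Lemma force_L2xt : L2xt Omega T force.
Proof. exact: (sqiD mC LF (time_independent_L2xt oO T divergence_L2x)). Qed.

Lemma force_coef_L2t k : L2t T (force_coef k).
Proof. exact: (coef_L2t oO hSx Se e_orthonormal k force_L2xt). Qed.

Let eL2 k : L2x Omega (e k) := subspace_L2 hSx (Se k).

Lemma time_space_sum m (a : 'I_m -> R) (u : 'I_m -> measurableTypeR R -> R) :
  (forall k, St (u k)) -> St (fun s => \sum_k a k * u k s).
Proof.
case: hSt => _ S0 SD _ Su; elim: (index_enum _) => [|k r IH].
  by under eq_fun do rewrite big_nil.
by under eq_fun do rewrite big_cons; exact: SD.
Qed.

Definition expands (Y : set (measurableTypeR R -> R)) (U : spacetime -> R)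
    (u : 'I_n -> measurableTypeR R -> R) :=
  [/\ L2xt Omega T U, forall k, Y (u k), forall k, L2t T (u k) & ae_eq xt cyl U (modal e u)].

Lemma expands_exists_time U : Qh Omega T Sx St U -> exists u, expands St U u.
Proof.
move=> /(tensor_modal (time_space_L2 hSt) time_space_sum e_span)[u Hu]; by exists u.
Qed.

Lemma expands_exists_deriv L : dtQh Omega T Sx St L -> exists l, expands D L l.
Proof.
have D_sum m (a : 'I_m -> R) (u : 'I_m -> measurableTypeR R -> R) :
    (forall k, D (u k)) -> D (fun s => \sum_k a k * u k s).
  exact: (derivatives_sum hSt).
by move=> /(tensor_modal (@derivatives_L2 _ _ _) D_sum e_span)[l Hl]; exists l.
Qed.

Lemma rhs_modal L X l x : expands D L l -> expands D X x ->
  dot_e Omega T F L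
  - dotv_e Omega T (fun z => c z.1 ^+ 2 *: gradx Omega (time_independent U0) z) (gradx Omega L)
  - dot_e Omega T (time_independent V0) X =
  \sum_k dot (force_coef k) (l k) - \sum_k velocity_coef k * dot (fun=> 1) (x k).
Proof.
move=> [LL _ Ll El] [LX _ Lx Ex].
have Ltw := time_independent_L2xt oO T divergence_L2x; have LtV := time_independent_L2xt oO T initial_velocity_L2x.
have E v X' x' : L2x Omega v -> L2xt Omega T X' -> (forall k, L2t T (x' k)) ->
    ae_eq xt cyl X' (modal e x') -> dot_e Omega T (time_independent v) X' =
    \sum_k dotx Omega v (e k) * dot (fun=> 1) (x' k).
  move=> Lv LX' Lx' Ex'.
  rewrite (dot_e_coef oO T0 hSx Se e_orthonormal LX' Lx' Ex' (time_independent_L2xt oO T Lv)).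
  apply: eq_bigr => k _; have Lx1 := L2t_cst T (1 : R).
  rewrite -(dot_wZl T0 (dotx Omega v (e k)) Lx1 (Lx' k)).
  by apply: eq_Rintegral => s _; rewrite /coef /time_independent mulr1.
rewrite (E _ _ _ initial_velocity_L2x LX Lx Ex); congr (_ - _).
rewrite (dotv_e_time_independent oO bO T0 mc cM hSx Se LL Ll El HU0).
have -> : \sum_k energy U0 (e k) * dot (fun=> 1) (l k) = - dot_e Omega T (time_independent w) L.
  rewrite (E _ _ _ divergence_L2x LL Ll El) -sumrN; apply: eq_bigr => k _.
  by rewrite (weak_div_energy oO bO mc cM HU0 (subspace_H10x hSx (Se k)) div_w) mulNr.
rewrite opprK -(dot_eDl oO T0 LF Ltw LL).
exact: (dot_e_coef oO T0 hSx Se e_orthonormal LL Ll El force_L2xt).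
Qed.

Section trial.
Variables (U V : spacetime -> R) (u v g h : 'I_n -> measurableTypeR R -> R).
Hypotheses (EU : expands St U u) (EV : expands St V v).
Hypotheses (ug : forall k, is_weak_deriv T (u k) (g k)) (vh : forall k, is_weak_deriv T (v k) (h k)).

Let Lg k : L2t T (g k) := (ug k).1.
Let Lh k : L2t T (h k) := (vh k).1.

Lemma time_space_prim (u1 g1 : measurableTypeR R -> R) : St u1 -> is_weak_deriv T u1 g1 ->
  ae_eq leb It u1 (prim g1).
Proof. by move=> Su; apply: (H10_left_prim T0); case: hSt => /(_ _ Su). Qed.

Lemma dot_prim_trial (u1 g1 l1 : measurableTypeR R -> R) : St u1 -> is_weak_deriv T u1 g1 ->
  L2t T l1 -> dot u1 l1 = dot (prim g1) l1.
Proof.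
move=> Su ug1 Ll1; apply: (ae_eq_dot_w T0) => //.
- exact: (time_space_L2 hSt).
- exact: L2t_prim (L2t_integrable ug1.1).
- exact: time_space_prim.
- exact: ae_eq_refl.
Qed.

Lemma dot_prim_trial2 (u1 g1 : measurableTypeR R -> R) : St u1 -> is_weak_deriv T u1 g1 ->
  dot u1 u1 = dot (prim g1) (prim g1).
Proof.
move=> Su ug1; rewrite (dot_prim_trial Su ug1 (time_space_L2 hSt Su)) dot_wC.
exact: (dot_prim_trial Su ug1 (L2t_prim (L2t_integrable ug1.1))).
Qed.

Lemma weak_dt_U : L2xt Omega T (weak_dt Omega T U) /\ ae_eq xt cyl (weak_dt Omega T U) (modal e g).
Proof. by case: EU => LU _ Lu E; exact: (weak_dt_modal oO bO eL2 LU E Lu ug). Qed.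

Lemma weak_dt_V : L2xt Omega T (weak_dt Omega T V) /\ ae_eq xt cyl (weak_dt Omega T V) (modal e h).
Proof. by case: EV => LV _ Lv E; exact: (weak_dt_modal oO bO eL2 LV E Lv vh). Qed.

Lemma formA_modal L X l x : expands D L l -> expands D X x ->
  formA Omega T c U V L X =
  \sum_k (dot (h k) (l k) + lam k * dot (prim (g k)) (l k)) +
  \sum_k (- dot (g k) (x k) + dot (prim (h k)) (x k)).
Proof.
move=> [LL _ Ll El] [LX _ Lx Ex]; have [LU Su Lu Eu] := EU; have [LV Sv Lv Ev] := EV.
have [LdU EdU] := weak_dt_U; have [LdV EdV] := weak_dt_V.
rewrite /formA (dot_e_modal oO T0 hSx Se e_orthonormal LL Ll El LdV Lh EdV).
rewrite (dot_e_modal oO T0 hSx Se e_orthonormal LX Lx Ex LdU Lg EdU).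
rewrite (dot_e_modal oO T0 hSx Se e_orthonormal LX Lx Ex LV Lv Ev).
rewrite (dotv_e_modal oO bO T0 mc cM hSx Se e_energy LL Ll El LU Lu Eu).
rewrite !big_split /= sumrN -!addrA; congr (_ + _); congr (_ + _).
  by apply: eq_bigr => k _; rewrite (dot_prim_trial (Su k) (ug k) (Ll k)).
congr (_ + _).
by apply: eq_bigr => k _; rewrite (dot_prim_trial (Sv k) (vh k) (Lx k)).
Qed.

Lemma norm_V_modal : norm_V Omega T c Sx U V ^+ 2 = \sum_k mode_energy T (lam k) (g k) (h k).
Proof.
have [LU Su Lu Eu] := EU; have [LV Sv Lv Ev] := EV.
have [LdU EdU] := weak_dt_U; have [LdV EdV] := weak_dt_V.
rewrite /norm_V sqr_sqrtr; last by rewrite !addr_ge0// sqr_ge0.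
have E1 : norm_e Omega T (weak_dt Omega T U) ^+ 2 = \sum_k dot (g k) (g k).
  rewrite norm_e_sqr; exact: (dot_e_modal oO T0 hSx Se e_orthonormal LdU Lg EdU LdU Lg EdU).
have E2 := norm_newton_modal oO bO T0 mc cM hSx Se e_orthonormal e_energy lam0 e_span LdV Lh EdV.
have E3 := normv_e_modal oO bO T0 mc cM hSx Se e_energy LU Lu Eu.
have E4 : norm_e Omega T V ^+ 2 = \sum_k dot (v k) (v k).
  rewrite norm_e_sqr; exact: (dot_e_modal oO T0 hSx Se e_orthonormal LV Lv Ev LV Lv Ev).
transitivity (\sum_k dot (g k) (g k) + \sum_k (lam k)^-1 * dot (h k) (h k)
    + \sum_k lam k * dot (u k) (u k) + \sum_k dot (v k) (v k)).
  by congr (_ + _ + _ + _).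
rewrite -!big_split /=; apply: eq_bigr => k _; rewrite /mode_energy.
congr (_ + _ + _ * _ + _).
  exact: (dot_prim_trial2 (Su k) (ug k)).
exact: (dot_prim_trial2 (Sv k) (vh k)).
Qed.

Lemma expands_modal (Y : set (measurableTypeR R -> R)) (l : 'I_n -> measurableTypeR R -> R) :
  (forall k, Y (l k)) -> (forall k, L2t T (l k)) -> expands Y (modal e l) l.
Proof. move=> Yl Ll; split=> //; [exact: (modal_L2xt oO eL2) | exact: ae_eq_refl]. Qed.

Lemma expands_dtQh L l : expands D L l -> dtQh Omega T Sx St L.
Proof. by case=> LL Dl _ El; exact: (modal_tensor Se LL El Dl). Qed.

Lemma expands_Qh L l : expands St L l -> Qh Omega T Sx St L.
Proof. by case=> LL Dl _ El; exact: (modal_tensor Se LL El Dl). Qed.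

(** Products of some e k and a function of time span the test space, and orthogonality
    leaves the equation of the mode k only. *)
Lemma discrete_solution_modes : (forall k, D (g k)) -> (forall k, D (h k)) ->
  discrete_solution Omega T c Sx St F U0 V0 U V <->
  forall k, mode_solution T St (lam k) (force_coef k) (velocity_coef k) (g k) (h k).
Proof.
move=> Dg Dh; split; last first.
  move=> H; split; [exact: expands_Qh EU|exact: expands_Qh EV|].
  move=> L X /expands_exists_deriv[l El] /expands_exists_deriv[x Ex].
  rewrite (formA_modal El Ex) (rhs_modal El Ex); congr (_ + _).
    by case: El => _ Dl _ _; apply: eq_bigr => k _; have [_ _ -> //] := H k; exact: Dl.
  rewrite -sumrN; case: Ex => _ Dx _ _; apply: eq_bigr => k _.
  by have [_ _ _ ->] := H k; [rewrite mulNr|exact: Dx].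
move=> [_ _ H] k.
have D0 := derivatives0 hSt.
pose at_k l (j : 'I_n) : measurableTypeR R -> R := if j == k then l else fun=> 0.
have Dat l : D l -> forall j, D (at_k l j) by move=> Dl j; rewrite /at_k; case: eqP.
have Eat l : D l -> expands D (modal e (at_k l)) (at_k l).
  move=> Dl; apply: expands_modal => j; first exact: Dat.
  exact: (derivatives_L2 (Dat _ Dl j)).
have dot0 (f : measurableTypeR R -> R) : dot f (fun=> 0) = 0.
  by rewrite dot_wC dot_wE; exact: dotL2_0l.
have sum_at (f : 'I_n -> (measurableTypeR R -> R) -> R) l : (forall j, f j (fun=> 0) = 0) ->
    \sum_j f j (at_k l j) = f k l.
  move=> f0; rewrite (bigD1 k)//= /at_k eqxx big1 ?addr0// => j /negPf->; exact: f0.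
have test l x : D l -> D x -> dot (h k) l + lam k * dot (prim (g k)) l
    + (- dot (g k) x + dot (prim (h k)) x) =
    dot (force_coef k) l - velocity_coef k * dot (fun=> 1) x.
  move=> Dl Dx; have := H _ _ (expands_dtQh (Eat _ Dl)) (expands_dtQh (Eat _ Dx)).
  rewrite (formA_modal (Eat _ Dl) (Eat _ Dx)) (rhs_modal (Eat _ Dl) (Eat _ Dx)).
  rewrite (sum_at (fun j y => dot (h j) y + lam j * dot (prim (g j)) y)); last first.
    by move=> j; rewrite !dot0 mulr0 addr0.
  rewrite (sum_at (fun j y => - dot (g j) y + dot (prim (h j)) y)); last first.
    by move=> j; rewrite !dot0 oppr0 addr0.
  rewrite (sum_at (fun j y => dot (force_coef j) y)) => [|j]; last exact: dot0.
  by rewrite (sum_at (fun j y => velocity_coef j * dot (fun=> 1) y)) => [|j]; rewrite ?dot0 ?mulr0.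
split; [exact: Dg|exact: Dh|move=> l Dl..].
  by have := test _ _ Dl D0; rewrite !dot0 mulr0 oppr0 !addr0.
by have := test _ _ D0 Dl; rewrite !dot0 mulr0 !add0r mulNr.
Qed.

End trial.

(** Bessel's inequality in space-time: the projection P of the force satisfies
    (force, P) = (P, P), so that Cauchy-Schwarz bounds its norm. *)
Lemma sum_force_coef_le : \sum_k dot (force_coef k) (force_coef k) <= norm_e Omega T force ^+ 2.
Proof.
have Lf := force_coef_L2t.
pose P := modal e force_coef; have LP : L2xt Omega T P := modal_L2xt oO eL2 Lf.
have PP : ae_eq xt cyl P (modal e force_coef) by exact: ae_eq_refl.
have E1 := dot_e_coef oO T0 hSx Se e_orthonormal LP Lf PP force_L2xt.
have E2 := dot_e_modal oO T0 hSx Se e_orthonormal LP Lf PP LP Lf PP.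
rewrite -/force_coef in E1; rewrite norm_e_sqr.
have CS := dotL2_CS mC (half_weight_L2xt oO T0 force_L2xt) (half_weight_L2xt oO T0 LP).
rewrite -(dot_eE oO T0 force_L2xt LP) -(dot_eE oO T0 force_L2xt force_L2xt)
  -(dot_eE oO T0 LP LP) in CS.
have EE : dot_e Omega T force P = \sum_k dot (force_coef k) (force_coef k) by exact: E1.
rewrite EE E2 in CS.
apply: le_of_sqr_le_mul CS; first by apply: sumr_ge0 => k _; exact: dot_w_ge0.
by rewrite -norm_e_sqr sqr_ge0.
Qed.

Variable kap : R.
Hypothesis kap_lam : forall k, 1 <= kap ^+ 2 * lam k.
Hypothesis kap_V0 : dotx Omega V0 V0 <= kap ^+ 2 * energy V0 V0.
Local Notation K := (2 * Num.sqrt (kap ^+ 2 + 4 * T ^+ 2)).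

Let K_sqr : K ^+ 2 = 4 * (kap ^+ 2 + 4 * T ^+ 2).
Proof.
rewrite exprMn sqr_sqrtr; first by rewrite -natrX.
by rewrite addr_ge0 ?sqr_ge0// mulr_ge0// sqr_ge0.
Qed.

Let K_ge0 : 0 <= K. Proof. by rewrite mulr_ge0// sqrtr_ge0. Qed.

Lemma forced_part_le (g h : 'I_n -> measurableTypeR R -> R) :
  (forall k, mode_solution T St (lam k) (force_coef k) 0 (g k) (h k)) ->
  \sum_k mode_energy T (lam k) (g k) (h k) <= (K * norm_e Omega T force) ^+ 2.
Proof.
move=> H; rewrite exprMn K_sqr.
have k0 : 0 <= 4 * (kap ^+ 2 + 4 * T ^+ 2) by rewrite -K_sqr sqr_ge0.
apply: le_trans (ler_wpM2l k0 sum_force_coef_le).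
rewrite mulr_sumr; apply: ler_sum => k _.
exact: (mode_solution_forced T0 (lam0 k) (kap_lam k) (force_coef_L2t k) (H k)).
Qed.

Lemma initial_part_le (g h : 'I_n -> measurableTypeR R -> R) :
  (forall k, mode_solution T St (lam k) (fun=> 0) (velocity_coef k) (g k) (h k)) ->
  \sum_k mode_energy T (lam k) (g k) (h k) <=
  (K * (Num.sqrt T * normv_x Omega (fun x => c x *: weak_grad Omega V0 x))) ^+ 2.
Proof.
move=> H; rewrite exprMn K_sqr exprMn -energy_sqr sqr_sqrtr ?(ltW T0)//.
have B := bessel oO hSx Se e_orthonormal initial_velocity_L2x.
have En := energy_ge0 Omega c V0.
apply: (@le_trans _ _ (4 * T * dotx Omega V0 V0)).
  have T4 : 0 <= 4 * T by rewrite mulr_ge0// ltW.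
  apply: le_trans (ler_wpM2l T4 B); rewrite mulr_sumr; apply: ler_sum => k _.
  rewrite -mulrA; exact: (mode_solution_initial T0 (lam0 k) (H k)).
have TE : 0 <= T * energy V0 V0 by rewrite mulr_ge0// ltW.
have T2 : 0 <= 16 * T ^+ 2 * (T * energy V0 V0) by rewrite mulr_ge0// mulr_ge0// sqr_ge0.
have T4 : 0 <= 4 * T by rewrite mulr_ge0// ltW.
apply: le_trans (ler_wpM2l T4 kap_V0) _.
move: T2; move: (energy V0 V0) => E; lra.
Qed.

(** Each mode is the sum of its response to the force and of its response to the initial
    velocity. The two families are bounded separately and added by Minkowski's
    inequality. *)
Lemma exists_unique_discrete_solution : exists U V : spacetime -> R,
  [/\ discrete_solution Omega T c Sx St F U0 V0 U V,
      forall U' V', discrete_solution Omega T c Sx St F U0 V0 U' V' ->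
        ae_eq xt cyl U' U /\ ae_eq xt cyl V' V &
      norm_V Omega T c Sx U V <= K * (norm_e Omega T F + Num.sqrt T * normx Omega w
        + Num.sqrt T * normv_x Omega (fun x => c x *: weak_grad Omega V0 x))].
Proof.
have Lf := force_coef_L2t.
have /choice[g1 /choice[h1 H1]] := fun k => mode_solution_exists T0 hSt 0 (lam0 k) (Lf k).
have /choice[g2 /choice[h2 H2]] := fun k =>
  mode_solution_exists T0 hSt (velocity_coef k) (lam0 k) (L2t_cst T 0).
pose g k s := 1 * g1 k s + g2 k s; pose h k s := 1 * h1 k s + h2 k s.
have H k : mode_solution T St (lam k) (force_coef k) (velocity_coef k) (g k) (h k).
  have := mode_solution_linear T0 hSt 1 (Lf k) (L2t_cst T 0) (H1 k) (H2 k).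
  rewrite mulr0 add0r; congr mode_solution.
  by apply/funext => s; rewrite mul1r addr0.
have Dg k : D (g k) by have [] := H k.
have Dh k : D (h k) by have [] := H k.
have /choice[u Hu] : forall k, exists u, St u /\ is_weak_deriv T u (g k).
  by move=> k; have [u] := Dg k; exists u.
have /choice[v Hv] : forall k, exists v, St v /\ is_weak_deriv T v (h k).
  by move=> k; have [v] := Dh k; exists v.
have EU : expands St (modal e u) u.
  by apply: expands_modal => k; [exact: (Hu k).1|exact: (time_space_L2 hSt (Hu k).1)].
have EV : expands St (modal e v) v.
  by apply: expands_modal => k; [exact: (Hv k).1|exact: (time_space_L2 hSt (Hv k).1)].
have ug k := (Hu k).2; have vh k := (Hv k).2.
exists (modal e u), (modal e v); split.
- by apply/(discrete_solution_modes EU EV ug vh Dg Dh).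
- move=> U' V' sol; have [/expands_exists_time[u' EU'] /expands_exists_time[v' EV'] _] := sol.
  have [_ Su' _ Eu'] := EU'; have [_ Sv' _ Ev'] := EV'.
  have has_deriv (y : measurableTypeR R -> R) : St y -> exists z, is_weak_deriv T y z.
    by case: hSt => SH _ _ _ /SH[].
  have /choice[g' ug'] := fun k => has_deriv _ (Su' k).
  have /choice[h' vh'] := fun k => has_deriv _ (Sv' k).
  have Dg' k : D (g' k) by exists (u' k).
  have Dh' k : D (h' k) by exists (v' k).
  have H' := (discrete_solution_modes EU' EV' ug' vh' Dg' Dh').1 sol.
  have null k : ae_eq leb It (g k) (g' k) /\ ae_eq leb It (h k) (h' k).
    have := mode_solution_linear T0 hSt (-1) (Lf k) (Lf k) (H k) (H' k).
    have -> : (fun s => -1 * force_coef k s + force_coef k s) = (fun=> 0).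
      by apply/funext => s; rewrite mulN1r addNr.
    rewrite mulN1r addNr => /(mode_solution_unique T0 (lam0 k))[Zg Zh].
    have E (x y : R) : -1 * x + y = 0 -> x = y.
      by rewrite mulN1r addrC => /eqP; rewrite subr_eq0 => /eqP.
    by split; [move: Zg | move: Zh]; apply: filterS => s Z Is; apply/E/Z.
  have same (y1 y2 z1 z2 : measurableTypeR R -> R) : St y1 -> St y2 ->
      is_weak_deriv T y1 z1 -> is_weak_deriv T y2 z2 -> ae_eq leb It z1 z2 ->
      {ae leb, forall s, It s -> y1 s = y2 s}.
    move=> S1 S2 d1 d2 z12.
    apply: filterS (filterI (time_space_prim S1 d1) (time_space_prim S2 d2)) => s [p1 p2] Is.
    rewrite p1// p2//; apply: (@ae_eq_prim _ _ _ T) => //; try exact: (L2t_integrable d1.1).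
      by move: Is; rewrite /time_interval /= in_itv/= => /andP[_ /ltW].
    exact: (L2t_integrable d2.1).
  have same_modal (X : spacetime -> R) (y1 y2 : 'I_n -> measurableTypeR R -> R) :
      (forall k, {ae leb, forall s, It s -> y1 k s = y2 k s}) ->
      ae_eq xt cyl X (modal e y2) -> ae_eq xt cyl X (modal e y1).
    move=> Y12; have A : {ae xt, forall z, forall k, It z.2 -> y1 k z.2 = y2 k z.2}.
      by apply: filter_forall => k; exact: (ae_product_snd _ (Y12 k)).
    apply: filterS2 A => z A E Cz; rewrite E//; apply: eq_bigr => k _.
    by rewrite A//; case: Cz.
  split.
    apply: same_modal Eu' => k.
    exact: (same _ _ _ _ (Hu k).1 (Su' k) (ug k) (ug' k) (null k).1).
  apply: same_modal Ev' => k.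
  exact: (same _ _ _ _ (Hv k).1 (Sv' k) (vh k) (vh' k) (null k).2).
have n0 : 0 <= norm_V Omega T c Sx (modal e u) (modal e v) by exact: sqrtr_ge0.
set Y := Num.sqrt T * normv_x Omega (fun x => c x *: weak_grad Omega V0 x).
have Y0 : 0 <= Y by rewrite mulr_ge0// sqrtr_ge0.
have X0 : 0 <= norm_e Omega T force by exact: sqrtr_ge0.
have KX0 : 0 <= K * norm_e Omega T force by exact: mulr_ge0.
have KY0 : 0 <= K * Y by exact: mulr_ge0.
apply: (@le_trans _ _ (K * (norm_e Omega T force + Y))).
  rewrite -(@ler_pXn2r _ 2)// ?nnegrE ?mulr_ge0 ?addr_ge0//.
  rewrite (norm_V_modal EU EV ug vh) mulrDr.
  apply: sum_mode_energy_le => //.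
  - by move=> k; have [/derivatives_L2] := H1 k.
  - by move=> k; have [_ /derivatives_L2] := H1 k.
  - by move=> k; have [/derivatives_L2] := H2 k.
  - by move=> k; have [_ /derivatives_L2] := H2 k.
  - exact: (forced_part_le H1).
  - exact: (initial_part_le H2).
rewrite ler_wpM2l// lerD2r.
apply: le_trans (norm_eD oO T0 LF (time_independent_L2xt oO T divergence_L2x)) _.
rewrite lerD2l; exact: (norm_e_time_independent T0 divergence_L2x).
Qed.

End mode_problems.

(** * The discrete problem for the wave equation *)

Theorem corollary4p3 (R : realType) (d : nat) (hd : (1 <= d <= 3)%N)
  (Omega : set 'rV[R]_d) (hOmega : lipschitz_polytopal_domain Omega)
  (T : R) (hT : 0 < T)
  (c : 'rV[R]_d -> R) (hc_meas : measurable_fun Omega c)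
  (hc_bounded : exists M : R,
     {ae lebesgue_rV d, forall x, Omega x -> `|c x| <= M})
  (c0 : R) (hc0 : 0 < c0)
  (hc_lower : {ae lebesgue_rV d, forall x, Omega x -> c0 <= c x})
  (C_Omega : R) (hC_Omega : 0 < C_Omega)
  (hpoincare : poincare_constant Omega C_Omega)
  (Sx : set ('rV[R]_d -> R))
  (hSx : finite_dim_subspace (lebesgue_rV d) Omega (H10x Omega) Sx)
  (St : set (measurableTypeR R -> R))
  (hSt : finite_dim_subspace (@lebesgue_measure R) (time_interval T)
           (H10_left T) St)
  (F : 'rV[R]_d * measurableTypeR R -> R) (hF : L2xt Omega T F)
  (U0 : 'rV[R]_d -> R) (hU0 : H10x Omega U0)
  (hU0_div : has_L2_div Omega (fun x => c x ^+ 2 *: weak_grad Omega U0 x))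
  (V0 : 'rV[R]_d -> R) (hV0 : H10x Omega V0) :
  exists U V : 'rV[R]_d * measurableTypeR R -> R,
    [/\ discrete_solution Omega T c Sx St F U0 V0 U V,
        forall U' V', discrete_solution Omega T c Sx St F U0 V0 U' V' ->
          ae_eq (lebesgue_xt R d) (cylinder Omega T) U' U /\
          ae_eq (lebesgue_xt R d) (cylinder Omega T) V' V &
        norm_V Omega T c Sx U V <=
          2 * Num.sqrt (C_Omega ^+ 2 / c0 ^+ 2 + 4 * T ^+ 2) *
          (norm_e Omega T F
           + Num.sqrt T * normx Omega
               (weak_div Omega (fun x => c x ^+ 2 *: weak_grad Omega U0 x))
           + Num.sqrt T * normv_x Omega
               (fun x => c x *: weak_grad Omega V0 x))].

Proof.
have [_ oO _ bO _] := hOmega; have [M cM] := hc_bounded.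
have [n [e [lam [Se e1 e2 span]]]] := eigenbasis oO bO hc_meas cM hSx.
have HS v : Sx v -> H10x Omega v := subspace_H10x hSx (v := v).
have PE v : H10x Omega v -> dotx Omega v v <= (C_Omega / c0) ^+ 2 * energy Omega c v v.
  exact: (poincare_energy oO hc_meas cM hc0 hC_Omega hc_lower hpoincare).
have kap_lam k : 1 <= (C_Omega / c0) ^+ 2 * lam k.
  by have := PE _ (HS _ (Se k)); rewrite e1 e2 eqxx mulr1.
have kap0 : 0 < (C_Omega / c0) ^+ 2 by rewrite exprn_gt0// divr_gt0.
have lam0 k : 0 < lam k.
  by rewrite -(pmulr_rgt0 _ kap0); exact: lt_le_trans (kap_lam k).
have wP : is_weak_div Omega (fun x => c x ^+ 2 *: weak_grad Omega U0 x)
    (weak_div Omega (fun x => c x ^+ 2 *: weak_grad Omega U0 x)).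
  exact: (xgetPex (fun=> 0) hU0_div).
have [U [V [H1 H2 H3]]] := exists_unique_discrete_solution oO bO hT hc_meas cM hSx hSt
  Se e1 e2 lam0 span hF hU0 wP hV0 kap_lam (PE _ hV0).
by exists U, V; split => //; rewrite -expr_div_n.
Qed.
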